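(* The weighted perfect edge domination problem can be solved for $P_5$-free graphs in linear time in a robust way: there is an $O(|V(G)|+|E(G)|)$-time algorithm which, given an arbitrary graph $G$ with real edge weights, either outputs a perfect edge dominating set of $G$ of minimum total weight, or outputs an induced subgraph of $G$ isomorphic to $P_5$.
   Context: Graphs are finite, simple and undirected; $P_5$ is the path on 5 vertices and a graph is $P_5$-free if it has no induced $P_5$. An edge dominates itself and every edge sharing an endpoint with it. A set $P\subseteq E(G)$ is a perfect edge dominating set if every edge of $E(G)\setminus P$ is dominated by exactly one edge of $P$. The weight of a set of edges is the sum of the weights of its edges. *)

(* Defs.v *)
From HB Require Import structures.
From mathcomp Require Import all_boot all_order all_algebra.
From mathcomp Require Import reals.

Set Implicit Arguments.
Unset Strict Implicit.
Unset Printing Implicit Defensive.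

Import Order.TTheory GRing.Theory Num.Theory.

Local Open Scope ring_scope.

(** * Finite simple graphs and perfect edge domination *)

Record sgraph (V : finType) := SGraph {
  adj :> rel V;
  adj_sym : symmetric adj;
  adj_irr : irreflexive adj
}.

Section PerfectEdgeDomination.
Variables (V : finType) (G : sgraph V).

Definition edges : {set {set V}} :=
  [set f | [exists x, exists y, G x y && (f == [set x; y])]].

(* For edges [f] and [g], which are 2-element sets, this covers both [f = g]
   and [f], [g] sharing an endpoint. *)
Definition dominates (f g : {set V}) : bool := f :&: g != set0.

Definition perfect_edge_dominating (P : {set {set V}}) : bool :=
  (P \subset edges) &&
  [forall f in edges :\: P, #|[set g in P | dominates g f]| == 1%N].

Definition weight (R : realType) (w : {set V} -> R) (P : {set {set V}}) : R :=
  \sum_(f in P) w f.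

Definition min_weight_perfect_edge_dominating (R : realType)
    (w : {set V} -> R) (P : {set {set V}}) : Prop :=
  perfect_edge_dominating P /\
  forall Q, perfect_edge_dominating Q -> weight w P <= weight w Q.

End PerfectEdgeDomination.

Definition path_adj (k : nat) : rel 'I_k :=
  fun i j => (i.+1 == j :> nat) || (j.+1 == i :> nat).

Fact path_adj_sym k : symmetric (@path_adj k).
Proof. by move=> i j; rewrite /path_adj orbC. Qed.

Fact path_adj_irr k : irreflexive (@path_adj k).
Proof. by move=> i; rewrite /path_adj orbb gtn_eqF. Qed.

Definition path_graph (k : nat) : sgraph 'I_k :=
  SGraph (@path_adj_sym k) (@path_adj_irr k).

(* [f] is an isomorphism from [H] onto the subgraph of [G] induced by the
   image of [f]. *)
Definition induced_embedding (U V : finType) (H : sgraph U) (G : sgraph V)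
    (f : U -> V) : Prop :=
  injective f /\ forall x y, G (f x) (f y) = H x y.

(** * Programs and running time

    A uniform-cost random access machine presented as a structured
    imperative language.  Natural-number data only support addition,
    truncated subtraction, comparison and use as array indices; real data only
    support 0, addition, subtraction and comparison.  There are no real
    constants other than 0, no multiplication, and no conversion of reals to
    naturals.  A program mentions finitely many variables and arrays, so these
    can be interleaved in a single memory at the price of a constant factor. *)

Inductive nexp : Type :=
| NConst of nat
| NVar of nat
| NGet of nat & nexp
| NAdd of nexp & nexp
| NSub of nexp & nexp.

Inductive rexp : Type :=
| RZero
| RVar of nat
| RGet of nat & nexp
| RAdd of rexp & rexp
| RSub of rexp & rexp.

Inductive bexp : Type :=
| BNle of nexp & nexp
| BRle of rexp & rexp
| BNot of bexp
| BAnd of bexp & bexp.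

Inductive cmd : Type :=
| Skip
| NSet of nat & nexp
| NPut of nat & nexp & nexp
| RSet of nat & rexp
| RPut of nat & nexp & rexp
| Seq of cmd & cmd
| If of bexp & cmd & cmd
| While of bexp & cmd.

Fixpoint ncost (e : nexp) : nat :=
  match e with
  | NConst _ | NVar _ => 1
  | NGet _ i => (ncost i).+1
  | NAdd e1 e2 | NSub e1 e2 => (ncost e1 + ncost e2).+1
  end.

Fixpoint rcost (e : rexp) : nat :=
  match e with
  | RZero | RVar _ => 1
  | RGet _ i => (ncost i).+1
  | RAdd e1 e2 | RSub e1 e2 => (rcost e1 + rcost e2).+1
  end.

Fixpoint bcost (b : bexp) : nat :=
  match b with
  | BNle e1 e2 => (ncost e1 + ncost e2).+1
  | BRle e1 e2 => (rcost e1 + rcost e2).+1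
  | BNot b1 => (bcost b1).+1
  | BAnd b1 b2 => (bcost b1 + bcost b2).+1
  end.

Section Semantics.
Variable R : realType.

Record state := State {
  nvar : nat -> nat;
  narr : nat -> nat -> nat;
  rvar : nat -> R;
  rarr : nat -> nat -> R
}.

Fixpoint neval (s : state) (e : nexp) : nat :=
  match e with
  | NConst c => c
  | NVar x => nvar s x
  | NGet a i => narr s a (neval s i)
  | NAdd e1 e2 => (neval s e1 + neval s e2)%N
  | NSub e1 e2 => (neval s e1 - neval s e2)%N
  end.

Fixpoint reval (s : state) (e : rexp) : R :=
  match e with
  | RZero => 0
  | RVar x => rvar s x
  | RGet a i => rarr s a (neval s i)
  | RAdd e1 e2 => reval s e1 + reval s e2
  | RSub e1 e2 => reval s e1 - reval s e2
  end.

Fixpoint beval (s : state) (b : bexp) : bool :=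
  match b with
  | BNle e1 e2 => (neval s e1 <= neval s e2)%N
  | BRle e1 e2 => reval s e1 <= reval s e2
  | BNot b1 => ~~ beval s b1
  | BAnd b1 b2 => beval s b1 && beval s b2
  end.

Definition upd (T : Type) (f : nat -> T) (x : nat) (v : T) : nat -> T :=
  fun y => if y == x then v else f y.

Definition set_nvar (s : state) (x v : nat) : state :=
  State (upd (nvar s) x v) (narr s) (rvar s) (rarr s).
Definition set_narr (s : state) (a i v : nat) : state :=
  State (nvar s) (upd (narr s) a (upd (narr s a) i v)) (rvar s) (rarr s).
Definition set_rvar (s : state) (x : nat) (v : R) : state :=
  State (nvar s) (narr s) (upd (rvar s) x v) (rarr s).
Definition set_rarr (s : state) (a i : nat) (v : R) : state :=
  State (nvar s) (narr s) (rvar s) (upd (rarr s) a (upd (rarr s a) i v)).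

(* [exec c s s' t]: started in [s], [c] halts in [s'] after [t] elementary
   operations. *)
Inductive exec : cmd -> state -> state -> nat -> Prop :=
| ExecSkip s : exec Skip s s 1
| ExecNSet s x e :
    exec (NSet x e) s (set_nvar s x (neval s e)) (ncost e).+1
| ExecNPut s a i e :
    exec (NPut a i e) s (set_narr s a (neval s i) (neval s e))
         (ncost i + ncost e).+1
| ExecRSet s x e :
    exec (RSet x e) s (set_rvar s x (reval s e)) (rcost e).+1
| ExecRPut s a i e :
    exec (RPut a i e) s (set_rarr s a (neval s i) (reval s e))
         (ncost i + rcost e).+1
| ExecSeq s1 s2 s3 c1 c2 t1 t2 :
    exec c1 s1 s2 t1 -> exec c2 s2 s3 t2 ->
    exec (Seq c1 c2) s1 s3 (t1 + t2)
| ExecIfTrue s s' b c1 c2 t :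
    beval s b -> exec c1 s s' t ->
    exec (If b c1 c2) s s' (bcost b + t).+1
| ExecIfFalse s s' b c1 c2 t :
    ~~ beval s b -> exec c2 s s' t ->
    exec (If b c1 c2) s s' (bcost b + t).+1
| ExecWhileFalse s b c :
    ~~ beval s b -> exec (While b c) s s (bcost b).+1
| ExecWhileTrue s1 s2 s3 b c t1 t2 :
    beval s1 b -> exec c s1 s2 t1 -> exec (While b c) s2 s3 t2 ->
    exec (While b c) s1 s3 (bcost b + t1 + t2).+1.

(* Hence exhibiting one terminating run determines the behaviour of the
   program on that input. *)
Lemma exec_det c s s1 s2 t1 t2 :
  exec c s s1 t1 -> exec c s s2 t2 -> s1 = s2 /\ t1 = t2.
Proof.
move=> h; elim: h s2 t2 => {c s s1 t1}; intros;
  match goal with h : exec _ _ ?s2 ?t2 |- _ = ?s2 /\ _ = ?t2 => inversion h end;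
  subst; try by [];
  repeat match goal with
  | b1 : is_true (beval ?s ?b), b2 : is_true (~~ beval ?s ?b) |- _ =>
      by rewrite b1 in b2
  | ih : (forall s2 t2, exec ?c ?s s2 t2 -> _), h : exec ?c ?s _ _ |- _ =>
      case: (ih _ _ h) => ? ?; subst; clear ih
  end; by [].
Qed.

End Semantics.

(** * Input and output conventions *)

Section InputOutput.
Variables (R : realType) (n : nat) (G : sgraph 'I_n).
Implicit Types (es : seq ('I_n * 'I_n)) (w : {set 'I_n} -> R).

Definition edge_of (p : 'I_n * 'I_n) : {set 'I_n} := [set p.1; p.2].

(* [es] lists every edge of [G] exactly once, in any order and with either
   orientation. *)
Definition edge_list es : Prop := perm_eq (map edge_of es) (enum (edges G)).

(* Variables 0 and 1 hold the numbers of vertices and edges; cell [k] of the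
   natural-number arrays 0 and 1 and of the real array 0 holds the endpoints
   and the weight of the [k]-th edge.  Everything else is 0. *)
Definition input_state es w : state R :=
  State (nth 0%N [:: n; size es])
        (fun a => nth 0%N (nth [::] [:: [seq val p.1 | p <- es];
                                         [seq val p.2 | p <- es]] a))
        (fun=> 0)
        (fun a => nth 0 (nth [::] [:: [seq w (edge_of p) | p <- es]] a)).

(* The result is in the natural-number array 2, and variable 2 tells which
   kind of result it is: 0 for the characteristic vector of a set of edges,
   nonzero for the five successive vertices of an induced path. *)
Definition output_kind (s : state R) : nat := nvar s 2.

Definition output_edges es (s : state R) : {set {set 'I_n}} :=
  [set edge_of p | p in es & narr s 2 (index p es) != 0%N].

Definition output_induced_P5 (s : state R) : Prop :=
  exists f : 'I_5 -> 'I_n,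
    induced_embedding (path_graph 5) G f /\
    forall i : 'I_5, narr s 2 i = f i :> nat.

Definition correct_output es w (s : state R) : Prop :=
  if output_kind s == 0%N
  then min_weight_perfect_edge_dominating G w (output_edges es s)
  else output_induced_P5 s.

End InputOutput.

(* Main.v *)
Require Import Defs.
From mathcomp Require Import all_boot all_order all_algebra.
From mathcomp Require Import reals.
From mathcomp Require Import zify.

(** A perfect edge dominating set is determined by the set [W] of vertices that
    it does not cover: it consists of all edges avoiding [W], and [W] arises in
    this way iff every neighbour of a vertex of [W] lies outside [W] and has
    exactly one neighbour outside [W].

    A connected P5-free graph has a vertex [c] at distance at most 2 from all
    others; one such is, among the neighbours of an arbitrary root, one with
    most neighbours at distance 2 from the root.  Let L1 be the neighbourhood
    of [c] and L2 the rest.  Whether [c] is in [W], has a neighbour in [W], or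
    neither, the trace of [W] on L1 and L2 has one of a few shapes, governed by
    one pivot vertex, and either the pivot can be taken from a bounded list or
    it may be replaced by the lightest of its false twins; otherwise an
    induced P5 through [c] shows up.  So it suffices to test a bounded number of
    candidates in every component.

    Every step is a fixed number of sweeps over the vertices or the edge list,
    applied to all components simultaneously, with components labelled by
    their largest vertex: in a P5-free graph three rounds of propagation to
    neighbours suffice, and a failure of this yields an induced P5. *)

Set Implicit Arguments.
Unset Strict Implicit.
Unset Printing Implicit Defensive.

Import Order.TTheory GRing.Theory Num.Theory.

(** * Linear-time sweeps *)

Section Machine.
Variable R : realType.

(** Nothing is assumed about [G]. Correctness rests on a single hypothesis, [noP5]: none of seven
    five-tuples computed along the way is an induced P5. Each structural fact is proved by showing
    that its failure would turn one of these tuples into a P5, so no search over five-vertex sets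
    takes place. The obstacle is the machine: edges arrive in arbitrary order, and all components
    are served by the same sweeps. Hence a chosen vertex is an array of bits with at most one bit
    set per component, adjacency to it is the existence of a neighbour whose bit is set, and
    non-adjacency to some vertex of a set is detected by comparing the number of neighbours in the
    set with its size in the component. Weights may have any sign, so sizes of dominating sets carry
    no information: every admissible [W] is shown, on each component, either to be one of the
    candidates or to be matched by one whose pivot is a twin of at most the same weighted degree. *)

Record inst := Inst {
  isz : nat;
  igr : sgraph 'I_isz;
  iwt : {set 'I_isz} -> R;
  ies : seq ('I_isz * 'I_isz);
  iok : edge_list igr ies
}.

Implicit Types (I : inst) (s : state R).

Definition input I : state R := input_state (ies I) (@iwt I).
Definition isize I : nat := (isz I + size (ies I)).+1.

(* Array 2 is left out so that writing the result preserves every invariant. *)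
Definition frame k s s' : Prop :=
  forall a, (a < k)%N && (a != 2) -> narr s' a =1 narr s a /\ rarr s' a =1 rarr s a.

(** The arrays from [k] on are zero because a sweep accumulates into a fresh array, whose initial
    content serves as the neutral element. *)
Definition clean k I s : Prop :=
  [/\ nvar s 0 = isz I, nvar s 1 = size (ies I), frame 2 (input I) s &
      forall a, (k <= a)%N -> narr s a =1 (fun=> 0%N) /\ rarr s a =1 (fun=> 0%R)].

Lemma frame_trans k s1 s2 s3 : frame k s1 s2 -> frame k s2 s3 -> frame k s1 s3.
Proof.
move=> h12 h23 a ak; have [n12 r12] := h12 a ak; have [n23 r23] := h23 a ak.
by split=> j; rewrite ?n23 ?r23 ?n12 ?r12.
Qed.

Lemma frame_le k k' s s' : (k <= k')%N -> frame k' s s' -> frame k s s'.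
Proof. by move=> kk' h a /andP[ak a2]; apply: h; rewrite a2 (leq_trans ak). Qed.

(* A quantity is available when, above any array index [k], some linear-time
   program fragment establishes it without touching the arrays below [k]; the
   parameter [x] records where the fragment has put its results. *)
Definition avail (X : Type) (Phi : X -> inst -> state R -> Prop) : Prop :=
  forall k, (2 < k)%N -> exists (c : cmd) (C k' : nat) (x : X), [/\ (k <= k')%N,
    (forall I s s', frame k' s s' -> Phi x I s -> Phi x I s') &
    forall I s, clean k I s -> exists s' t,
      [/\ exec c s s' t, (t <= C * isize I)%N, clean k' I s', frame k s s' & Phi x I s']].

(** The second fragment works above the arrays of the first, whose results therefore survive. *)
Lemma avail_and X Y (Phi : X -> inst -> state R -> Prop) (Psi : Y -> inst -> state R -> Prop) :
  avail Phi -> avail Psi ->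
  avail (fun (xy : X * Y) I s => Phi xy.1 I s /\ Psi xy.2 I s).
Proof.
move=> hX hY k k3.
have [c1 [C1 [k1 [x [kk1 st1 run1]]]]] := hX k k3.
have [c2 [C2 [k2 [y [kk2 st2 run2]]]]] := hY k1 (leq_trans k3 kk1).
exists (Seq c1 c2), (C1 + C2)%N, k2, (x, y); split.
- exact: leq_trans kk2.
- move=> I s s' f [px py]; split; last exact: st2 f py.
  by apply: st1 px; apply: frame_le f.
move=> I s /run1 [s1 [t1 [e1 b1 cl1 f1 p1]]].
have [s2 [t2 [e2 b2 cl2 f2 p2]]] := run2 _ _ cl1.
exists s2, (t1 + t2)%N; split=> //.
- exact: ExecSeq e1 e2.
- by rewrite mulnDl leq_add.
- by apply: frame_trans f1 _; apply: frame_le f2.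
- by split=> //; apply: st1 p1.
Qed.

Lemma avail_true : avail (fun (_ : unit) _ _ => True).
Proof.
move=> k k3; exists Skip, 1%N, k, tt; split=> // I s cl; exists s, 1%N.
by split; rewrite ?mul1n //; constructor.
Qed.

Definition loop (b : nat) (c : cmd) : cmd :=
  Seq (NSet 3 (NConst 0))
      (While (BNot (BNle (NVar b) (NVar 3)))
             (Seq c (NSet 3 (NAdd (NVar 3) (NConst 1))))).

(** The overhead of 9 per iteration is 4 for the guard, 1 for the loop itself and 4 for the counter;
    the additional unit in [N.+1] absorbs the initialisation and the last test. *)
Lemma loop_rule (c : cmd) (b K N : nat) (Inv : nat -> state R -> Prop) s :
    (b < 2)%N -> nvar s b = N ->
    (forall i s, (i < N)%N -> nvar s 3 = i -> Inv i s -> exists s' t,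
       [/\ exec c s s' t, (t <= K)%N, nvar s' =1 nvar s & Inv i.+1 s']) ->
    (forall i s v, Inv i s -> Inv i (set_nvar s 3 v)) ->
    Inv 0%N s ->
  exists s' t, [/\ exec (loop b c) s s' t, (t <= (K + 9) * N.+1)%N,
    (forall x, x != 3 -> nvar s' x = nvar s x) & Inv N s'].
Proof.
move=> b2 sN body stab Inv0.
have b3 : b != 3 by move: b2; case: b {sN} => [|[|]].
suff run (d i : nat) s1 : i + d = N -> nvar s1 3 = i -> nvar s1 b = N -> Inv i s1 ->
    exists s' t,
    [/\ exec (While (BNot (BNle (NVar b) (NVar 3)))
              (Seq c (NSet 3 (NAdd (NVar 3) (NConst 1))))) s1 s' t,
        (t <= (K + 9) * d + 5)%N,
        (forall x, x != 3 -> nvar s' x = nvar s1 x) & Inv N s'].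
  have [] := run N 0%N (set_nvar s 3 0%N); rewrite ?add0n //=.
  - by rewrite /upd (negPf b3).
  - exact: stab.
  move=> s' [t [e1 b1 v1 I1]]; exists s', ((ncost (NConst 0)).+1 + t)%N; split=> //.
  - exact: ExecSeq (ExecNSet s 3 (NConst 0)) e1.
  - by rewrite /=; lia.
  - by move=> x x3; rewrite v1 //= /upd (negPf x3).
elim: d i s1 => [|d IH] i s1 iN s3 sb Ii.
  have -> : N = i by lia.
  exists s1, (bcost (BNot (BNle (NVar b) (NVar 3)))).+1; split=> //.
  - by constructor; rewrite /= negbK s3 sb; lia.
  - by rewrite /=; lia.
have [|s2 [t2 [e2 b2' v2 I2]]] := body i s1 _ s3 Ii; first by lia.
have [||||s' [t [e1 b1 v1 I1]]] := IH i.+1 (set_nvar s2 3 i.+1).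
- by lia.
- by rewrite /= /upd eqxx.
- by rewrite /= /upd (negPf b3) v2.
- exact: stab.
exists s', (bcost (BNot (BNle (NVar b) (NVar 3))) +
            (t2 + (ncost (NAdd (NVar 3) (NConst 1))).+1) + t).+1; split=> //.
- apply: (ExecWhileTrue (s2 := set_nvar s2 3 i.+1)) => //.
  + by rewrite /= s3 sb; lia.
  + apply: ExecSeq e2 _.
    suff -> : i.+1 = neval s2 (NAdd (NVar 3) (NConst 1)) by constructor.
    by rewrite /= v2 s3 addn1.
- by rewrite /= mulnS; lia.
- by move=> x x3; rewrite v1 //= /upd (negPf x3) v2.
Qed.

(* The cell [j] of an array after the updates [A[key i] := step i A[key i]], [i < N]. *)
Definition scat (T : Type) (N : nat) (key : nat -> nat) (step : nat -> T -> T)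
    (z : T) (j : nat) : T :=
  foldl (fun acc i => if key i == j then step i acc else acc) z (iota 0 N).

Lemma scatS T N key (step : nat -> T -> T) z j :
  scat N.+1 key step z j =
  if key N == j then step N (scat N key step z j) else scat N key step z j.
Proof. by rewrite /scat -addn1 iotaD foldl_cat add0n. Qed.

(** Coerced to a number, [b] is also the variable holding this bound, so it selects a sweep over the
    vertices or over the edge list. *)
Definition dim (b : bool) I := if b then size (ies I) else isz I.

Lemma clean_dim k I s (b : bool) : clean k I s -> nvar s b = dim b I.
Proof. by case: b => -[]. Qed.

Definition cN (F : inst -> nat -> nat) : Prop :=
  avail (fun (a : nat) I s => narr s a =1 F I).
Definition cR (F : inst -> nat -> R) : Prop :=
  avail (fun (a : nat) I s => rarr s a =1 F I).

(** Together with its real counterpart, the only loop shape of the computing phase: one conditional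
    write per index, which may read the array [k] being written. With the identity as key it is a
    map, with an endpoint as key an aggregate over neighbours, with a label as key an aggregate over
    components. *)
Lemma scatterN X (Phi : X -> inst -> state R -> Prop) (b : bool)
    (ke : X -> nexp) (bb : X -> nat -> bexp) (e1 e2 : X -> nat -> nexp)
    (key : inst -> nat -> nat) (step : inst -> nat -> nat -> nat) :
    avail Phi ->
    (forall x I s k i, (i < dim b I)%N -> nvar s 3 = i -> frame 2 (input I) s ->
       Phi x I s -> neval s (ke x) = key I i /\
       (if beval s (bb x k) then neval s (e1 x k) else neval s (e2 x k)) =
       step I i (narr s k (key I i))) ->
  cN (fun I => scat (dim b I) (key I) (step I) 0%N).
Proof.
move=> hX spec k k3.
have [c1 [C1 [k1 [x [kk1 st1 run1]]]]] := hX k k3.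
pose body := If (bb x k1) (NPut k1 (ke x) (e1 x k1)) (NPut k1 (ke x) (e2 x k1)).
pose K := (bcost (bb x k1) + (ncost (ke x) + ncost (e1 x k1) + ncost (e2 x k1)) + 2)%N.
exists (Seq c1 (loop b body)), (C1 + (K + 9))%N, k1.+1, k1; split.
- exact: leqW.
- by move=> I s s' f h j; rewrite (f k1 _).1 // leqnn; apply/eqP; lia.
move=> I s /run1 [s1 [t1 [ex1 b1 cl1 f1 p1]]].
pose Inv i s2 := [/\ frame k1 s1 s2, narr s2 k1 =1 scat i (key I) (step I) 0%N,
  rarr s2 k1 =1 (fun=> 0%R) &
  forall a, (k1 < a)%N -> narr s2 a =1 (fun=> 0%N) /\ rarr s2 a =1 (fun=> 0%R)].
have [n1 m1 in1 z1] := cl1.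
have b_lt2 : (b < 2)%N by case: (b).
have k1_2 : (2 <= k1)%N by lia.
have [|||s2 [t2 [ex2 b2 v2 [f2 h2 r2 z2]]]] :=
  @loop_rule body b K (dim b I) Inv s1 b_lt2 (clean_dim _ cl1).
- move=> i s2 ltiN s2i [f2 h2 r2 z2].
  have in2 : frame 2 (input I) s2 by apply: frame_trans in1 _; apply: frame_le f2.
  have [kE stE] := spec x I s2 k1 i ltiN s2i in2 (st1 _ _ _ f2 p1).
  exists (set_narr s2 k1 (key I i) (step I i (narr s2 k1 (key I i)))).
  have upd_a a : (a == k1) = false -> upd (narr s2) k1 (upd (narr s2 k1) (key I i)
         (step I i (narr s2 k1 (key I i)))) a = narr s2 a by rewrite /upd => ->.
  have : Inv i.+1 (set_narr s2 k1 (key I i) (step I i (narr s2 k1 (key I i)))).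
    split=> //=.
    - by move=> a ak /=; rewrite upd_a; [exact: f2 | case/andP: ak; lia].
    - by move=> j; rewrite /upd eqxx scatS -!h2 eq_sym; case: eqP => // ->.
    - by move=> a ak /=; rewrite upd_a; [exact: z2 | lia].
  move: stE; case: ifPn => [bT|bF] <- Inv'; rewrite -kE in Inv' *;
    eexists; split;
    [constructor=> //; constructor | | | | apply: ExecIfFalse => //; constructor | | |] => //;
    by rewrite /K; lia.
- by move=> i s2 v [].
- by split=> // [j|j|a ak]; [rewrite (z1 k1 _).1 | rewrite (z1 k1 _).2 | apply: z1; lia].
exists s2, (t1 + t2)%N; split=> //.
- exact: ExecSeq ex1 ex2.
- rewrite mulnDl leq_add //; apply: leq_trans b2 _; rewrite leq_mul2l; apply/orP; right.
  by rewrite /isize ltnS /dim; case: (b); lia.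
- split; [by rewrite v2 | by rewrite v2 | | exact: z2].
  by apply: frame_trans in1 _; apply: frame_le f2.
- by apply: frame_trans f1 _; apply: frame_le f2.
Qed.

Lemma scatterR X (Phi : X -> inst -> state R -> Prop) (b : bool)
    (ke : X -> nexp) (bb : X -> nat -> bexp) (e1 e2 : X -> nat -> rexp)
    (key : inst -> nat -> nat) (step : inst -> nat -> R -> R) :
    avail Phi ->
    (forall x I s k i, (i < dim b I)%N -> nvar s 3 = i -> frame 2 (input I) s ->
       Phi x I s -> neval s (ke x) = key I i /\
       (if beval s (bb x k) then reval s (e1 x k) else reval s (e2 x k)) =
       step I i (rarr s k (key I i))) ->
  cR (fun I => scat (dim b I) (key I) (step I) 0%R).
Proof.
move=> hX spec k k3.
have [c1 [C1 [k1 [x [kk1 st1 run1]]]]] := hX k k3.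
pose body := If (bb x k1) (RPut k1 (ke x) (e1 x k1)) (RPut k1 (ke x) (e2 x k1)).
pose K := (bcost (bb x k1) + (ncost (ke x) + rcost (e1 x k1) + rcost (e2 x k1)) + 2)%N.
exists (Seq c1 (loop b body)), (C1 + (K + 9))%N, k1.+1, k1; split.
- exact: leqW.
- by move=> I s s' f h j; rewrite (f k1 _).2 // leqnn; apply/eqP; lia.
move=> I s /run1 [s1 [t1 [ex1 b1 cl1 f1 p1]]].
pose Inv i s2 := [/\ frame k1 s1 s2, rarr s2 k1 =1 scat i (key I) (step I) 0%R,
  narr s2 k1 =1 (fun=> 0%N) &
  forall a, (k1 < a)%N -> narr s2 a =1 (fun=> 0%N) /\ rarr s2 a =1 (fun=> 0%R)].
have [n1 m1 in1 z1] := cl1.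
have b_lt2 : (b < 2)%N by case: (b).
have k1_2 : (2 <= k1)%N by lia.
have [|||s2 [t2 [ex2 b2 v2 [f2 h2 r2 z2]]]] :=
  @loop_rule body b K (dim b I) Inv s1 b_lt2 (clean_dim _ cl1).
- move=> i s2 ltiN s2i [f2 h2 r2 z2].
  have in2 : frame 2 (input I) s2 by apply: frame_trans in1 _; apply: frame_le f2.
  have [kE stE] := spec x I s2 k1 i ltiN s2i in2 (st1 _ _ _ f2 p1).
  exists (set_rarr s2 k1 (key I i) (step I i (rarr s2 k1 (key I i)))).
  have upd_a a : (a == k1) = false -> upd (rarr s2) k1 (upd (rarr s2 k1) (key I i)
         (step I i (rarr s2 k1 (key I i)))) a = rarr s2 a by rewrite /upd => ->.
  have : Inv i.+1 (set_rarr s2 k1 (key I i) (step I i (rarr s2 k1 (key I i)))).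
    split=> //=.
    - by move=> a ak /=; rewrite upd_a; [exact: f2 | case/andP: ak; lia].
    - by move=> j; rewrite /upd eqxx scatS -!h2 eq_sym; case: eqP => // ->.
    - by move=> a ak /=; rewrite upd_a; [exact: z2 | lia].
  move: stE; case: ifPn => [bT|bF] <- Inv'; rewrite -kE in Inv' *;
    eexists; split;
    [constructor=> //; constructor | | | | apply: ExecIfFalse => //; constructor | | |] => //;
    by rewrite /K; lia.
- by move=> i s2 v [].
- by split=> // [j|j|a ak]; [rewrite (z1 k1 _).2 | rewrite (z1 k1 _).1 | apply: z1; lia].
exists s2, (t1 + t2)%N; split=> //.
- exact: ExecSeq ex1 ex2.
- rewrite mulnDl leq_add //; apply: leq_trans b2 _; rewrite leq_mul2l; apply/orP; right.
  by rewrite /isize ltnS /dim; case: (b); lia.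
- split; [by rewrite v2 | by rewrite v2 | | exact: z2].
  by apply: frame_trans in1 _; apply: frame_le f2.
- by apply: frame_trans f1 _; apply: frame_le f2.
Qed.

End Machine.

(** * Aggregates over neighbours and over the classes of a key *)

Section Operations.
Variables (R : realType) (n : nat) (G : sgraph 'I_n) (w : {set 'I_n} -> R).
Implicit Types (u v : 'I_n) (p q : pred 'I_n) (key f : 'I_n -> nat) (r : 'I_n -> R).

Definition nb p v : bool := [exists y, G v y && p y].
Definition cnt p v : nat := #|[pred y | G v y & p y]|.
Definition nmax f v : nat := \max_(y | G v y) f y.
Definition kcnt key p v : nat := #|[pred u | key u == key v & p u]|.
Definition kmax key f v : nat := \max_(u | key u == key v) f u.
Definition kex key p v : bool := [exists u, (key u == key v) && p u].
Definition kargmax key f p u : bool :=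
  p u && [forall u', (key u' == key u) && p u' ==> (f u' <= f u)%N].
Definition kargmin key r p u : bool :=
  p u && [forall u', (key u' == key u) && p u' ==> (r u <= r u')%R].
Definition kpick key p u : bool := kargmax key val p u.

Definition wsum p v : R := (\sum_(y | G v y && p y) w [set v; y])%R.
Definition kwsum key p r v : R := (\sum_(u | (key u == key v) && p u) r u)%R.

Lemma nbP p v : reflect (exists2 y, G v y & p y) (nb p v).
Proof.
by apply: (iffP existsP) => [[y /andP[]]|[y vy py]]; exists y => //; rewrite vy.
Qed.

Lemma nb_cnt p v : nb p v = (0 < cnt p v)%N.
Proof. by apply/existsP/card_gt0P => -[y h]; exists y. Qed.

Lemma kex_kcnt key p v : kex key p v = (0 < kcnt key p v)%N.
Proof. by apply/existsP/card_gt0P => -[y h]; exists y. Qed.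

Lemma cnt_sum p v : cnt p v = (\sum_(y | G v y) p y)%N.
Proof.
rewrite /cnt -sum1_card big_mkcondr; apply: eq_bigr => y _.
by case: (p y).
Qed.

Lemma kcnt_sum key p v : kcnt key p v = (\sum_(u | key u == key v) p u)%N.
Proof.
rewrite /kcnt -sum1_card big_mkcondr; apply: eq_bigr => y _.
by case: (p y).
Qed.

(** The successor separates a member of value 0 from the value given to non-members, so a maximum
    over the class suffices to recognise the maximisers. *)
Lemma kargmaxE key f p u :
  kargmax key f p u =
  p u && (kmax key (fun u' => if p u' then (f u').+1 else 0%N) u <= (f u).+1)%N.
Proof.
rewrite /kargmax; case: (p u) => //=; apply/forallP/bigmax_leqP => [h u' ku'|h u'].
  by case: ifP => // pu'; have := h u'; rewrite ku' pu'.
by apply/implyP => /andP[ku' pu']; have := h u' ku'; rewrite pu'.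
Qed.

End Operations.

Lemma uniq_map_inj (T1 T2 : eqType) (f : T1 -> T2) (s : seq T1) :
  uniq (map f s) -> {in s &, injective f}.
Proof.
elim: s => [|x s IH] //= /andP[/mapP nx /IH inj] y z; rewrite !inE.
move=> /predU1P[->|ys] /predU1P[->|zs] // e.
- by case: nx; exists z.
- by case: nx; exists y.
- exact: inj.
Qed.

Lemma edges_sym (V : finType) (G : sgraph V) (x y : V) : ([set x; y] \in edges G) = G x y.
Proof.
rewrite inE; apply/existsP/idP => [[x' /existsP[y' /andP[xy' /eqP e]]]|xy].
  have xy'D : x' != y' by apply: contraTneq xy' => ->; rewrite adj_irr.
  have : x' \in [set x; y] by rewrite e set21.
  have : y' \in [set x; y] by rewrite e set22.
  rewrite !inE => /orP[]/eqP y'E /orP[]/eqP x'E; move: xy' xy'D;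
    by rewrite x'E y'E ?eqxx // adj_sym.
by exists x; apply/existsP; exists y; rewrite xy eqxx.
Qed.

Lemma set2_inj (V : finType) (x y x' y' : V) :
  [set x; y] = [set x'; y'] -> (x, y) = (x', y') \/ (x, y) = (y', x').
Proof.
move=> /setP e; have := (e x, e y, e x', e y').
rewrite !inE !eqxx /= ?orbT; case=> -[[]].
move=> /esym/orP[]/eqP -> ; move=> /esym/orP[]/eqP -> /=; rewrite ?orbb; auto.
  by move=> _ /eqP ->; auto.
by move=> /eqP ->; auto.
Qed.

(** * Edges taken in both orientations *)

Section Arcs.
Variables (R : realType) (I : inst R).
Notation n := (isz I).
Notation G := (igr I).

Definition orient (o : bool) (p : 'I_n * 'I_n) := if o then (p.2, p.1) else p.
Definition arcs := ies I ++ [seq orient true p | p <- ies I].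

Lemma arcs_uniq : uniq arcs /\ (forall p, (p \in arcs) = G p.1 p.2).
Proof.
have ok := iok I; rewrite /edge_list in ok.
have um : uniq (map (@edge_of n) (ies I)) by rewrite (perm_uniq ok) enum_uniq.
have ue := map_uniq um.
have edge_adj p : p \in ies I -> G p.1 p.2.
  move=> pes; rewrite -edges_sym -mem_enum -(perm_mem ok).
  by apply/mapP; exists p.
have inj := uniq_map_inj um.
split.
  rewrite cat_uniq ue map_inj_uniq ?ue ?andbT //=; last by move=> [? ?] [? ?] [-> ->].
  apply/hasPn => _ /mapP[p pes ->]; apply/negP => opes.
  have : orient true p = p by apply: inj => //; rewrite /edge_of /= setUC.
  by case: p pes {opes} => x y /edge_adj /= h [e _]; move: h; rewrite e adj_irr.
move=> [x y]; rewrite mem_cat /=; apply/orP/idP => [[/edge_adj //|/mapP[p /edge_adj h [-> ->]]]|xy].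
  by rewrite adj_sym.
have : [set x; y] \in map (@edge_of n) (ies I) by rewrite (perm_mem ok) mem_enum edges_sym.
case/mapP => -[x' y'] pes /set2_inj[[-> ->]|[-> ->]]; first by left.
by right; apply/mapP; exists (x', y').
Qed.

(** Each neighbour of [v] ends exactly one arc leaving [v]; so two sweeps over the edge list, one
    per orientation, aggregate over neighbours without adjacency lists. *)
Lemma big_arcs (T : Type) (idx : T) (op : Monoid.com_law idx) v (F : 'I_n -> 'I_n -> T) :
  \big[op/idx]_(p <- arcs | p.1 == v) F p.1 p.2 = \big[op/idx]_(y | G v y) F v y.
Proof.
have [ua memE] := arcs_uniq.
rewrite big_mkcond big_uniq //= -big_mkcondr /=.
rewrite (eq_bigl (fun p => G p.1 p.2 && (p.1 == v))); last by move=> p; rewrite memE.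
rewrite (reindex_onto (fun y => (v, y)) (fun p => p.2)) /=.
  by apply: eq_bigl => y; rewrite !eqxx !andbT.
by move=> [x y] /= /andP[_ /eqP ->].
Qed.

Definition ends (o : bool) (i : nat) : nat :=
  nth 0%N (if o then [seq val p.2 | p <- ies I] else [seq val p.1 | p <- ies I]) i.

End Arcs.

(** Beyond the last vertex the default agrees with the zero content of untouched cells, which lets
    equality of arrays be stated at all indices. *)
Definition vget (T : Type) (z : T) n (f : 'I_n -> T) (j : nat) : T :=
  if insub j is Some u then f u else z.

Lemma vget_val T (z : T) n (f : 'I_n -> T) (v : 'I_n) : vget z f v = f v.
Proof. by rewrite /vget valK. Qed.

Lemma vget_lt T (z : T) n (f : 'I_n -> T) j (jn : (j < n)%N) : vget z f j = f (Ordinal jn).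
Proof. by rewrite /vget insubT. Qed.

Lemma vget_ge T (z : T) n (f : 'I_n -> T) j : (n <= j)%N -> vget z f j = z.
Proof. by move=> nj; rewrite /vget insubF // ltnNge nj. Qed.

Lemma scat_id T N (g : nat -> T) z j :
  scat N id (fun i _ => g i) z j = if (j < N)%N then g j else z.
Proof.
elim: N => [|N IH] //; rewrite scatS IH /= ltnS [(j <= N)%N]leq_eqVlt eq_sym.
by case: (j =P N) => [->|].
Qed.

Lemma scat_big T idx (op : Monoid.com_law idx) N key (g : nat -> T) j :
  scat N key (fun i acc => op acc (g i)) idx j = \big[op/idx]_(0 <= i < N | key i == j) g i.
Proof.
elim: N => [|N IH]; first by rewrite big_geq.
rewrite scatS IH [RHS]big_mkcond big_nat_recr //= -big_mkcond.
by case: eqP => // _; rewrite Monoid.mulm1.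
Qed.

(* Naming: [cN], [cR] say that arrays of naturals or reals are computable in
   linear time, [cn], [cb], [cr] that functions of the vertices with values in
   naturals, booleans or reals are.  Dependencies are recomputed at every use,
   which only affects the constant factor. *)
Section Closure.
Variable R : realType.
Notation inst := (inst R).
Implicit Types (I : inst) (s : state R).

Definition cn (f : forall I, 'I_(isz I) -> nat) : Prop := cN (fun I => vget 0%N (@f I)).
Definition cb (p : forall I, pred 'I_(isz I)) : Prop := cn (fun I v => p I v : nat).
Definition cr (r : forall I, 'I_(isz I) -> R) : Prop := cR (fun I => vget 0%R (@r I)).

Lemma avail_ext X (Phi Psi : X -> inst -> state R -> Prop) :
  (forall x I s, Phi x I s <-> Psi x I s) -> avail Phi -> avail Psi.
Proof.
move=> h av k k3; have [c [C [k' [x [kk st run]]]]] := av k k3.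
exists c, C, k', x; split=> //; first by move=> I s s' f /h p; apply/h/(st _ s).
by move=> I s /run[s' [t [? ? ? ? /h ?]]]; exists s', t.
Qed.

Lemma cN_ext (F F' : inst -> nat -> nat) : (forall I, F I =1 F' I) -> cN F -> cN F'.
Proof. by move=> h cF; apply: avail_ext cF => a I s; split=> e j; rewrite e h. Qed.

Lemma cR_ext (F F' : inst -> nat -> R) : (forall I, F I =1 F' I) -> cR F -> cR F'.
Proof. by move=> h cF; apply: avail_ext cF => a I s; split=> e j; rewrite e h. Qed.

Lemma cn_ext (f g : forall I, 'I_(isz I) -> nat) : (forall I, @f I =1 @g I) -> cn f -> cn g.
Proof. by move=> h cf; apply: cN_ext cf => I j; rewrite /vget; case: insub => [u|//]; rewrite h. Qed.

Lemma cb_ext (p q : forall I, pred 'I_(isz I)) : (forall I, p I =1 q I) -> cb p -> cb q.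
Proof. by move=> h cf; apply: cn_ext cf => I v; rewrite h. Qed.

Lemma cn_map X (Phi : X -> inst -> state R -> Prop) (b : X -> bexp) (e1 e2 : X -> nexp)
    (f : forall I, 'I_(isz I) -> nat) :
  avail Phi ->
  (forall x I s (v : 'I_(isz I)), nvar s 3 = v -> Phi x I s ->
    (if beval s (b x) then neval s (e1 x) else neval s (e2 x)) = f I v) ->
  cn f.
Proof.
move=> av spec.
have := @scatterN R X Phi false (fun=> NVar 3) (fun x _ => b x) (fun x _ => e1 x)
  (fun x _ => e2 x) (fun _ => id) (fun I i _ => vget 0%N (@f I) i) av.
move=> h; apply: cN_ext (h _) => [I j|x I s k i ltin s3 _ px].
  rewrite scat_id /=; case: ifP => // /negbT; rewrite -leqNgt => nj.
  by rewrite vget_ge.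
by split=> //; rewrite (spec x I s (Ordinal ltin)) // vget_lt.
Qed.

Lemma cn_const c : cn (fun I v => c).
Proof.
apply: (@cn_map _ _ (fun=> BNle (NConst 0) (NConst 0)) (fun=> NConst c) (fun=> NConst c) _
  (avail_true R)).
by [].
Qed.

Lemma cn_val : cn (fun I v => val v).
Proof.
apply: (@cn_map _ _ (fun=> BNle (NConst 0) (NConst 0)) (fun=> NVar 3) (fun=> NConst 0) _
  (avail_true R)).
by [].
Qed.

Let get a := NGet a (NVar 3).

Lemma cn_add f g : cn f -> cn g -> cn (fun I v => f I v + g I v)%N.
Proof.
move=> cf cg; apply: (@cn_map _ _ (fun=> BNle (NConst 0) (NConst 0))
  (fun x => NAdd (get x.1) (get x.2)) (fun=> NConst 0) _ (avail_and cf cg)).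
by move=> x I s v s3 [e1 e2]; rewrite /= s3 e1 e2 !vget_val.
Qed.

Lemma cn_sub f g : cn f -> cn g -> cn (fun I v => f I v - g I v)%N.
Proof.
move=> cf cg; apply: (@cn_map _ _ (fun=> BNle (NConst 0) (NConst 0))
  (fun x => NSub (get x.1) (get x.2)) (fun=> NConst 0) _ (avail_and cf cg)).
by move=> x I s v s3 [e1 e2]; rewrite /= s3 e1 e2 !vget_val.
Qed.

Lemma cn_if p f g : cb p -> cn f -> cn g -> cn (fun I v => if p I v then f I v else g I v).
Proof.
move=> cp cf cg; apply: (@cn_map _ _ (fun x => BNle (NConst 1) (get x.1))
  (fun x => get x.2.1) (fun x => get x.2.2) _ (avail_and cp (avail_and cf cg))).
move=> x I s v s3 [e1 [e2 e3]]; rewrite /= s3 e1 e2 e3 !vget_val.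
by case: (p I v).
Qed.

Lemma cb_leq f g : cn f -> cn g -> cb (fun I v => f I v <= g I v)%N.
Proof.
move=> cf cg; apply: (@cn_map _ _ (fun x => BNle (get x.1) (get x.2))
  (fun=> NConst 1) (fun=> NConst 0) _ (avail_and cf cg)).
by move=> x I s v s3 [e1 e2]; rewrite /= s3 e1 e2 !vget_val; case: leqP.
Qed.

Lemma cb_const c : cb (fun I v => c).
Proof. exact: cn_const. Qed.

Lemma cb_if p q q' : cb p -> cb q -> cb q' -> cb (fun I v => if p I v then q I v else q' I v).
Proof.
move=> cp cq cq'; apply: cn_ext (cn_if cp cq cq') => I v.
by case: (p I v).
Qed.

Lemma cb_not p : cb p -> cb (fun I v => ~~ p I v).
Proof.
move=> cp; apply: cb_ext (cb_if cp (cb_const false) (cb_const true)) => I v.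
by case: (p I v).
Qed.

Lemma cb_and p q : cb p -> cb q -> cb (fun I v => p I v && q I v).
Proof. by move=> cp cq; apply: cb_if cp cq (cb_const false). Qed.

Lemma cb_or p q : cb p -> cb q -> cb (fun I v => p I v || q I v).
Proof. by move=> cp cq; apply: cb_if cp (cb_const true) cq. Qed.

Lemma cb_eqn f g : cn f -> cn g -> cb (fun I v => f I v == g I v).
Proof.
move=> cf cg; apply: cb_ext (cb_and (cb_leq cf cg) (cb_leq cg cf)) => I v.
by rewrite eqn_leq.
Qed.

Lemma cb_eqb p q : cb p -> cb q -> cb (fun I v => p I v == q I v).
Proof.
move=> cp cq; apply: cb_ext (cb_if cp cq (cb_not cq)) => I v.
by case: (p I v); case: (q I v).
Qed.

Section NatFold.
Variable op : Monoid.com_law 0%N.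
Variable eop : nexp -> nexp -> nexp.
Hypothesis eopE : forall s e1 e2, neval s (eop e1 e2) = op (neval s e1) (neval s e2).

Lemma cN_key (key f : forall I, 'I_(isz I) -> nat) : cn key -> cn f ->
  cN (fun I j => \big[op/0%N]_(u | key I u == j) f I u).
Proof.
move=> ck cf.
have := @scatterN R _ _ false (fun x => get x.1) (fun _ _ => BNle (NConst 0) (NConst 0))
  (fun x k => eop (NGet k (get x.1)) (get x.2)) (fun _ _ => NConst 0)
  (fun I => vget 0%N (@key I)) (fun I i acc => op acc (vget 0%N (@f I) i)) (avail_and ck cf).
move=> h; apply: cN_ext (h _) => [I j|x I s k i ltin s3 _ [e1 e2]].
  rewrite scat_big big_mkord; apply: eq_big => u; first by rewrite vget_val.
  by move=> _; rewrite vget_val.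
by rewrite eopE /= s3 !e1 e2.
Qed.

Lemma cn_key (key f : forall I, 'I_(isz I) -> nat) : cn key -> cn f ->
  cn (fun I v => \big[op/0%N]_(u | key I u == key I v) f I u).
Proof.
move=> ck cf; apply: (@cn_map _ _ (fun=> BNle (NConst 0) (NConst 0))
  (fun x => NGet x.2 (get x.1)) (fun=> NConst 0) _ (avail_and ck (cN_key ck cf))).
by move=> x I s v s3 [e1 e2]; rewrite /= s3 e1 e2 vget_val.
Qed.

Lemma ends_input I s (o : bool) j : frame 2 (input I) s -> narr s o j = ends I o j.
Proof. by case: o => f; rewrite (f _ _).1. Qed.

Lemma cN_half (o : bool) (f : forall I, 'I_(isz I) -> nat) : cn f ->
  cN (fun I j => \big[op/0%N]_(p <- ies I | (orient o p).1 == j :> nat) f I (orient o p).2).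
Proof.
move=> cf.
have := @scatterN R _ _ true (fun x => get o) (fun _ _ => BNle (NConst 0) (NConst 0))
  (fun x k => eop (NGet k (get o)) (NGet x (get (~~ o)))) (fun _ _ => NConst 0)
  (fun I => ends I o) (fun I i acc => op acc (vget 0%N (@f I) (ends I (~~ o) i))) cf.
move=> h; apply: cN_ext (h _) => [I j|x I s k i ltim s3 inp e1].
  rewrite scat_big /=; case: (posnP (size (ies I))) => [s0|].
    by rewrite s0 (size0nil s0) big_geq // big_nil.
  case esE: (ies I) => [//|p0 es'] _; rewrite -esE (big_nth p0).
  rewrite [LHS]big_nat_cond [RHS]big_nat_cond.
  have endsE i b : (0 <= i < size (ies I))%N ->
      ends I b i = (orient b (nth p0 (ies I) i)).1 :> nat.
    by move=> /andP[_ ltim]; rewrite /ends; case: b; rewrite (nth_map p0).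
  apply: eq_big => i; last move=> /andP[ltim _].
    by case: (boolP (0 <= i < _)%N) => // ltim; rewrite endsE.
  by rewrite endsE // vget_val; case: (o).
by rewrite eopE /= s3 !(ends_input _ _ inp) e1.
Qed.

Lemma cn_nbr (f : forall I, 'I_(isz I) -> nat) : cn f ->
  cn (fun I v => \big[op/0%N]_(y | igr I v y) f I y).
Proof.
move=> cf; apply: (@cn_map _ _ (fun=> BNle (NConst 0) (NConst 0))
  (fun x => eop (get x.1) (get x.2)) (fun=> NConst 0) _
  (avail_and (cN_half false cf) (cN_half true cf))).
move=> x I s v s3 [e1 e2]; rewrite /= eopE /= s3 e1 e2.
by rewrite -(big_arcs op v (fun _ y => f I y)) big_cat big_map.
Qed.

End NatFold.

Section Derived.
Variables (key f : forall I, 'I_(isz I) -> nat) (p : forall I, pred 'I_(isz I)).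
Hypotheses (ck : cn key) (cf : cn f) (cp : cb p).

(** Truncated subtraction provides the maximum, which is not a primitive of the machine. *)
Let emax e1 e2 := NAdd e1 (NSub e2 e1).

Lemma emaxE s e1 e2 : neval s (emax e1 e2) = maxn (neval s e1) (neval s e2).
Proof. by rewrite /= maxnE. Qed.

Lemma cn_nmax : cn (fun I => nmax (igr I) (@f I)).
Proof. exact: (@cn_nbr maxn emax emaxE _ cf). Qed.

Lemma cn_kmax : cn (fun I => kmax (@key I) (@f I)).
Proof. exact: (@cn_key maxn emax emaxE _ _ ck cf). Qed.

Lemma cn_cnt : cn (fun I => cnt (igr I) (@p I)).
Proof.
apply: cn_ext (@cn_nbr addn NAdd _ _ cp) => // I v.
by rewrite cnt_sum.
Qed.

Lemma cn_kcnt : cn (fun I => kcnt (@key I) (@p I)).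
Proof.
apply: cn_ext (@cn_key addn NAdd _ _ _ ck cp) => // I v.
by rewrite kcnt_sum.
Qed.

Lemma cb_kargmax : cb (fun I => kargmax (@key I) (@f I) (@p I)).
Proof.
apply: cb_ext (cb_and cp (cb_leq
  (@cn_key maxn emax emaxE _ _ ck (cn_if cp (cn_add cf (cn_const 1)) (cn_const 0)))
  (cn_add cf (cn_const 1)))) => I v.
rewrite kargmaxE addn1 /kmax; congr (_ && (_ <= _)%N).
by apply: eq_bigr => u _; rewrite addn1.
Qed.

End Derived.

Lemma cb_nb p : cb p -> cb (fun I => nb (igr I) (p I)).
Proof.
move=> cp; apply: cb_ext (cb_leq (cn_const 1) (cn_cnt cp)) => I v.
by rewrite nb_cnt.
Qed.

Lemma cb_kex (key : forall I, 'I_(isz I) -> nat) p :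
  cn key -> cb p -> cb (fun I => kex (@key I) (p I)).
Proof.
move=> ck cp; apply: cb_ext (cb_leq (cn_const 1) (cn_kcnt ck cp)) => I v.
by rewrite kex_kcnt.
Qed.

Lemma cb_kpick (key : forall I, 'I_(isz I) -> nat) p :
  cn key -> cb p -> cb (fun I => kpick (@key I) (p I)).
Proof. by move=> ck cp; apply: cb_kargmax ck cn_val cp. Qed.

Section Weights.

Let truth := BNle (NConst 0) (NConst 0).

Lemma cR_half (o : bool) p : cb p ->
  cR (fun I j => \sum_(e <- ies I | (orient o e).1 == j :> nat)
                   if p I (orient o e).2 then iwt (edge_of e) else 0)%R.
Proof.
move=> cp.
have := @scatterR R _ _ true (fun x => get o) (fun x _ => BNle (NConst 1) (NGet x (get (~~ o))))
  (fun x k => RAdd (RGet k (get o)) (RGet 0 (NVar 3))) (fun x k => RGet k (get o))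
  (fun I => ends I o)
  (fun I i acc => (acc + if vget 0%N (fun v => p I v : nat) (ends I (~~ o) i) == 1%N
     then nth 0 [seq iwt (edge_of e) | e <- ies I] i else 0)%R) cp.
move=> h; apply: cR_ext (h _) => [I j|x I s k i ltim s3 inp e1].
  rewrite scat_big /=; case: (posnP (size (ies I))) => [s0|].
    by rewrite s0 (size0nil s0) big_geq // big_nil.
  case esE: (ies I) => [//|p0 es'] _; rewrite -esE (big_nth p0).
  rewrite [LHS]big_nat_cond [RHS]big_nat_cond.
  have endsE i b : (0 <= i < size (ies I))%N ->
      ends I b i = (orient b (nth p0 (ies I) i)).1 :> nat.
    by move=> /andP[_ ltim]; rewrite /ends; case: b; rewrite (nth_map p0).
  apply: eq_big => i; last move=> /andP[ltim _].
    by case: (boolP (0 <= i < _)%N) => // ltim; rewrite endsE.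
  rewrite endsE // vget_val (nth_map p0) ?(andP ltim).2 // eqb1.
  by case: (o).
rewrite /= s3 !(ends_input _ _ inp); split=> //.
have -> : narr s x (ends I (~~ o) i) = vget 0%N (fun v => p I v : nat) (ends I (~~ o) i) by [].
rewrite (inp 0%N isT).2 /vget; case: insub => [u|]; last by rewrite addr0.
by case: (p I u); rewrite ?addr0.
Qed.

Lemma cr_wsum p : cb p -> cr (fun I => wsum (igr I) (@iwt R I) (p I)).
Proof.
move=> cp.
have := @scatterR R _ _ false (fun x => NVar 3) (fun _ _ => truth)
  (fun x k => RAdd (RGet x.1 (NVar 3)) (RGet x.2 (NVar 3))) (fun x k => RZero)
  (fun I i => i) (fun I i _ => vget 0%R (wsum (igr I) (@iwt R I) (p I)) i)
  (avail_and (cR_half false cp) (cR_half true cp)).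
move=> h; apply: cR_ext (h _) => [I j|x I s k i ltin s3 inp [e1 e2]].
  rewrite scat_id /=; case: ifP => // /negbT; rewrite -leqNgt => nj.
  by rewrite vget_ge.
rewrite /= s3 e1 e2 vget_lt; split=> //.
pose F v y := if p I y then iwt [set v; y] else 0%R.
rewrite /wsum big_mkcondr -(big_arcs +%R (Ordinal ltin) F) big_cat big_map /=.
by congr (_ + _)%R; apply: eq_bigr => -[y z] /= _; rewrite /F /edge_of /= 1?setUC.
Qed.

Variables (key : forall I, 'I_(isz I) -> nat) (p p' : forall I, pred 'I_(isz I)).
Variables (r r' : forall I, 'I_(isz I) -> R).
Hypotheses (ck : cn key) (cp : cb p) (cp' : cb p') (c_r : cr r) (c_r' : cr r').

Lemma cR_kwsum : cR (fun I j => \sum_(u | (key u == j) && @p I u) r u)%R.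
Proof.
have := @scatterR R _ _ false (fun x => get x.1)
  (fun x _ => BNle (NConst 1) (get x.2.1))
  (fun x k => RAdd (RGet k (get x.1)) (RGet x.2.2 (NVar 3))) (fun x k => RGet k (get x.1))
  (fun I => vget 0%N (@key I))
  (fun I i acc => (acc + if vget 0%N (fun v => @p I v : nat) i == 1%N then vget 0%R (@r I) i else 0)%R)
  (avail_and ck (avail_and cp c_r)).
move=> h; apply: cR_ext (h _) => [I j|x I s k i ltin s3 _ [e1 [e2 e3]]].
  rewrite scat_big big_mkord big_mkcondr /=; apply: eq_big => u; first by rewrite vget_val.
  by move=> _; rewrite !vget_val eqb1.
rewrite /= s3 !e1; split=> //.
rewrite e2 e3 !vget_lt; case: (p _); by rewrite ?addr0.
Qed.

End Weights.

Lemma cb_kwsum_le (key : forall I, 'I_(isz I) -> nat) p p' r r' :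
  cn key -> cb p -> cb p' -> cr r -> cr r' ->
  cb (fun I v => (kwsum (@key I) (p I) (@r I) v <= kwsum (@key I) (p' I) (@r' I) v)%R).
Proof.
move=> ck cp cp' c_r c_r'.
apply: (@cn_map _ _ (fun x => BRle (RGet x.2.1 (get x.1)) (RGet x.2.2 (get x.1)))
  (fun=> NConst 1) (fun=> NConst 0) _
  (avail_and ck (avail_and (cR_kwsum ck cp c_r) (cR_kwsum ck cp' c_r')))).
move=> x I s v s3 [e1 [e2 e3]]; rewrite /= s3 !e1 e2 e3 !vget_val /kwsum.
by case: ifP.
Qed.

Lemma cb_kargmin (key : forall I, 'I_(isz I) -> nat) r p :
  cn key -> cr r -> cb p -> cb (fun I => kargmin (@key I) (@r I) (p I)).
Proof.
move=> ck c_r cp.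
pose stp I i acc := if [&& vget 0%N (fun v => p I v : nat) i == 1%N &
    (acc == 0%N) || (vget 0 (@r I) i <= vget 0 (@r I) acc.-1)%R] then i.+1 else acc.
have av := avail_and ck (avail_and cp c_r).
have best : cN (fun I => scat (isz I) (vget 0%N (@key I)) (stp I) 0%N).
  have := @scatterN R _ _ false (fun x => get x.1)
    (fun x k => BAnd (BNle (NConst 1) (get x.2.1))
      (BNot (BAnd (BNle (NConst 1) (NGet k (get x.1)))
           (BNot (BRle (RGet x.2.2 (NVar 3)) (RGet x.2.2 (NSub (NGet k (get x.1)) (NConst 1))))))))
    (fun x k => NAdd (NVar 3) (NConst 1)) (fun x k => NGet k (get x.1))
    (fun I => vget 0%N (@key I)) stp av.
  apply=> x I s k i ltin s3 _ [e1 [e2 e3]]; rewrite /= s3 !e1; split=> //.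
  rewrite /stp e2 !e3 subn1 addn1 negb_and negbK -leqNgt leqn0 !(vget_lt _ _ ltin).
  by case: (p I _).
have bestP I j : let B N := scat N (vget 0%N (@key I)) (stp I) 0%N j in
  forall N, (N <= isz I)%N ->
  if B N is b.+1 then exists u : 'I_(isz I), [/\ b = u, key I u = j, p I u &
     forall u' : 'I_(isz I), (u' < N)%N -> key I u' = j -> p I u' -> (r I u <= r I u')%R]
  else forall u : 'I_(isz I), (u < N)%N -> key I u = j -> ~~ p I u.
  move=> B; elim=> [|N IH] Nn //; have := IH (ltnW Nn).
  rewrite /B scatS -/(B N) (vget_lt _ _ Nn) /stp (vget_lt _ _ Nn); set uN := Ordinal Nn.
  have ltS (u : 'I_(isz I)) : (u < N.+1)%N -> u = uN \/ (u < N)%N.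
    by rewrite ltnS leq_eqVlt => /predU1P[e|]; [left; apply: val_inj | right].
  case: ifP => [/eqP kN|/eqP kN]; last first.
    case: (B N) => [nop|b [u [-> ku pu hu]]].
      by move=> u /ltS[-> //|]; apply: nop.
    by exists u; split=> // u' /ltS[-> //|]; apply: hu.
  rewrite eqb1; case pN: (p I uN) => /=; last first.
    case: (B N) => [nop|b [u [-> ku pu hu]]].
      by move=> u /ltS[->|]; [rewrite pN | apply: nop].
    by exists u; split=> // u' /ltS[->|]; [rewrite pN | apply: hu].
  case: (B N) => [nop|b [u [-> ku pu hu]]] /=.
    by exists uN; split=> // u' /ltS[->|/nop h /h /negPf->].
  rewrite vget_val [vget 0%R _ N](vget_lt _ _ Nn) -/uN; case: ifPn => [le|]; last rewrite -ltNge => /ltW le.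
    exists uN; split=> // u' /ltS[->|] // lt' k' p'.
    by apply: le_trans le _; apply: hu.
  by exists u; split=> // u' /ltS[->|] // lt' k' p'; apply: hu.
apply: (@cn_map _ _ (fun x => BAnd (BNle (NConst 1) (get x.1.2.1))
    (BRle (RGet x.1.2.2 (NVar 3)) (RGet x.1.2.2 (NSub (NGet x.2 (get x.1.1)) (NConst 1)))))
  (fun=> NConst 1) (fun=> NConst 0) _ (avail_and av best)).
move=> x I s v s3 [[e1 [e2 e3]] e4]; rewrite /= s3 e1 e2 e4 !e3 !vget_val.
rewrite /kargmin; case pv: (p I v) => //=.
have := bestP I (key I v) _ (leqnn _).
case: (scat _ _ _ _ _) => [nop|b [u [-> ku pu hu]]].
  by have := nop v (ltn_ord v) erefl; rewrite pv.
rewrite subn1 /= vget_val; case: ifPn => le.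
  symmetry; apply/eqP; rewrite eqb1; apply/forallP => u'; apply/implyP => /andP[/eqP k' p'].
  by apply: le_trans le _; apply: hu.
symmetry; apply/eqP; rewrite eqb0; apply/negP => /forallP/(_ u); rewrite ku eqxx pu /=.
by rewrite (negPf le).
Qed.

End Closure.

(** * Writing the result *)

Section Output.
Variable R : realType.
Notation inst := (inst R).

Lemma frame_put2 k (s : state R) i v : frame k s (set_narr s 2 i v).
Proof. by move=> a /andP[_ /negPf a2]; rewrite /= /upd a2. Qed.

Fixpoint puts (i : nat) (l : seq nat) : cmd :=
  if l is a :: l' then Seq (NPut 2 (NConst i) (NGet a (NConst 0))) (puts i.+1 l') else Skip.

Lemma exec_puts k i l (s : state R) (h : nat -> nat) :
    (forall j s', (j < size l)%N -> frame k s s' ->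
       narr s' (nth 0%N l j) 0 = h (i + j)%N) ->
  exists s' t, [/\ exec (puts i l) s s' t, (t <= 5 * (size l).+1)%N,
    nvar s' = nvar s &
    forall j, narr s' 2 j = if (i <= j < i + size l)%N then h j else narr s 2 j].
Proof.
elim: l i s => [|a l IH] i s hs.
  exists s, 1%N; split=> // [|j]; first by constructor.
  by rewrite /= addn0; case: ifP => //; lia.
have [|s' [t [e1 b1 v1 n1]]] := IH i.+1 (set_narr s 2 i (narr s a 0%N)).
  move=> j s' jl f; rewrite addSnnS; apply: (hs j.+1) => //.
  by apply: frame_trans f; apply: frame_put2.
exists s'; eexists; split; first exact: ExecSeq (ExecNPut s 2 (NConst i) (NGet a (NConst 0))) e1.
- by rewrite /=; lia.
- by rewrite v1.
move=> j; rewrite n1 /= /upd eqxx addSnnS; case: (j =P i) => [->|ji].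
  by rewrite ltnn leqnn addnS ltnS leq_addr /= (hs 0%N s) ?addn0.
by have -> : (i < j)%N = (i <= j)%N by lia.
Qed.

Definition edge_bit (aw : nat) : cmd :=
  If (BAnd (BNot (BNle (NConst 1) (NGet aw (NGet 0 (NVar 3)))))
           (BNot (BNle (NConst 1) (NGet aw (NGet 1 (NVar 3))))))
     (NPut 2 (NVar 3) (NConst 1)) (NPut 2 (NVar 3) (NConst 0)).

(** The number of a vertex known by its bits is recovered as a maximum over the class of the
    constant key 0, hence from cell 0. The flag is read in cell 0 as well; in the empty graph this
    cell is 0, and an edge set is written. *)
Lemma output_exec (flag W : forall I : inst, pred 'I_(isz I))
    (T : nat -> forall I : inst, pred 'I_(isz I)) :
  cb flag -> cb W -> (forall i, (i < 5)%N -> cb (T i)) ->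
  exists c C, forall I, exists s t, [/\ exec c (input I) s t, (t <= C * isize I)%N &
    if vget 0%N (fun v => flag I v : nat) 0 == 0%N then
      nvar s 2 = 0%N /\ forall i, (i < size (ies I))%N ->
        narr s 2 i = ~~ vget true (W I) (ends I false i) &&
                     ~~ vget true (W I) (ends I true i) :> nat
    else nvar s 2 = 1%N /\ forall i, (i < 5)%N ->
        narr s 2 i = \max_(u | T i I u) u :> nat].
Proof.
move=> cflag cW cT.
pose F i I (u : 'I_(isz I)) : nat := if T i I u then val u else 0%N.
have cF i : (i < 5)%N -> cN (fun I j => \big[maxn/0%N]_(u | 0%N == j) @F i I u).
  move=> i5; apply: (@cN_key R maxn (fun e1 e2 => NAdd e1 (NSub e2 e1)) _ (fun _ _ => 0%N)).
  - by move=> s e1 e2; rewrite /= maxnE.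
  - exact: cn_const.
  - by apply: cn_if; [exact: cT | exact: cn_val | exact: cn_const].
have av := avail_and (avail_and cflag cW) (avail_and (cF 0%N isT) (avail_and (cF 1%N isT)
  (avail_and (cF 2 isT) (avail_and (cF 3 isT) (cF 4 isT))))).
have [c [C [k [[[af aw] [x0 [x1 [x2 [x3 x4]]]]] [/= k3 stab run]]]]] := av 3 isT.
exists (Seq c (If (BNle (NConst 1) (NGet af (NConst 0)))
  (Seq (NSet 2 (NConst 1)) (puts 0 [:: x0; x1; x2; x3; x4]))
  (Seq (NSet 2 (NConst 0)) (loop 1 (edge_bit aw))))), (C + 100)%N => I.
(* Arrays 0 and 1 hold the input and array 2 receives the output, so the work space starts at 3. *)
have cl : clean 3 I (input I).
  split=> // -[|[|[|a]]] // _; split=> j //=; by rewrite ?nth_nil.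
have [s1 [t1 [ex1 b1 cl1 f1 p1]]] := run I _ cl.
have [[flE wE] _] := p1.
have [nE mE inE _] := cl1.
set fl := vget _ _ _; case: eqP => [fl0|fl1].
  pose Inv i s := frame k s1 s /\ forall j, (j < i)%N ->
    narr s 2 j = ~~ vget true (W I) (ends I false j) && ~~ vget true (W I) (ends I true j) :> nat.
  have [|||s2 [t2 [ex2 b2 v2 [f2 h2]]]] :=
    @loop_rule R (edge_bit aw) 1 20 (size (ies I)) Inv (set_nvar s1 2 0%N) isT mE.
  - move=> i s ltim s3 [f h].
    have inp : frame 2 (input I) s by apply: frame_trans inE _; exact: frame_le (ltnW k3) f.
    have [[_ wE'] _] := stab I s1 s f p1.
    have wb o : (0 < narr s aw (narr s (nat_of_bool o) i))%N = vget true (W I) (ends I o i).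
      have lt : (ends I o i < isz I)%N.
        rewrite /ends; case: (o); case: (ies I) ltim => // p0 es' ltim;
          by rewrite (nth_map p0) //; apply: ltn_ord.
      by rewrite (ends_input o i inp) wE' (vget_lt 0%N _ lt) (vget_lt true _ lt); case: (W I _).
    set v := nat_of_bool (~~ vget true (W I) (ends I false i) &&
                          ~~ vget true (W I) (ends I true i)).
    exists (set_narr s 2 i v).
    have I' : Inv i.+1 (set_narr s 2 i v).
      split; first by apply: frame_trans f _; apply: frame_put2.
      move=> j; rewrite ltnS leq_eqVlt /= /upd eqxx => /predU1P[->|ji]; first by rewrite eqxx.
      by rewrite ltn_eqF // h.
    have bE : beval s (BAnd (BNot (BNle (NConst 1) (NGet aw (NGet 0 (NVar 3)))))
           (BNot (BNle (NConst 1) (NGet aw (NGet 1 (NVar 3)))))) = v :> nat.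
      by rewrite /= s3 (wb false) (wb true).
    have put c' : exec (NPut 2 (NVar 3) (NConst c')) s (set_narr s 2 i c') 3.
      by rewrite -s3; exact: (ExecNPut s 2 (NVar 3) (NConst c')).
    move: bE; case bT: (beval _ _) => vE; eexists; split; [| |by []|exact: I'| | |by []|exact: I'].
    + by apply: ExecIfTrue => //; rewrite -vE; apply: put.
    + by [].
    + by apply: ExecIfFalse; rewrite ?bT //; rewrite -vE; apply: put.
    + by [].
  - by move=> i s v [].
  - by [].
  exists s2; eexists; split.
  - apply: ExecSeq ex1 _; apply: ExecIfFalse; first by rewrite /= flE -/fl fl0.
    exact: ExecSeq (ExecNSet s1 2 (NConst 0)) ex2.
  - by move: b1 b2; rewrite /= /isize; lia.
  by split=> //; rewrite v2.
pose h i := (\max_(u | T i I u) u)%N.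
have [j s' j5 f|s2 [t2 [ex2 b2 v2 h2]]] :=
  @exec_puts k 0%N [:: x0; x1; x2; x3; x4] (set_nvar s1 2 1%N) h.
  have FE i : \big[maxn/0%N]_(u < isz I | 0%N == 0%N) @F i I u = h i.
    by rewrite /h [RHS]big_mkcond.
  have [_ [/= e0 [e1 [e2 [e3 e4]]]]] := stab I s1 s' f p1.
  by case: j j5 => [|[|[|[|[|j]]]]] //= _; rewrite ?e0 ?e1 ?e2 ?e3 ?e4 FE.
exists s2; eexists; split.
- apply: ExecSeq ex1 _; apply: ExecIfTrue; first by rewrite /= flE -/fl lt0n; apply/eqP.
  exact: ExecSeq (ExecNSet s1 2 (NConst 1)) ex2.
- by move: b1 b2; rewrite /= /isize; lia.
split; first by rewrite v2.
by move=> i i5; rewrite h2 /= i5.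
Qed.

End Output.

(** * The algorithm *)

(* Distinguished vertices are represented by their characteristic predicates:
   [cpick p] selects one vertex of [p] in every component meeting [p], and
   [gpick p] one vertex of [p] in the whole graph, if any. *)
Section Algorithm.
Variables (R : realType) (n : nat) (G : sgraph 'I_n) (w : {set 'I_n} -> R).
Implicit Types (u v x y : 'I_n) (p t W : pred 'I_n) (l : seq (pred 'I_n)).

(* The largest vertex at distance at most [k] from [v]. *)
Fixpoint lab (k : nat) v : nat :=
  if k is k'.+1 then maxn (lab k' v) (nmax G (lab k') v) else v.

Local Notation comp := (lab 3).
Local Notation one := (fun=> 0%N).
Local Notation nb := (nb G).
Local Notation cnt := (cnt G).

Definition gpick p := kpick one p.
Definition cpick p := kpick comp p.
Definition gex p := kex one p.

(* Meaningful when [t] holds at a single vertex [a]: then it says [f a = g v]. *)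
Definition like (f g : 'I_n -> nat) t v : bool :=
  kmax one (fun u => if t u then f u else 0%N) v == g v.
Definition same t v : bool := like comp comp t v.

Definition adjb p p' v : bool := gex (fun u => p u && nb p' u) v.
(** Picking again makes every entry denote at most one vertex, whatever the list; entries that were
    already picked do not change. *)
Definition tup l (i : nat) : pred 'I_n := gpick (nth xpred0 l i).
Definition isP5 l v : bool :=
  all (fun i => gex (tup l i) v &&
    all (fun j => adjb (tup l i) (tup l j) v == (i.+1 == j) || (j.+1 == i)) (iota 0 5))
  (iota 0 5).
Fixpoint select (ls : seq (seq (pred 'I_n))) (i : nat) v : bool :=
  if ls is l :: ls' then (if isP5 l v then tup l i v else select ls' i v) else false.
Definition found ls v : bool := has (fun l => isP5 l v) ls.

(* If the labels are not stable after three rounds: a shortest path of length 4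
   from [long4] to the vertex whose label reaches it only in the fourth round. *)
Definition long4 := gpick (fun v => lab 4 v != lab 3 v).
Definition hit k v := like (lab 4) (lab k) long4 v.
Definition long3 := gpick (fun v => nb long4 v && hit 3 v).
Definition long2 := gpick (fun v => nb long3 v && hit 2 v).
Definition long1 := gpick (fun v => nb long2 v && hit 1 v).
Definition long0 := gpick (fun v => nb long1 v && hit 0 v).

Definition rootv u := comp u == u.
Definition R1 := nb rootv.
Definition R2 u := [&& ~~ rootv u, ~~ R1 u & nb R1 u].
Definition center := cpick (kargmax comp (cnt R2) R1).
Definition L1 := nb center.
Definition L2 u := ~~ center u && ~~ L1 u.

(* Candidates for an induced P5 when [deep_z] is at distance at least 3 from
   the center [deep_c]. *)
Definition deep_z := gpick (fun v => [&& L2 v, ~~ nb L1 v & kex comp center v]).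
Definition deep_z' := gpick (fun v =>
  R2 v && (deep_z v || (nb deep_z v && ~~ gex (fun u => deep_z u && R2 u) v))).
Definition deep_x' := gpick (fun v => R1 v && nb deep_z' v).
Definition deep_c := gpick (fun v => center v && same deep_z v).
Definition deep_r := gpick (fun v => rootv v && same deep_z v).
Definition deep_u := gpick (fun v => [&& R2 v, nb deep_c v & ~~ nb deep_x' v]).

(* The score prefers vertices having a neighbour in L2, so that [hub'] exists
   whenever L2 is not independent. *)
Definition hub := cpick (kargmax comp (fun v => nb L2 v : nat) L2).
Definition hub' := cpick (fun v => L2 v && nb hub v).
Definition hub'' := cpick (fun v => [&& L2 v, nb hub v & ~~ hub' v]).
(** When the vertex of [t] has a single neighbour in L1, this recovers it; a pivot of L1 is thus
    reached through L2. *)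
Definition upper t := cpick (fun v => L1 v && nb t v).
Definition rung := cpick (fun v => L1 v && nb L1 v).
Definition rung' := cpick (fun v => L1 v && nb rung v).
Definition iso1 u := L1 u && ~~ nb L1 u.
Definition iso2 u := L2 u && ~~ nb L2 u.
Definition wdeg := wsum G w xpredT.
(* For [p0] contained in [p]: the neighbours of [u] in [p] are exactly the
   vertices of [p0] in its component. *)
Definition exactly p p0 u :=
  ~~ nb (fun y => p y && ~~ p0 y) u && (cnt p0 u == kcnt comp p0 u).
(* The vertices compared here have the same neighbours when L1 (resp. L2) is
   independent. *)
Definition twin1 := cpick (kargmin comp wdeg (fun u => L1 u && exactly L2 iso2 u)).
Definition twin2 := cpick (kargmin comp wdeg (fun u => L2 u && exactly L1 iso1 u)).

Definition hub_side y := L1 y && nb hub y.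
(* Then any neighbours in L1 of the hub and of [v] complete an induced P5. *)
Definition remote v :=
  [&& kex comp center v, L2 v, ~~ hub v, ~~ nb hub v &
      ~~ nb (fun u => L1 u && (nb hub u || nb hub_side u)) v].
Definition remote_v := gpick remote.
Definition remote_h := gpick (fun v => hub v && same remote_v v).
Definition remote_c := gpick (fun v => center v && same remote_v v).
Definition remote_y := gpick (fun v => L1 v && nb remote_h v).
Definition remote_y' := gpick (fun v => L1 v && nb remote_v v).

(* The vertices of L2 that may be outside [W], together with another one, when
   [c] is in [W]: each isolated vertex of L1 then has one neighbour among them,
   and the other vertices of L1 have none. *)
Definition partial u :=
  [&& L2 u, ~~ nb (fun y => L1 y && ~~ iso1 y) u & (cnt iso1 u < kcnt comp iso1 u)%N].
Definition widest := cpick (kargmax comp (cnt iso1) partial).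
Definition apart v :=
  [&& partial v, ~~ widest v, ~~ nb widest v & nb (fun a => iso1 a && ~~ nb widest a) v].
Definition apart_v := gpick apart.
Definition apart_m := gpick (fun v => widest v && same apart_v v).
Definition apart_c := gpick (fun v => center v && same apart_v v).
Definition apart_a' := gpick (fun v => [&& iso1 v, nb apart_v v & ~~ nb apart_m v]).
Definition apart_a := gpick (fun v => [&& iso1 v, nb apart_m v & ~~ nb apart_v v]).

Definition seen := cpick (fun v => iso1 v && nb widest v).
Definition unseen := cpick (fun v => iso1 v && ~~ nb widest v).
Definition side0 u := [&& partial u, nb seen u & ~~ nb unseen u].
Definition side1 u := [&& partial u, nb unseen u & ~~ nb seen u].
(** The count says that some vertex of [side1] in the component is not adjacent to [u]. *)
Definition crossed u := side0 u && (cnt side1 u < kcnt comp side1 u)%N.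
Definition crossed_x := gpick crossed.
Definition crossed_y := gpick (fun u => [&& side1 u, ~~ nb crossed_x u & same crossed_x u]).
Definition crossed_a := gpick (fun v => seen v && same crossed_x v).
Definition crossed_c := gpick (fun v => center v && same crossed_x v).
Definition crossed_b := gpick (fun v => unseen v && same crossed_x v).

Definition tuples : seq (seq (pred 'I_n)) :=
  [:: [:: long4; long3; long2; long1; long0];
      [:: deep_u; deep_c; deep_r; deep_x'; deep_z'];
      [:: deep_z; deep_z'; deep_x'; deep_c; deep_u];
      [:: deep_r; deep_c; deep_u; deep_z'; deep_z];
      [:: remote_h; remote_y; remote_c; remote_y'; remote_v];
      [:: apart_m; apart_a; apart_c; apart_a'; apart_v];
      [:: crossed_x; crossed_a; crossed_c; crossed_b; crossed_y]].

(* Membership in [W] of the center, of L1, of the neighbours of the pivot in L2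
   and of the other vertices of L2; [cut] removes the pivot itself. *)
Record pattern := Pattern { wc : bool; w1 : bool; w2n : bool; w2f : bool; cut : bool }.

Definition paint (b : pattern) p u :=
  ~~ (cut b && p u) &&
  [|| center u && wc b, L1 u && w1 b | L2 u && (if nb p u then w2n b else w2f b)].

(** The first two occur when the center is outside [W] and has a neighbour in [W], with that set
    meeting or missing the neighbourhood of the pivot. The third, the fourth and the seventh have
    the center in [W], with one, several or no vertices of L2 outside [W]. The fifth and the sixth
    have [W] inside L2, with the hub in [W] or not. The last one keeps every edge. *)
Definition patterns : seq pattern :=
  [:: Pattern false true true false true;
      Pattern false true false false true;
      Pattern true false true true true;
      Pattern true false false true true;
      Pattern false false false true false;
      Pattern false false true false false;
      Pattern true false true true false;
      Pattern false false false false false].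
Definition pivots : seq (pred 'I_n) :=
  [:: hub; hub'; hub''; upper hub; upper hub'; upper hub''; rung; rung'; twin1; twin2; widest].

Definition whites : seq (pred 'I_n) := [seq paint b p | b <- patterns, p <- pivots].

Definition bad W u := W u && nb (fun y => W y || (cnt (predC W) y != 1%N)) u.
Definition goodK W v := ~~ kex comp (bad W) v.
(** Counting every kept edge from both ends avoids choosing orientations and does not affect
    comparisons. *)
Definition KW W v : R := kwsum comp (predC W) (wsum G w (predC W)) v.
(** Both tests are constant on components, so the choice is made for whole components, independently
    of each other. *)
Definition better W W' v := if goodK W v && (KW W v <= KW W' v)%R then W v else W' v.
Definition best := foldr better xpred0 whites.

End Algorithm.

(** * Every object of the algorithm is computable in linear time *)

Section Computable.
Variable R : realType.
Notation inst := (inst R).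
Notation cb := (@cb R).
Notation cn := (@cn R).

Lemma cn_lab k : cn (fun I => lab (igr I) k).
Proof.
elim: k => [|k IH]; first exact: cn_val.
apply: cn_ext (cn_add IH (cn_sub (cn_nmax IH) IH)) => I v.
by rewrite /= maxnE.
Qed.

Lemma cb_gpick p : cb p -> cb (fun I => gpick (p I)).
Proof. by move=> cp; apply: cb_kpick => //; apply: cn_const. Qed.

Lemma cb_cpick p : cb p -> cb (fun I => cpick (igr I) (p I)).
Proof. by move=> cp; apply: cb_kpick => //; apply: cn_lab. Qed.

Lemma cb_gex p : cb p -> cb (fun I => gex (p I)).
Proof. by move=> cp; apply: cb_kex => //; apply: cn_const. Qed.

Lemma cb_like f g t : cn f -> cn g -> cb t -> cb (fun I => like (@f I) (@g I) (t I)).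
Proof.
move=> cf cg ct; apply: cb_eqn => //; apply: (cn_kmax (key := fun _ _ => 0%N)).
  exact: cn_const.
by apply: cn_if => //; apply: cn_const.
Qed.

Lemma cb_same t : cb t -> cb (fun I => same (igr I) (t I)).
Proof. by move=> ct; apply: cb_like => //; apply: cn_lab. Qed.

Lemma cb_adjb p p' : cb p -> cb p' -> cb (fun I => adjb (igr I) (p I) (p' I)).
Proof. by move=> cp cp'; apply: cb_gex; apply: cb_and => //; apply: cb_nb. Qed.

Lemma cb_exactly p p' : cb p -> cb p' -> cb (fun I => exactly (igr I) (p I) (p' I)).
Proof.
move=> cp cp'; apply: cb_and.
  by apply: cb_not; apply: cb_nb; apply: cb_and => //; apply: cb_not.
by apply: cb_eqn; [apply: cn_cnt | apply: cn_kcnt => //; apply: cn_lab].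
Qed.

Lemma cn_succ f : cn f -> cn (fun I v => (f I v).+1).
Proof.
move=> cf; apply: cn_ext (cn_add cf (cn_const R 1)) => I v.
by rewrite addn1.
Qed.

Ltac cb_step := lazymatch goal with
  | |- cb (fun I => gpick (@?p I)) => apply: cb_gpick
  | |- cb (fun I v => gpick (@?p I) v) => apply: cb_gpick
  | |- cb (fun I => cpick (igr I) (@?p I)) => apply: cb_cpick
  | |- cb (fun I v => cpick (igr I) (@?p I) v) => apply: cb_cpick
  | |- cb (fun I => gex (@?p I)) => apply: cb_gex
  | |- cb (fun I v => gex (@?p I) v) => apply: cb_gex
  | |- cb (fun I => same (igr I) (@?p I)) => apply: cb_same
  | |- cb (fun I v => same (igr I) (@?p I) v) => apply: cb_same
  | |- cb (fun I => like (@?f I) (@?g I) (@?p I)) => apply: cb_like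
  | |- cb (fun I v => like (@?f I) (@?g I) (@?p I) v) => apply: cb_like
  | |- cb (fun I => nb (igr I) (@?p I)) => apply: cb_nb
  | |- cb (fun I v => nb (igr I) (@?p I) v) => apply: cb_nb
  | |- cb (fun I => kex (@?k I) (@?p I)) => apply: cb_kex
  | |- cb (fun I v => kex (@?k I) (@?p I) v) => apply: cb_kex
  | |- cb (fun I => kargmax (@?k I) (@?f I) (@?p I)) => apply: cb_kargmax
  | |- cb (fun I v => kargmax (@?k I) (@?f I) (@?p I) v) => apply: cb_kargmax
  | |- cb (fun I => kargmin (@?k I) (@?r I) (@?p I)) => apply: cb_kargmin
  | |- cb (fun I v => kargmin (@?k I) (@?r I) (@?p I) v) => apply: cb_kargmin
  | |- cb (fun I => exactly (igr I) (@?p I) (@?r I)) => apply: cb_exactly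
  | |- cb (fun I v => exactly (igr I) (@?p I) (@?r I) v) => apply: cb_exactly
  | |- cb (fun I v => (@?p I v) && (@?r I v)) => apply: cb_and
  | |- cb (fun I v => (@?p I v) || (@?r I v)) => apply: cb_or
  | |- cb (fun I v => ~~ (@?p I v)) => apply: cb_not
  | |- cb (fun I v => ((@?f I v) <= (@?g I v))%N) => apply: cb_leq
  | |- cb (fun I v => (@?f I v) == (@?g I v) :> nat) => apply: cb_eqn
  | |- cb (fun I => xpredT) => apply: cb_const
  | |- cn (fun I => lab (igr I) ?k) => apply: cn_lab
  | |- cn (fun I v => lab (igr I) ?k v) => apply: cn_lab
  | |- cn (fun I => cnt (igr I) (@?p I)) => apply: cn_cnt
  | |- cn (fun I v => cnt (igr I) (@?p I) v) => apply: cn_cnt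
  | |- cn (fun I => kcnt (@?k I) (@?p I)) => apply: cn_kcnt
  | |- cn (fun I v => kcnt (@?k I) (@?p I) v) => apply: cn_kcnt
  | |- cn (fun I v => nat_of_bool (@?p I v)) => change (cb p)
  | |- cn (fun I v => (@?f I v).+1) => apply: cn_succ
  | |- cn (fun I v => val v) => apply: cn_val
  | |- cn (fun I v => nat_of_ord v) => apply: cn_val
  | |- cr (fun I => wsum (igr I) (@iwt _ I) (@?p I)) => apply: cr_wsum
  end.
Ltac cb_tac := repeat first [ assumption | solve [auto 1 with cb_db nocore] | cb_step ].

Create HintDb cb_db.

Lemma cb_long4 : cb (fun I => long4 (igr I)).
Proof. by rewrite /long4; cb_tac. Qed.
#[local] Hint Resolve cb_long4 : cb_db.
Lemma cb_hit k : cb (fun I => hit (igr I) k).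
Proof. by rewrite /hit; cb_tac. Qed.
#[local] Hint Resolve cb_hit : cb_db.
Lemma cb_long3 : cb (fun I => long3 (igr I)).
Proof. by rewrite /long3; cb_tac. Qed.
#[local] Hint Resolve cb_long3 : cb_db.
Lemma cb_long2 : cb (fun I => long2 (igr I)).
Proof. by rewrite /long2; cb_tac. Qed.
#[local] Hint Resolve cb_long2 : cb_db.
Lemma cb_long1 : cb (fun I => long1 (igr I)).
Proof. by rewrite /long1; cb_tac. Qed.
#[local] Hint Resolve cb_long1 : cb_db.
Lemma cb_long0 : cb (fun I => long0 (igr I)).
Proof. by rewrite /long0; cb_tac. Qed.
#[local] Hint Resolve cb_long0 : cb_db.
Lemma cb_rootv : cb (fun I => rootv (igr I)).
Proof. by rewrite /rootv; cb_tac. Qed.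
#[local] Hint Resolve cb_rootv : cb_db.
Lemma cb_R1 : cb (fun I => R1 (igr I)).
Proof. by rewrite /R1; cb_tac. Qed.
#[local] Hint Resolve cb_R1 : cb_db.
Lemma cb_R2 : cb (fun I => R2 (igr I)).
Proof. by rewrite /R2; cb_tac. Qed.
#[local] Hint Resolve cb_R2 : cb_db.
Lemma cb_center : cb (fun I => center (igr I)).
Proof. by rewrite /center; cb_tac. Qed.
#[local] Hint Resolve cb_center : cb_db.
Lemma cb_L1 : cb (fun I => L1 (igr I)).
Proof. by rewrite /L1; cb_tac. Qed.
#[local] Hint Resolve cb_L1 : cb_db.
Lemma cb_L2 : cb (fun I => L2 (igr I)).
Proof. by rewrite /L2; cb_tac. Qed.
#[local] Hint Resolve cb_L2 : cb_db.
Lemma cb_deep_z : cb (fun I => deep_z (igr I)).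
Proof. by rewrite /deep_z; cb_tac. Qed.
#[local] Hint Resolve cb_deep_z : cb_db.
Lemma cb_deep_z' : cb (fun I => deep_z' (igr I)).
Proof. by rewrite /deep_z'; cb_tac. Qed.
#[local] Hint Resolve cb_deep_z' : cb_db.
Lemma cb_deep_x' : cb (fun I => deep_x' (igr I)).
Proof. by rewrite /deep_x'; cb_tac. Qed.
#[local] Hint Resolve cb_deep_x' : cb_db.
Lemma cb_deep_c : cb (fun I => deep_c (igr I)).
Proof. by rewrite /deep_c; cb_tac. Qed.
#[local] Hint Resolve cb_deep_c : cb_db.
Lemma cb_deep_r : cb (fun I => deep_r (igr I)).
Proof. by rewrite /deep_r; cb_tac. Qed.
#[local] Hint Resolve cb_deep_r : cb_db.
Lemma cb_deep_u : cb (fun I => deep_u (igr I)).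
Proof. by rewrite /deep_u; cb_tac. Qed.
#[local] Hint Resolve cb_deep_u : cb_db.
Lemma cb_hub : cb (fun I => hub (igr I)).
Proof. by rewrite /hub; cb_tac. Qed.
#[local] Hint Resolve cb_hub : cb_db.
Lemma cb_hub' : cb (fun I => hub' (igr I)).
Proof. by rewrite /hub'; cb_tac. Qed.
#[local] Hint Resolve cb_hub' : cb_db.
Lemma cb_hub'' : cb (fun I => hub'' (igr I)).
Proof. by rewrite /hub''; cb_tac. Qed.
#[local] Hint Resolve cb_hub'' : cb_db.
Lemma cb_upper p : cb p -> cb (fun I => upper (igr I) (p I)).
Proof. by move=> cp; rewrite /upper; cb_tac. Qed.
#[local] Hint Resolve cb_upper : cb_db.
Lemma cb_rung : cb (fun I => rung (igr I)).
Proof. by rewrite /rung; cb_tac. Qed.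
#[local] Hint Resolve cb_rung : cb_db.
Lemma cb_rung' : cb (fun I => rung' (igr I)).
Proof. by rewrite /rung'; cb_tac. Qed.
#[local] Hint Resolve cb_rung' : cb_db.
Lemma cb_iso1 : cb (fun I => iso1 (igr I)).
Proof. by rewrite /iso1; cb_tac. Qed.
#[local] Hint Resolve cb_iso1 : cb_db.
Lemma cb_iso2 : cb (fun I => iso2 (igr I)).
Proof. by rewrite /iso2; cb_tac. Qed.
#[local] Hint Resolve cb_iso2 : cb_db.
Lemma cb_twin1 : cb (fun I => twin1 (igr I) (@iwt R I)).
Proof. by rewrite /twin1 /wdeg; cb_tac. Qed.
#[local] Hint Resolve cb_twin1 : cb_db.
Lemma cb_twin2 : cb (fun I => twin2 (igr I) (@iwt R I)).
Proof. by rewrite /twin2 /wdeg; cb_tac. Qed.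
#[local] Hint Resolve cb_twin2 : cb_db.
Lemma cb_hub_side : cb (fun I => hub_side (igr I)).
Proof. by rewrite /hub_side; cb_tac. Qed.
#[local] Hint Resolve cb_hub_side : cb_db.
Lemma cb_remote : cb (fun I => remote (igr I)).
Proof. by rewrite /remote; cb_tac. Qed.
#[local] Hint Resolve cb_remote : cb_db.
Lemma cb_remote_v : cb (fun I => remote_v (igr I)).
Proof. by rewrite /remote_v; cb_tac. Qed.
#[local] Hint Resolve cb_remote_v : cb_db.
Lemma cb_remote_h : cb (fun I => remote_h (igr I)).
Proof. by rewrite /remote_h; cb_tac. Qed.
#[local] Hint Resolve cb_remote_h : cb_db.
Lemma cb_remote_c : cb (fun I => remote_c (igr I)).
Proof. by rewrite /remote_c; cb_tac. Qed.
#[local] Hint Resolve cb_remote_c : cb_db.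
Lemma cb_remote_y : cb (fun I => remote_y (igr I)).
Proof. by rewrite /remote_y; cb_tac. Qed.
#[local] Hint Resolve cb_remote_y : cb_db.
Lemma cb_remote_y' : cb (fun I => remote_y' (igr I)).
Proof. by rewrite /remote_y'; cb_tac. Qed.
#[local] Hint Resolve cb_remote_y' : cb_db.
Lemma cb_partial : cb (fun I => partial (igr I)).
Proof. by rewrite /partial; cb_tac. Qed.
#[local] Hint Resolve cb_partial : cb_db.
Lemma cb_widest : cb (fun I => widest (igr I)).
Proof. by rewrite /widest; cb_tac. Qed.
#[local] Hint Resolve cb_widest : cb_db.
Lemma cb_apart : cb (fun I => apart (igr I)).
Proof. by rewrite /apart; cb_tac. Qed.
#[local] Hint Resolve cb_apart : cb_db.
Lemma cb_apart_v : cb (fun I => apart_v (igr I)).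
Proof. by rewrite /apart_v; cb_tac. Qed.
#[local] Hint Resolve cb_apart_v : cb_db.
Lemma cb_apart_m : cb (fun I => apart_m (igr I)).
Proof. by rewrite /apart_m; cb_tac. Qed.
#[local] Hint Resolve cb_apart_m : cb_db.
Lemma cb_apart_c : cb (fun I => apart_c (igr I)).
Proof. by rewrite /apart_c; cb_tac. Qed.
#[local] Hint Resolve cb_apart_c : cb_db.
Lemma cb_apart_a' : cb (fun I => apart_a' (igr I)).
Proof. by rewrite /apart_a'; cb_tac. Qed.
#[local] Hint Resolve cb_apart_a' : cb_db.
Lemma cb_apart_a : cb (fun I => apart_a (igr I)).
Proof. by rewrite /apart_a; cb_tac. Qed.
#[local] Hint Resolve cb_apart_a : cb_db.
Lemma cb_seen : cb (fun I => seen (igr I)).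
Proof. by rewrite /seen; cb_tac. Qed.
#[local] Hint Resolve cb_seen : cb_db.
Lemma cb_unseen : cb (fun I => unseen (igr I)).
Proof. by rewrite /unseen; cb_tac. Qed.
#[local] Hint Resolve cb_unseen : cb_db.
Lemma cb_side0 : cb (fun I => side0 (igr I)).
Proof. by rewrite /side0; cb_tac. Qed.
#[local] Hint Resolve cb_side0 : cb_db.
Lemma cb_side1 : cb (fun I => side1 (igr I)).
Proof. by rewrite /side1; cb_tac. Qed.
#[local] Hint Resolve cb_side1 : cb_db.
Lemma cb_crossed : cb (fun I => crossed (igr I)).
Proof. by rewrite /crossed; cb_tac. Qed.
#[local] Hint Resolve cb_crossed : cb_db.
Lemma cb_crossed_x : cb (fun I => crossed_x (igr I)).
Proof. by rewrite /crossed_x; cb_tac. Qed.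
#[local] Hint Resolve cb_crossed_x : cb_db.
Lemma cb_crossed_y : cb (fun I => crossed_y (igr I)).
Proof. by rewrite /crossed_y; cb_tac. Qed.
#[local] Hint Resolve cb_crossed_y : cb_db.
Lemma cb_crossed_a : cb (fun I => crossed_a (igr I)).
Proof. by rewrite /crossed_a; cb_tac. Qed.
#[local] Hint Resolve cb_crossed_a : cb_db.
Lemma cb_crossed_c : cb (fun I => crossed_c (igr I)).
Proof. by rewrite /crossed_c; cb_tac. Qed.
#[local] Hint Resolve cb_crossed_c : cb_db.
Lemma cb_crossed_b : cb (fun I => crossed_b (igr I)).
Proof. by rewrite /crossed_b; cb_tac. Qed.
#[local] Hint Resolve cb_crossed_b : cb_db.
Lemma cb_all T (f : T -> forall I : inst, pred 'I_(isz I)) (s : seq T) :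
  (forall i, cb (f i)) -> cb (fun I v => all (fun i => f i I v) s).
Proof.
move=> cf; elim: s => [|i s IH]; first exact: cb_const.
exact: cb_and (cf i) IH.
Qed.

(** A fixed program can only run through a list whose length does not depend on the instance; hence
    lists of families, specialised to an instance afterwards. *)
Notation family := (forall I : inst, pred 'I_(isz I)).
Notation at_ I l := [seq F I | F <- l].

Fixpoint all_cb (l : seq family) : Prop := if l is F :: l' then cb F /\ all_cb l' else True.

Lemma cb_tup (l : seq family) i : all_cb l -> cb (fun I => tup (at_ I l) i).
Proof.
move=> cl; apply: cb_gpick.
elim: l i cl => [|F l IH] [|i] //= [cF cl]; try exact: cb_const; first exact: cF.
exact: IH.
Qed.

Lemma cb_isP5 (l : seq family) : all_cb l -> cb (fun I => isP5 (igr I) (at_ I l)).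
Proof.
move=> cl; apply: cb_all => i; apply: cb_and; first by apply: cb_gex; apply: cb_tup.
apply: cb_all => j; apply: (cb_eqb (q := fun I v => _)); last exact: cb_const.
by apply: cb_adjb; apply: cb_tup.
Qed.

Fixpoint all_cbs (ls : seq (seq family)) : Prop :=
  if ls is l :: ls' then all_cb l /\ all_cbs ls' else True.

Lemma cb_found (ls : seq (seq family)) :
  all_cbs ls -> cb (fun I => found (igr I) [seq at_ I l | l <- ls]).
Proof.
elim: ls => [_|l ls IH [cl cls]]; first exact: cb_const.
by apply: cb_or; [apply: cb_isP5 | apply: IH].
Qed.

Lemma cb_select (ls : seq (seq family)) i :
  all_cbs ls -> cb (fun I => select (igr I) [seq at_ I l | l <- ls] i).
Proof.
elim: ls => [_|l ls IH [cl cls]]; first exact: cb_const.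
by apply: cb_if; [apply: cb_isP5 | apply: cb_tup | apply: IH].
Qed.

Definition tuple_families : seq (seq family) :=
  let g (f : forall n, sgraph 'I_n -> pred 'I_n) : family := fun I => f _ (igr I) in
  [:: [:: g long4; g long3; g long2; g long1; g long0];
      [:: g deep_u; g deep_c; g deep_r; g deep_x'; g deep_z'];
      [:: g deep_z; g deep_z'; g deep_x'; g deep_c; g deep_u];
      [:: g deep_r; g deep_c; g deep_u; g deep_z'; g deep_z];
      [:: g remote_h; g remote_y; g remote_c; g remote_y'; g remote_v];
      [:: g apart_m; g apart_a; g apart_c; g apart_a'; g apart_v];
      [:: g crossed_x; g crossed_a; g crossed_c; g crossed_b; g crossed_y]].

Lemma tuple_families_cb : all_cbs tuple_families.
Proof. by repeat split; auto 1 with cb_db nocore. Qed.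

Lemma cb_found_tuples : cb (fun I => found (igr I) (tuples (igr I))).
Proof. exact: cb_found tuple_families_cb. Qed.

Lemma cb_select_tuples i : cb (fun I => select (igr I) (tuples (igr I)) i).
Proof. exact: cb_select tuple_families_cb. Qed.

Lemma cb_paint b p : cb p -> cb (fun I => paint (igr I) b (p I)).
Proof.
move=> cp; apply: cb_and; first by apply: cb_not; apply: cb_and => //; apply: cb_const.
have cL1 := cb_L1; have cL2 := cb_L2; have c_center := cb_center.
apply: cb_or; first by apply: cb_and => //; apply: cb_const.
apply: cb_or; first by apply: cb_and => //; apply: cb_const.
apply: cb_and => //; apply: cb_if; [exact: cb_nb | exact: cb_const | exact: cb_const].
Qed.

Lemma cb_better W W' : cb W -> cb W' ->
  cb (fun I => better (igr I) (@iwt R I) (W I) (W' I)).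
Proof.
move=> cW cW'; apply: (cb_if (p := fun I v => goodK (igr I) (W I) v &&
  (KW (igr I) (@iwt R I) (W I) v <= KW (igr I) (@iwt R I) (W' I) v)%R)) => //.
have cnW := cb_not cW; have cnW' := cb_not cW'; have clab := cn_lab 3.
apply: cb_and.
  apply: cb_not; apply: cb_kex clab _; apply: cb_and => //; apply: cb_nb; apply: cb_or => //.
  by apply: cb_not; apply: cb_eqn; [apply: cn_cnt | apply: cn_const].
apply: (cb_kwsum_le (p := fun I => predC (W I)) (p' := fun I => predC (W' I))) => //; exact: cr_wsum.
Qed.

Definition pivot_families : seq family :=
  let g (f : forall n, sgraph 'I_n -> pred 'I_n) : family := fun I => f _ (igr I) in
  [:: g hub; g hub'; g hub''; (fun I => upper (igr I) (hub (igr I)));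
      (fun I => upper (igr I) (hub' (igr I))); (fun I => upper (igr I) (hub'' (igr I))); g rung; g rung'; (fun I => twin1 (igr I) (@iwt R I));
      (fun I => twin2 (igr I) (@iwt R I)); g widest].

Lemma pivot_families_cb : all_cb pivot_families.
Proof. by repeat split; try apply: cb_upper; auto 1 with cb_db nocore. Qed.

Lemma cb_fold_better b (ps : seq family) (acc : family) : all_cb ps -> cb acc ->
  cb (fun I => foldr (better (igr I) (@iwt R I)) (acc I) [seq paint (igr I) b p | p <- at_ I ps]).
Proof.
move=> cps cacc; elim: ps cps => [|p ps IH] //= [cp cps].
by apply: cb_better; [apply: cb_paint | apply: IH].
Qed.

Lemma foldr_allpairs S T A (f : S -> T -> A) (h : A -> A -> A) z (bs : seq S) (ps : seq T) :
  foldr h z [seq f b p | b <- bs, p <- ps] =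
  foldr (fun b acc => foldr h acc [seq f b p | p <- ps]) z bs.
Proof. by elim: bs => //= b bs <-; rewrite foldr_cat. Qed.

Lemma pivotsE I : pivots (igr I) (@iwt R I) = at_ I pivot_families.
Proof. by []. Qed.

Lemma cb_best : cb (fun I => best (igr I) (@iwt R I)).
Proof.
have fold (bs : seq pattern) (ps : seq family) : all_cb ps ->
    cb (fun I => foldr (better (igr I) (@iwt R I)) xpred0
                   [seq paint (igr I) b p | b <- bs, p <- at_ I ps]).
  move=> cps; apply: (cb_ext (p := fun I => foldr (fun b acc => foldr (better (igr I) (@iwt R I)) acc
    [seq paint (igr I) b p | p <- at_ I ps]) xpred0 bs)) => [I v|].
    by rewrite foldr_allpairs.
  elim: bs => [|b bs IH]; first exact: cb_const.
  exact: (cb_fold_better b cps IH).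
apply: cb_ext (fold patterns _ pivot_families_cb) => I v.
by rewrite -pivotsE.
Qed.

End Computable.

(** * Correctness *)

Section Picks.
Variables (n : nat) (key : 'I_n -> nat).
Implicit Types (u v : 'I_n) (p : pred 'I_n).

Lemma kargmax_sub f p u : kargmax key f p u -> p u.
Proof. by case/andP. Qed.

Lemma kargmax_max f p u u' : kargmax key f p u -> p u' -> key u' = key u -> (f u' <= f u)%N.
Proof. by case/andP=> _ /forallP/(_ u'); case: (p u') => // h _ e; rewrite e eqxx in h. Qed.

Lemma kargmax_ex f p u : p u -> exists2 u', kargmax key f p u' & key u' = key u.
Proof.
move=> pu; pose P u' := (key u' == key u) && p u'.
have Pu : P u by rewrite /P eqxx.
case: (arg_maxnP f Pu) => u' /andP[/eqP k' p'] hmax; exists u' => //.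
rewrite /kargmax p'; apply/forallP => v; apply/implyP => /andP[kv pv].
by apply: hmax; rewrite /P pv -k' kv.
Qed.

Lemma kargmin_ex (R : realType) (r : 'I_n -> R) p u : p u ->
  exists2 u', kargmin key r p u' & key u' = key u.
Proof.
move=> pu; pose P u' := (key u' == key u) && p u'.
have Pu : P u by rewrite /P eqxx.
case: (Order.TotalTheory.arg_minP r Pu) => u' /andP[/eqP k' p'] hmin; exists u' => //.
rewrite /kargmin p'; apply/forallP => v; apply/implyP => /andP[kv pv].
by apply: hmin; rewrite /P pv -k' kv.
Qed.

Lemma kpick_sub p u : kpick key p u -> p u.
Proof. exact: kargmax_sub. Qed.

Lemma kpick_ex p u : p u -> exists2 u', kpick key p u' & key u' = key u.
Proof. exact: kargmax_ex. Qed.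

Lemma kpick_uniq p u u' : kpick key p u -> kpick key p u' -> key u = key u' -> u = u'.
Proof.
move=> pu pu' e; apply: val_inj; apply/eqP; rewrite eqn_leq.
have le := kargmax_max pu (kpick_sub pu') (esym e).
by have ge := kargmax_max pu' (kpick_sub pu) e; rewrite ge.
Qed.

Lemma kpick_id p u : kpick key p u -> kpick key (kpick key p) u.
Proof.
move=> pu; rewrite {1}/kpick /kargmax pu; apply/forallP => v; apply/implyP => /andP[/eqP e pv].
by rewrite (kpick_uniq pv pu).
Qed.

End Picks.

(** * The five-tuple test and the reported path *)

Section Soundness.
Variables (n : nat) (G : sgraph 'I_n).
Implicit Types (u v : 'I_n) (p t : pred 'I_n) (l : seq (pred 'I_n)).

Lemma gpick_ex p u : p u -> exists u', gpick p u'.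
Proof. by move=> /(kpick_ex (fun=> 0%N))[u' ? _]; exists u'. Qed.

Lemma gpick_sub p u : gpick p u -> p u.
Proof. exact: kpick_sub. Qed.

Lemma gpick_uniq p u u' : gpick p u -> gpick p u' -> u = u'.
Proof. by move=> h h'; apply: kpick_uniq h h' _. Qed.

Lemma nb_uniq t a v : t a -> (forall u, t u -> u = a) -> nb G t v = G v a.
Proof.
move=> ta un; apply/existsP/idP => [[y /andP[vy /un <-]] //|va].
by exists a; rewrite va.
Qed.

Lemma gexP p v : reflect (exists u, p u) (gex p v).
Proof. exact: existsP. Qed.

Lemma adjb_uniq t t' a a' v : t a -> (forall u, t u -> u = a) -> t' a' ->
  (forall u, t' u -> u = a') -> adjb G t t' v = G a a'.
Proof.
move=> ta ut ta' ut'; apply/gexP/idP => [[u /andP[/ut ->]]|aa'].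
  by rewrite (nb_uniq _ ta' ut').
by exists a; rewrite ta (nb_uniq _ ta' ut').
Qed.

(** Injectivity follows from the adjacencies alone: no two vertices of P5 have the same
    neighbours. *)
Lemma isP5_sound l v : isP5 G l v ->
  exists f : 'I_5 -> 'I_n, induced_embedding (path_graph 5) G f /\
    forall i : 'I_5, tup l i (f i).
Proof.
move=> /allP h.
have ex (i : 'I_5) : exists u, tup l i u.
  have := h i; rewrite mem_iota /= => /(_ (ltn_ord i))/andP[/gexP].
  by [].
pose f i := xchoose (ex i); have fP (i : 'I_5) : tup l i (f i) := xchooseP (ex i).
have uf (i : 'I_5) u : tup l i u -> u = f i by move=> tu; apply: gpick_uniq tu (fP i).
have adjE (i j : 'I_5) : G (f i) (f j) = path_adj i j.
  have := h i; rewrite mem_iota => /(_ (ltn_ord i))/andP[_ /allP hj].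
  have := hj j; rewrite mem_iota => /(_ (ltn_ord j))/eqP.
  by rewrite (adjb_uniq v (fP i) (uf i) (fP j) (uf j)).
exists f; split=> //; split=> // i j fij.
have e k : path_adj i k = path_adj j k by rewrite -!adjE fij.
apply: val_inj; move: (e (inord 0)) (e (inord 1)) (e (inord 2)) (e (inord 3)) (e (inord 4)).
rewrite /path_adj !inordK // {e fij}; case: i => [[|[|[|[|[|i]]]]] lti] //=;
  by case: j => [[|[|[|[|[|j]]]]] ltj].
Qed.

Lemma isP5_complete l v (a b c d e : 'I_n) :
  tup l 0 a -> tup l 1 b -> tup l 2 c -> tup l 3 d -> tup l 4 e ->
  G a b -> G b c -> G c d -> G d e ->
  ~~ G a c -> ~~ G a d -> ~~ G a e -> ~~ G b d -> ~~ G b e -> ~~ G c e ->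
  isP5 G l v.
Proof.
move=> ta tb tc td te ab bc cd de ac ad ae bd be ce.
have un i u u' : tup l i u -> tup l i u' -> u' = u by move=> h h'; apply: gpick_uniq h' h.
pose f i := nth a [:: a; b; c; d; e] i.
have tf i : (i < 5)%N -> tup l i (f i) by case: i => [|[|[|[|[|i]]]]].
apply/allP => i; rewrite mem_iota => lti; apply/andP; split.
  by apply/gexP; exists (f i); apply: tf.
apply/allP => j; rewrite mem_iota => ltj.
rewrite (adjb_uniq v (tf i lti) (fun u => un i _ u (tf i lti))
  (tf j ltj) (fun u => un j _ u (tf j ltj))).
have sy := adj_sym G.
case: i lti => [|[|[|[|[|i]]]]] //= _; case: j ltj => [|[|[|[|[|j]]]]] //= _;
  by rewrite /f /= ?adj_irr // ?ab ?bc ?cd ?de ?(negPf ac) ?(negPf ad) ?(negPf ae)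
    ?(negPf bd) ?(negPf be) ?(negPf ce) // sy
    ?ab ?bc ?cd ?de ?(negPf ac) ?(negPf ad) ?(negPf ae) ?(negPf bd) ?(negPf be) ?(negPf ce).
Qed.

Lemma select_found (ls : seq (seq (pred 'I_n))) v : found G ls v ->
  exists2 l, isP5 G l v & forall i u, select G ls i u = tup l i u.
Proof.
elim: ls => // l ls IH /=; case P5: (isP5 G l v) => /= h.
  by exists l => // i u; rewrite (_ : isP5 G l u = isP5 G l v) ?P5.
have [l' P5' sel] := IH h; exists l' => // i u.
by rewrite (_ : isP5 G l u = isP5 G l v) ?P5.
Qed.

End Soundness.

(** * Labels, components and the center *)

Section Center.
Variables (n : nat) (G : sgraph 'I_n).
Implicit Types (u v x y : 'I_n) (p t : pred 'I_n).
Hypothesis noP5 : forall v, ~~ found G (tuples G) v.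
Local Notation L := (lab G 3).

Lemma not_tuple k v : (k < 7)%N -> ~~ isP5 G (nth [::] (tuples G) k) v.
Proof.
move=> k7; have := noP5 v; rewrite /found -all_predC => /(all_nthP [::]).
by move=> /(_ k); apply.
Qed.

Lemma gpick_tup p u : gpick p u -> gpick (gpick p) u.
Proof. exact: kpick_id. Qed.

Lemma like_uniq f g t a v : t a -> (forall u, t u -> u = a) -> like f g t v = (f a == g v).
Proof.
move=> ta ut; rewrite /like; congr (_ == _); apply/eqP; rewrite eqn_leq.
apply/andP; split.
  by apply/bigmax_leqP => u _; case: ifP => // /ut ->.
by apply: (bigop.bigmax_sup a) => //; rewrite ta.
Qed.

Lemma lab_mono k v : (lab G k v <= lab G k.+1 v)%N.
Proof. exact: leq_maxl. Qed.

Lemma lab_nbr k v y : G v y -> (lab G k y <= lab G k.+1 v)%N.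
Proof.
by move=> vy; rewrite /= leq_max; apply/orP; right; apply: (bigop.bigmax_sup y).
Qed.

Lemma lab_step k v : (lab G k v < lab G k.+1 v)%N ->
  exists2 y, G v y & lab G k y = lab G k.+1 v.
Proof.
move=> lt; have e : lab G k.+1 v = nmax G (lab G k) v.
  by move: lt => /=; rewrite leq_max ltnn /= => /ltnW/maxn_idPr.
rewrite {}e in lt *; have : (0 < #|[pred y | G v y]|)%N.
  rewrite lt0n; apply: contraL lt => /eqP/card0_eq e0.
  by rewrite /nmax big_pred0 // => y; have := e0 y.
by case/(bigop.eq_bigmax_cond (lab G k)) => y vy e; exists y.
Qed.

(** Suppose the label [B] reaches [v4] only in the fourth round. Going back, it reaches [v3], [v2],
    [v1], [v0] in rounds 3, 2, 1, 0 and not before. An edge between two non-consecutive ones would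
    have carried [B] faster, so these vertices form an induced P5. *)
Lemma lab_stable v : lab G 4 v = lab G 3 v.
Proof.
apply/eqP/negPn/negP => ne; have [v4 h4] := gpick_ex (p := fun v => lab G 4 v != lab G 3 v) ne.
set B := lab G 4 v4.
have u4 u : long4 G u -> u = v4 by move=> h; apply: gpick_uniq h h4.
have hitE k u : hit G k u = (B == lab G k u) by rewrite /hit (like_uniq _ _ _ h4 u4).
have lt4 : (lab G 3 v4 < B)%N.
  by rewrite ltn_neqAle lab_mono andbT eq_sym; exact: gpick_sub h4.
have [v3' a3 b3] := lab_step lt4.
have [v3 h3] : exists v3, long3 G v3.
  by apply: (gpick_ex (u := v3')); rewrite (nb_uniq _ _ h4 u4) hitE adj_sym a3 b3 /=.
have u3 u : long3 G u -> u = v3 by move=> h; apply: gpick_uniq h h3.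
have := gpick_sub h3; rewrite (nb_uniq _ _ h4 u4) hitE adj_sym => /andP[g43 /eqP l3].
have lt3 : (lab G 2 v3 < B)%N by apply: leq_ltn_trans lt4; apply: lab_nbr.
have [v2' a2 b2] : exists2 y, G v3 y & lab G 2 y = lab G 3 v3 by apply: lab_step; rewrite -l3.
have [v2 h2] : exists v2, long2 G v2.
  by apply: (gpick_ex (u := v2')); rewrite (nb_uniq _ _ h3 u3) hitE adj_sym a2 b2 l3 /=.
have u2 u : long2 G u -> u = v2 by move=> h; apply: gpick_uniq h h2.
have := gpick_sub h2; rewrite (nb_uniq _ _ h3 u3) hitE adj_sym => /andP[g32 /eqP l2].
have lt2 : (lab G 1 v2 < B)%N by apply: leq_ltn_trans lt3; apply: lab_nbr.
have [v1' a1 b1] : exists2 y, G v2 y & lab G 1 y = lab G 2 v2 by apply: lab_step; rewrite -l2.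
have [v1 h1] : exists v1, long1 G v1.
  by apply: (gpick_ex (u := v1')); rewrite (nb_uniq _ _ h2 u2) hitE adj_sym a1 b1 l2 /=.
have u1 u : long1 G u -> u = v1 by move=> h; apply: gpick_uniq h h1.
have := gpick_sub h1; rewrite (nb_uniq _ _ h2 u2) hitE adj_sym => /andP[g21 /eqP l1].
have lt1 : (lab G 0 v1 < B)%N by apply: leq_ltn_trans lt2; apply: lab_nbr.
have [v0' a0 b0] : exists2 y, G v1 y & lab G 0 y = lab G 1 v1 by apply: lab_step; rewrite -l1.
have [v0 h0] : exists v0, long0 G v0.
  by apply: (gpick_ex (u := v0')); rewrite (nb_uniq _ _ h1 u1) hitE adj_sym a0 b0 l1 /=.
have := gpick_sub h0; rewrite (nb_uniq _ _ h1 u1) hitE adj_sym => /andP[g10 /eqP l0].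
have nadj k k' x y : (lab G k' x < B)%N -> (k < k')%N -> B = lab G k y -> ~~ G x y.
  move=> ltx kk' ly; apply/negP => xy; have := lab_nbr k xy; rewrite -ly leqNgt => /negP; apply.
  apply: leq_ltn_trans ltx; rewrite -(subnK kk'); elim: (_ - _)%N => // d IH.
  by rewrite addSn; apply: leq_trans (lab_mono _ _).
apply/negP: (not_tuple (k := 0) v isT); rewrite negbK.
apply: (@isP5_complete _ _ _ v v4 v3 v2 v1 v0) => //; try exact: gpick_tup.
- exact: (nadj 2 3).
- exact: (nadj 1 3)%N.
- exact: (nadj 0 3)%N.
- exact: (nadj 1 2)%N.
- exact: (nadj 0 2)%N.
- exact: (nadj 0 1)%N.
Qed.

(** From here on, equality of labels stands for lying in the same component. *)
Lemma lab_adj x y : G x y -> L x = L y.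
Proof.
move=> xy; apply/eqP; rewrite eqn_leq; apply/andP.
by split; rewrite -[X in (_ <= X)%N]lab_stable lab_nbr // adj_sym.
Qed.

(* Otherwise [done] compares labels by unfolding them. *)
#[local] Opaque lab.

Lemma cpick_ex p u : p u -> exists2 u', cpick G p u' & L u' = L u.
Proof. exact: kpick_ex. Qed.

Lemma cpick_sub p u : cpick G p u -> p u.
Proof. exact: kpick_sub. Qed.

Lemma cpick_uniq p u u' : cpick G p u -> cpick G p u' -> L u = L u' -> u = u'.
Proof. exact: kpick_uniq. Qed.

Lemma nb_comp p a v : p a -> (forall u, p u -> L u = L a -> u = a) -> L v = L a ->
  nb G p v = G v a.
Proof.
move=> pa ua va; apply/existsP/idP => [[y /andP[vy py]]|vy]; last by exists a; rewrite vy.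
by have <- : y = a by apply: ua => //; rewrite -va (lab_adj vy).
Qed.

Lemma nb_cpick p a v : cpick G p a -> L v = L a -> nb G (cpick G p) v = G v a.
Proof. by move=> pa; apply: nb_comp => // u pu; apply: cpick_uniq pu pa. Qed.

(** Unwinding the three rounds gives a walk, possibly with halts, from the vertex whose number is
    the label of [v]. This vertex has the same label, so it is a root. *)
Lemma reach v : exists r y1 y2,
  [/\ rootv G r, r = y1 \/ G r y1, y1 = y2 \/ G y1 y2 & y2 = v \/ G y2 v].
Proof.
have back k x : exists2 y, y = x \/ G y x & lab G k y = lab G k.+1 x.
  case: (ltnP (lab G k x) (lab G k.+1 x)) => [/lab_step[y xy e]|le].
    by exists y => //; right; rewrite adj_sym.
  by exists x; [left | apply/eqP; rewrite eqn_leq lab_mono].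
have [y2 s2 e2] := back 2 v; have [y1 s1 e1] := back 1%N y2.
have [r s0 e0] := back 0%N y1.
exists r, y1, y2; split=> //.
have same_comp x y : x = y \/ G x y -> L x = L y by case=> [->|/lab_adj].
by rewrite /rootv (same_comp _ _ s0) (same_comp _ _ s1) (same_comp _ _ s2) -e2 -e1 -e0.
Qed.

Lemma rootv_uniq r r' : rootv G r -> rootv G r' -> L r = L r' -> r = r'.
Proof. by move=> /eqP er /eqP er' e; apply: val_inj; rewrite /= -er -er'. Qed.

Lemma R1E r v : rootv G r -> L v = L r -> R1 G v = G v r.
Proof. by move=> rr; apply: nb_comp => // u ru; apply: rootv_uniq. Qed.

Lemma L1E c v : center G c -> L v = L c -> L1 G v = G v c.
Proof. exact: nb_cpick. Qed.

Lemma reach_comp x y : x = y \/ G x y -> L x = L y.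
Proof. by case=> [->|/lab_adj]. Qed.

(** The neighbour [y] matters: the component of an isolated vertex has no center, since its root has
    no neighbour. *)
Lemma center_ex v y : G v y -> exists2 c, center G c & L c = L v.
Proof.
move=> vy; have [r [y1 [y2 [rr s1 s2 s3]]]] := reach v.
have rv : L r = L v by rewrite (reach_comp s1) (reach_comp s2) (reach_comp s3).
have [u ru] : exists u, G r u.
  clear rv; case: s1 => [->|ry1]; last by exists y1.
  case: s2 => [->|ry2]; last by exists y2.
  by case: s3 => [->|rv2]; [exists y | exists v].
have R1u : R1 G u by rewrite (R1E rr (esym (lab_adj ru))) adj_sym.
have [c' hc' e1] := kargmax_ex L (cnt G (R2 G)) R1u.
have [c hc e2] := cpick_ex hc'.
by exists c => //; rewrite e2 e1 -(lab_adj ru) rv.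
Qed.

(** Turns the maximality of a count into a vertex: a maximiser that lacks a neighbour of its rival
    has one that the rival lacks. *)
Lemma card_diff (A B : pred 'I_n) z : (#|B| <= #|A|)%N -> B z -> ~~ A z ->
  exists2 u, A u & ~~ B u.
Proof.
move=> le Bz Az; case: (pickP (predD A B)) => [u /andP[nBu Au]|none]; first by exists u.
have /proper_card : A \proper B.
  apply/properP; split; last by exists z.
  apply/subsetP => u Au; move: (none u); rewrite /= -[in_mem u _]/(A u) in Au *.
  by rewrite Au andbT => /negbFE.
by rewrite ltnNge le.
Qed.

Lemma gpickW p u : p u -> (forall u', p u' -> u' = u) -> gpick p u.
Proof. by move=> pu un; have [u' pu'] := gpick_ex pu; rewrite -(un u' (gpick_sub pu')). Qed.

Lemma sameE t a v : t a -> (forall u, t u -> u = a) -> same G t v = (L a == L v).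
Proof. exact: like_uniq. Qed.

(** Let [z] be at distance at least 3 from [c]. It is at distance 2 or 3 from the root [r], so some
    [z'], equal or adjacent to [z], is at distance 2 from [r], through some [x']. As [c] has at
    least as many neighbours in R2 as [x'] and misses [z'], it has one, [u], that [x'] misses.
    Depending on the adjacencies of [c] with [x'] and of [u] with [z'], one of the sequences
    [u c r x' z'], [z z' x' c u], [r c u z' z] is an induced P5. *)
Lemma center_dom c u : center G c -> L u = L c ->
  [\/ u = c, G c u | exists2 y, G c y & G y u].
Proof.
move=> hc uc; case: (eqVneq u c) => [|uNc]; first by constructor 1.
case cu: (G c u); first by constructor 2.
case hy: (nb G (G c) u).
  by case/nbP: hy => y uy cy; constructor 3; exists y => //; rewrite adj_sym.
exfalso.
have [z hz] : exists z, deep_z G z.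
  apply: (gpick_ex (u := u)); apply/and3P; split.
  - rewrite /L2 (L1E hc) // [G u c]adj_sym cu andbT.
    by apply: contra uNc => /cpick_uniq /(_ hc uc) /eqP.
  - apply: contraFN hy => /nbP[y uy]; rewrite (L1E hc) -?(lab_adj uy) //.
    by move=> yc; apply/nbP; exists y; rewrite // adj_sym.
  - by apply/existsP; exists c; rewrite hc uc eqxx.
have uz u' : deep_z G u' -> u' = z by move=> h; apply: gpick_uniq h hz.
have := gpick_sub hz => /and3P[L2z noL1 /existsP[c1 /andP[/eqP c1z hc1]]].
move: c hc {u uc uNc cu hy} => _ _; move: c1 c1z hc1 => c cz hc.
have [r [w1 [w2 [hr s1 s2 s3]]]] := reach z.
have rz : L r = L z by rewrite (reach_comp s1) (reach_comp s2) (reach_comp s3).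
have sm v : same G (deep_z G) v = (L z == L v) := sameE v hz uz.
have [rN1 c_max] : R1 G c /\ (forall x, R1 G x -> L x = L c -> cnt G (R2 G) x <= cnt G (R2 G) c)%N.
  have hc' := cpick_sub hc; split; first exact: kargmax_sub hc'.
  by move=> x Rx xc; apply: kargmax_max hc' Rx xc.
have gcr : G c r by rewrite -R1E // rz.
have L1z v : L v = L z -> L1 G v = G v c by rewrite -cz; apply: L1E.
have zc : ~~ G z c by move: L2z; rewrite /L2 L1z // => /andP[].
have no_common y : G z y -> ~~ G y c.
  move=> zy; apply: contra noL1 => yc; apply/nbP; exists y => //.
  by rewrite L1z // (lab_adj zy).
have rzN : ~~ G z r by apply/negP => /no_common; rewrite adj_sym gcr.
have R1z v : L v = L z -> R1 G v = G v r by rewrite -rz; apply: R1E.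
have rootz v : L v = L z -> rootv G v -> v = r by move=> e h; apply: rootv_uniq h hr _; rewrite e.
have z_r : z <> r by move=> e; move: zc; rewrite e adj_sym gcr.
have [z' [hz' z'P]] : exists z', deep_z' G z' /\ (z' = z \/ G z z' /\ ~~ R2 G z).
  have [z' hz'] : exists z', deep_z' G z'.
    case R2z: (R2 G z).
      by apply: (gpick_ex (u := z)); rewrite R2z hz.
    (* Here [z] is at distance 3 from the root, so the walk to it makes no halt and its third vertex
       [w2] serves as [z']. *)
    have R2N y : G z y -> ~~ R1 G y.
      move=> zy; move: R2z; rewrite /R2 R1z // rzN /=; case rz': (rootv G z).
        by move: z_r; rewrite (rootz z).
      by move=> /= h; apply: contraFN h => hy; apply/nbP; exists y.
    have w2z : L w2 = L z := reach_comp s3.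
    have w1z : L w1 = L z by rewrite (reach_comp s2).
    have {s1}s1 : r = w1 \/ R1 G w1 by case: s1; [left | rewrite R1z // adj_sym; right].
    have R1w1 : R1 G w1.
      case: s1 => // e; subst w1; case: s2 => [e|rw2]; last first.
        case: s3 => [e|w2z']; first by move: rzN; rewrite -e adj_sym rw2.
        by have := R2N w2; rewrite adj_sym w2z' R1z // adj_sym rw2 => /(_ isT).
      subst w2; case: s3 => [/esym/z_r //|]; by rewrite adj_sym (negPf rzN).
    have w1N : ~~ G z w1 by apply/negP => /R2N; rewrite R1w1.
    have w1_z : w1 <> z by move=> e; move: R1w1; rewrite e R1z // (negPf rzN).
    have {s2}s2 : G w1 w2.
      by case: s2 => // e; subst w2; case: s3 => [/w1_z //|]; rewrite adj_sym (negPf w1N).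
    have {s3}s3 : G z w2.
      by case: s3 => [e|]; [move: w1N; rewrite adj_sym -e s2 | rewrite adj_sym].
    apply: (gpick_ex (u := w2)); apply/andP; split.
      rewrite /R2 (R2N _ s3) /=; apply/andP; split.
        by apply: contra rzN => /(rootz _ w2z) <-.
      by apply/nbP; exists w1; rewrite // adj_sym.
    apply/orP; right; rewrite (nb_uniq _ _ hz uz) adj_sym s3 /=.
    by apply/negP => /gexP[u' /andP[/uz -> ]]; rewrite R2z.
  exists z'; split=> //; have /andP[_ /orP[/uz|/andP[]]] := gpick_sub hz'; first by left.
  rewrite (nb_uniq _ _ hz uz) adj_sym => zz' noR2; right; split=> //.
  by apply: contra noR2 => R2z; apply/gexP; exists z; rewrite hz.
have z'z : L z' = L z by case: z'P => [-> //|[/lab_adj]].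
have uz' u' : deep_z' G u' -> u' = z' by move=> h; apply: gpick_uniq h hz'.
have R2z' : R2 G z' by case/andP: (gpick_sub hz').
have [z'Nr /nbP[x1 z'x1 R1x1]] : ~~ G z' r /\ nb G (R1 G) z'.
  by move: R2z'; rewrite /R2 (R1z _ z'z) => /and3P[].
have [x' hx'] : exists x', deep_x' G x'.
  apply: (gpick_ex (u := x1)).
  by rewrite R1x1 (nb_uniq _ _ hz' uz') adj_sym z'x1.
have ux' u' : deep_x' G u' -> u' = x' by move=> h; apply: gpick_uniq h hx'.
have := gpick_sub hx'; rewrite (nb_uniq _ _ hz' uz') => /andP[R1x' x'z'].
have x'z : L x' = L z by rewrite (lab_adj x'z').
have x'r : G x' r by rewrite -R1z.
have z'Nc : ~~ G z' c by case: z'P => [-> //|[]] /no_common.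
have hcc : deep_c G c.
  apply: gpickW => [|u' /andP[hu']]; rewrite sm ?hc ?cz ?eqxx // => /eqP zu'.
  by apply: cpick_uniq hu' hc _; rewrite cz.
have ucc u' : deep_c G u' -> u' = c by move=> h; apply: gpick_uniq h hcc.
have hcr : deep_r G r.
  apply: gpickW => [|u' /andP[hu']]; rewrite sm ?hr ?rz ?eqxx // => /eqP zu'.
  by apply: rootv_uniq hu' hr _; rewrite rz.
have [u hu] : exists u, deep_u G u.
  have [|||u] := @card_diff [pred y | G c y & R2 G y] [pred y | G x' y & R2 G y] z'.
  - by apply: c_max; rewrite // cz.
  - by rewrite /= x'z' R2z'.
  - by rewrite /= adj_sym (negPf z'Nc).
  move=> /= /andP[gcu R2u]; rewrite R2u andbT => x'u; apply: (gpick_ex (u := u)).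
  by rewrite R2u (nb_uniq _ _ hcc ucc) (nb_uniq _ _ hx' ux') !(adj_sym G u) gcu.
have := gpick_sub hu; rewrite (nb_uniq _ _ hcc ucc) (nb_uniq _ _ hx' ux').
move=> /and3P[R2u gu_c uNx'].
have uz_comp : L u = L z by rewrite (lab_adj gu_c).
have uNr : ~~ G u r by move: R2u; rewrite /R2 R1z // => /and3P[].
have uNz : ~~ G z u by apply: contraL gu_c => /no_common.
have sy := adj_sym G.
have T1 : ~~ G c x' -> ~~ G u z' -> False.
  move=> cx' uz1; apply/negP: (not_tuple (k := 1) z isT); rewrite negbK.
  by apply: (@isP5_complete _ _ _ _ u c r x' z') => //; (try exact: gpick_tup); rewrite sy.
case: z'P => [e|[zz' noR2z]].
  subst z'; apply: T1; last by rewrite sy.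
  by apply/negP => cx'; move: (no_common x'); rewrite sy x'z' sy cx' => /(_ isT).
have zNx' : ~~ G z x'.
  apply: contra noR2z => zx'; rewrite /R2 R1z // rzN.
  have -> /= : rootv G z = false by apply/negP => /(rootz z erefl)/z_r.
  by apply/nbP; exists x'.
case uz1: (G u z'); last first.
  case cx1: (G c x'); last by apply: T1; rewrite ?cx1 ?uz1.
  apply/negP: (not_tuple (k := 2) z isT); rewrite negbK.
  by apply: (@isP5_complete _ _ _ _ z z' x' c u) => //; (try exact: gpick_tup); rewrite sy // uz1.
apply/negP: (not_tuple (k := 3) z isT); rewrite negbK.
by apply: (@isP5_complete _ _ _ _ r c u z' z) => //; (try exact: gpick_tup); rewrite sy.
Qed.

End Center.

#[local] Opaque lab.

(** * Configurations in L1 and L2 excluded by the failed candidates *)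

Section Forbidden.
Variables (n : nat) (G : sgraph 'I_n).
Implicit Types (u v x y : 'I_n) (p t : pred 'I_n).
Hypothesis noP5 : forall v, ~~ found G (tuples G) v.
Local Notation L := (lab G 3).
Let lab_adj := lab_adj noP5.
Let nb_cpick := nb_cpick noP5.
Let L1E := L1E noP5.

Lemma centerE c v : center G c -> L v = L c -> center G v = (v == c).
Proof.
move=> hc vc; apply/idP/eqP => [h|->] //; exact: cpick_uniq h hc vc.
Qed.

Lemma L2E c v : center G c -> L v = L c -> L2 G v = (v != c) && ~~ G v c.
Proof. by move=> hc vc; rewrite /L2 (centerE hc vc) (L1E hc vc). Qed.

Lemma L2_dom c v : center G c -> L v = L c -> L2 G v -> exists2 y, G c y & G v y.
Proof.
move=> hc vc; rewrite (L2E hc vc) => /andP[/eqP vNc vcN].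
case: (center_dom noP5 hc vc) => [//|cv|[y cy yv]].
  by rewrite adj_sym cv in vcN.
by exists y; rewrite // adj_sym.
Qed.

Lemma L1_center v : L1 G v -> exists2 c, center G c & G v c.
Proof. by case/nbP => c vc hc; exists c. Qed.

Lemma iso1_adj c u v : center G c -> L u = L c -> iso1 G u -> G v c -> ~~ G u v.
Proof.
move=> hc uc /andP[_ /negP h] vc; apply/negP => uv; apply: h; apply/nbP; exists v => //.
by rewrite (L1E hc) // -uc (lab_adj uv).
Qed.

(** The path climbs from the hub to L1, passes through [c] and descends to [v]. Membership in L2
    excludes the chords at [c], and [remote] excludes the others. *)
Lemma far_none v : ~~ remote G v.
Proof.
apply/negP => /gpick_ex [{}v hv].
have uv u : remote_v G u -> u = v by move=> h; apply: gpick_uniq h hv.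
have := gpick_sub hv.
case/and5P => /existsP[c /andP[/eqP cv hc]] L2v vNq vNbq noN.
have [a' ha' a'v] := kargmax_ex L (fun v => nb G (L2 G) v : nat) L2v.
have [a ha0 aa'] := cpick_ex G ha'; have ha : hub G a := ha0.
have av : L a = L v by rewrite aa'.
have ac : L a = L c by rewrite cv.
have L2a : L2 G a := kargmax_sub (cpick_sub ha).
have same_v u : same G (remote_v G) u = (L v == L u) := sameE G u hv uv.
have hfq : remote_h G a.
  apply: gpickW => [|u /andP[hu]]; rewrite same_v ?ha ?av ?eqxx // => /eqP vu.
  by apply: cpick_uniq hu ha _; rewrite av.
have hfc : remote_c G c.
  apply: gpickW => [|u /andP[hu]]; rewrite same_v ?hc ?cv ?eqxx // => /eqP vu.
  by apply: cpick_uniq hu hc _; rewrite cv.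
have ufq u : remote_h G u -> u = a by move=> h; apply: gpick_uniq h hfq.
have sy := adj_sym G.
have [y0 cy0 ay0] := L2_dom hc ac L2a.
have [y hy] : exists y, remote_y G y.
  apply: (gpick_ex (u := y0)); rewrite (nb_uniq _ _ hfq ufq) sy ay0 andbT.
  by rewrite (L1E hc) -?(lab_adj ay0) // sy.
have [y1 cy1 vy1] := L2_dom hc (esym cv) L2v.
have [y' hy'] : exists y', remote_y' G y'.
  apply: (gpick_ex (u := y1)); rewrite (nb_uniq _ _ hv uv) sy vy1 andbT.
  by rewrite (L1E hc) -?(lab_adj vy1) // sy.
have := gpick_sub hy; rewrite (nb_uniq _ _ hfq ufq) => /andP[L1y ya].
have := gpick_sub hy'; rewrite (nb_uniq _ _ hv uv) => /andP[L1y' y'v].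
have yc : L y = L c by rewrite (lab_adj ya).
have y'c : L y' = L c by rewrite (lab_adj y'v).
move: (L1y); rewrite (L1E hc yc) => gyc.
move: (L1y'); rewrite (L1E hc y'c) => gy'c.
have qE u : L u = L c -> nb G (hub G) u = G u a by move=> uc; apply: nb_cpick ha0 _; rewrite uc ac.
have no1 u : G v u -> L1 G u -> ~~ G u a.
  move=> vu L1u; apply: contra noN => ua; apply/nbP; exists u => //.
  by rewrite L1u qE ?ua // -(lab_adj vu).
have no2 u z : G v u -> L1 G u -> G u z -> L1 G z -> ~~ G z a.
  move=> vu L1u uz L1z; apply: contra noN => za; apply/nbP; exists u => //.
  have uc : L u = L c by rewrite -(lab_adj vu).
  rewrite L1u /=; apply/orP; right; apply/nbP; exists z => //.
  by rewrite /hub_side L1z qE // -(lab_adj uz).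
have vy' : G v y' by rewrite sy.
apply/negP: (not_tuple noP5 (k := 4) v isT); rewrite negbK.
apply: (@isP5_complete _ _ _ _ a y c y' v) => //; (try exact: gpick_tup); rewrite 1?sy //.
- by move: L2a; rewrite (L2E hc ac) sy => /andP[].
- exact: no1.
- by move: vNbq; rewrite qE.
- by apply/negP => yy'; move: (no2 y' y vy' L1y' yy' L1y); rewrite ya.
- by apply/negP => yv; move: (no1 y yv L1y); rewrite ya.
- by move: L2v; rewrite (L2E hc (esym cv)) => /andP[].
Qed.

(** [v] has a neighbour among the isolated vertices of L1 that the widest vertex [m] misses; by
    maximality [m] has one that [v] misses. Joined through [c], they give an induced P5 from [m] to
    [v]. *)
Lemma apart_none v : ~~ apart G v.
Proof.
apply/negP => /gpick_ex [{}v hv].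
have uv u : apart_v G u -> u = v by move=> h; apply: gpick_uniq h hv.
have := gpick_sub hv.
case/and4P => pv vNm vNbm /nbP[a1 va1 /andP[iso_a1 a1Nm]].
have [c hc a1c] : exists2 c, center G c & G a1 c by case/andP: iso_a1 => /L1_center.
have vc : L v = L c by rewrite (lab_adj va1) (lab_adj a1c).
have [m' hm' m'v] := kargmax_ex L (cnt G (iso1 G)) pv.
have [m hm0 mm'] := cpick_ex G hm'; have hm : widest G m := hm0.
have mv : L m = L v by rewrite mm'.
have mc : L m = L c by rewrite mv.
have pm : partial G m := kargmax_sub (cpick_sub hm).
have same_v u : same G (apart_v G) u = (L v == L u) := sameE G u hv uv.
have hgm : apart_m G m.
  apply: gpickW => [|u /andP[hu]]; rewrite same_v ?hm ?mv ?eqxx // => /eqP vu.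
  by apply: cpick_uniq hu hm _; rewrite mv.
have hgc : apart_c G c.
  apply: gpickW => [|u /andP[hu]]; rewrite same_v ?hc ?vc ?eqxx // => /eqP vu.
  by apply: cpick_uniq hu hc _; rewrite -vu.
have ugm u : apart_m G u -> u = m by move=> h; apply: gpick_uniq h hgm.
have sy := adj_sym G.
have mE u : L u = L c -> nb G (widest G) u = G u m by move=> uc; apply: nb_cpick hm0 _; rewrite uc mc.
have a1L : L a1 = L c by rewrite (lab_adj a1c).
rewrite mE // in a1Nm; rewrite mE // in vNbm.
have [a' ha'] : exists a', apart_a' G a'.
  apply: (gpick_ex (u := a1)).
  by rewrite iso_a1 (nb_uniq _ _ hv uv) (nb_uniq _ _ hgm ugm) sy va1.
have := gpick_sub ha'; rewrite (nb_uniq _ _ hv uv) (nb_uniq _ _ hgm ugm).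
case/and3P => iso_a' a'v a'Nm.
have [a ha] : exists a, apart_a G a.
  have [|||u] := @card_diff _ [pred y | G m y & iso1 G y] [pred y | G v y & iso1 G y] a'.
  - by apply: (kargmax_max (cpick_sub hm)).
  - by rewrite /= sy a'v.
  - by rewrite /= sy (negPf a'Nm).
  move=> /= /andP[mu iso_u]; rewrite iso_u andbT => uv'; apply: (gpick_ex (u := u)).
  by rewrite iso_u (nb_uniq _ _ hv uv) (nb_uniq _ _ hgm ugm) sy mu sy.
have := gpick_sub ha; rewrite (nb_uniq _ _ hv uv) (nb_uniq _ _ hgm ugm).
case/and3P => iso_a am aNv.
have aL : L a = L c by rewrite (lab_adj am).
have a'L : L a' = L c by rewrite (lab_adj a'v).
have gac : G a c by move: iso_a; rewrite /iso1 (L1E hc aL) => /andP[].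
have ga'c : G a' c by move: iso_a'; rewrite /iso1 (L1E hc a'L) => /andP[].
have L2m : L2 G m by case/and3P: pm.
have L2v : L2 G v by case/and3P: pv.
have mNc : ~~ G m c by move: L2m; rewrite (L2E hc mc) => /andP[].
have vNc : ~~ G v c by move: L2v; rewrite (L2E hc vc) => /andP[].
have aNa' : ~~ G a a' := iso1_adj hc aL iso_a ga'c.
apply/negP: (not_tuple noP5 (k := 5) v isT); rewrite negbK.
by apply: (@isP5_complete _ _ _ _ m a c a' v) => //; (try exact: gpick_tup); rewrite sy.
Qed.

(** The path is [x a c b y], with [a] seen and [b] unseen by the widest vertex. Being isolated in
    L1, [a] is not adjacent to [b]; the definition of the two sides excludes the edges [x b] and
    [a y]. *)
Lemma apart'_none v : ~~ crossed G v.
Proof.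
apply/negP => /gpick_ex [x hx0].
have ux u : crossed_x G u -> u = x by move=> h; apply: gpick_uniq h hx0.
have := gpick_sub hx0; case/andP => X0x lt.
have /and3P[px /nbP[a xa haa] xNb] := X0x.
have /andP[iso_a _] := cpick_sub haa.
have [c hc gac] : exists2 c, center G c & G a c by case/andP: iso_a => /L1_center.
have aL : L a = L c := lab_adj gac.
have xL : L x = L c by rewrite (lab_adj xa).
have sy := adj_sym G.
have [y0 y0x /andP[X1y0 xNy0]] : exists2 y, L y = L x & side1 G y && ~~ G x y.
  case: (pickP (fun y => [&& L y == L x, side1 G y & ~~ G x y])) => [y /and3P[/eqP ? ? ?]|none].
    by exists y => //; apply/andP.
  move: lt; rewrite ltnNge => /negP[]; apply: subset_leq_card; apply/subsetP => u.
  rewrite !inE => /andP[ux' X1u]; rewrite X1u andbT.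
  by move: (none u); rewrite ux' X1u /= => /negbFE.
have /and3P[_ /nbP[b y0b hbb] _] := X1y0.
have /andP[iso_b _] := cpick_sub hbb.
have bL : L b = L c by rewrite -(lab_adj y0b) y0x.
have same_v u : same G (crossed_x G) u = (L x == L u) := sameE G u hx0 ux.
have hha : crossed_a G a.
  apply: gpickW => [|u /andP[hu]]; rewrite same_v ?haa ?xL ?aL ?eqxx // => /eqP vu.
  by apply: cpick_uniq hu haa _; rewrite aL.
have hhc : crossed_c G c.
  apply: gpickW => [|u /andP[hu]]; rewrite same_v ?hc ?xL ?eqxx // => /eqP vu.
  by apply: cpick_uniq hu hc _; rewrite -vu.
have hhb : crossed_b G b.
  apply: gpickW => [|u /andP[hu]]; rewrite same_v ?hbb ?xL ?bL ?eqxx // => /eqP vu.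
  by apply: cpick_uniq hu hbb _; rewrite bL.
have [y hy0] : exists y, crossed_y G y.
  apply: (gpick_ex (u := y0)); rewrite X1y0 (nb_uniq _ _ hx0 ux) same_v y0x eqxx andbT.
  by rewrite sy.
have := gpick_sub hy0; rewrite (nb_uniq _ _ hx0 ux) same_v => /and3P[X1y yNx /eqP xy].
have yL : L y = L c by rewrite -xy.
have aE u : L u = L c -> nb G (seen G) u = G u a by move=> uc; apply: nb_cpick haa _; rewrite uc aL.
have bE u : L u = L c -> nb G (unseen G) u = G u b by move=> uc; apply: nb_cpick hbb _; rewrite uc bL.
rewrite bE // in xNb.
have /and3P[py] := X1y; rewrite aE // bE // => yb yNa.
have gbc : G b c by move: iso_b; rewrite /iso1 (L1E hc bL) => /andP[].
have L2x : L2 G x by case/and3P: px.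
have L2y : L2 G y by case/and3P: py.
have xNc : ~~ G x c by move: L2x; rewrite (L2E hc xL) => /andP[].
have yNc : ~~ G y c by move: L2y; rewrite (L2E hc yL) => /andP[].
have aNb : ~~ G a b := iso1_adj hc aL iso_a gbc.
apply/negP: (not_tuple noP5 (k := 6) x isT); rewrite negbK.
by apply: (@isP5_complete _ _ _ _ x a c b y) => //; (try exact: gpick_tup); rewrite sy.
Qed.

End Forbidden.

(** * Admissibility and weight depend only on the component *)

Section Local.
Variables (R : realType) (n : nat) (G : sgraph 'I_n) (w : {set 'I_n} -> R).
Implicit Types (u v x y : 'I_n) (p t W : pred 'I_n).
Hypothesis noP5 : forall v, ~~ found G (tuples G) v.
Local Notation L := (lab G 3).
Let lab_adj := lab_adj noP5.

Lemma eq_cnt_in p p' v : (forall y, G v y -> p y = p' y) -> cnt G p v = cnt G p' v.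
Proof. by move=> e; apply: eq_card => y; rewrite !inE; case vy: (G v y); rewrite //= e. Qed.

Lemma bad_local W W' v u : (forall x, L x = L v -> W x = W' x) -> L u = L v ->
  bad G W u = bad G W' u.
Proof.
move=> e uv; rewrite /bad e //; congr (_ && _).
apply/nbP/nbP => -[y uy h]; exists y => //.
  by rewrite -(e y) -?(lab_adj uy) // (eq_cnt_in (p' := predC W)) // => x yx /=;
     rewrite e // -(lab_adj yx) -(lab_adj uy).
by rewrite (e y) -?(lab_adj uy) // (eq_cnt_in (p' := predC W')) // => x yx /=;
   rewrite e // -(lab_adj yx) -(lab_adj uy).
Qed.

Lemma goodK_local W W' v : (forall x, L x = L v -> W x = W' x) ->
  goodK G W v = goodK G W' v.
Proof.
move=> e; congr (~~ _); apply/existsP/existsP => -[u /andP[/eqP uv b]]; exists u; rewrite uv eqxx /=.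
  by rewrite -(bad_local e uv).
by rewrite (bad_local e uv).
Qed.

Lemma KW_local W W' v : (forall x, L x = L v -> W x = W' x) -> KW G w W v = KW G w W' v.
Proof.
move=> e; apply: eq_big => [u|u /andP[/eqP uv _]]; first by case: eqP => //= uv; rewrite e.
apply: eq_bigl => y; case uy: (G u y) => //=.
by rewrite e // -(lab_adj uy).
Qed.

(** All neighbours of [u] lie in its component, so equal counts mean that [u] misses no vertex of
    [p0] there. *)
Lemma exactlyP c (p p0 : pred 'I_n) u : (forall y, p0 y -> p y) -> L u = L c ->
  reflect (forall y, L y = L c -> p y -> G u y = p0 y) (exactly G p p0 u).
Proof.
move=> sub uc; apply: (iffP andP) => [[none /eqP eqc] y yc py|h].
  case uy: (G u y).
    by apply/esym; apply: contraNT none => p0y; apply/nbP; exists y; rewrite // py.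
  apply/esym/negP => p0y.
  have /proper_card : [pred y | G u y & p0 y] \proper [pred y | L y == L u & p0 y].
    apply/properP; split; last by exists y; rewrite !inE ?uy // yc uc eqxx.
    by apply/subsetP => x; rewrite !inE => /andP[/lab_adj -> ->]; rewrite eqxx.
  by rewrite -[X in (X < _)%N]/(cnt G p0 u) eqc ltnn.
split.
  apply/nbP => -[y uy /andP[py]]; rewrite -(h y) ?uy // -uc.
  by rewrite (lab_adj uy).
apply/eqP/eq_card => y; rewrite !inE; case p0y: (p0 y); rewrite ?andbF ?andbT //.
case: eqP => yu; first by rewrite h ?sub // yu.
by apply/negP => /lab_adj /esym.
Qed.

(* [KW] counts every edge twice. *)
Lemma KW_add c W (N0 : pred 'I_n) m : L m = L c ->
  (forall u, L u = L c -> ~~ W u = N0 u || (u == m)) -> ~~ N0 m ->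
  (forall y, G m y -> N0 y) ->
  KW G w W c = (kwsum L N0 (wsum G w N0) c + wdeg G w m + wdeg G w m)%R.
Proof.
move=> mc NE mN hm; rewrite /KW /kwsum (bigD1 m) /=; last by rewrite mc eqxx NE // eqxx orbT.
rewrite addrC; congr (_ + _)%R; last first.
  apply: eq_bigl => y; rewrite andbT; case my: (G m y) => //=.
  by rewrite NE ?hm // -(lab_adj my).
rewrite (eq_bigl (fun u => (L u == L c) && N0 u)); last first.
  move=> u; case: eqP => //= uc; rewrite NE //; case: (u =P m) => [->|]; last by rewrite orbF andbT.
  by rewrite (negPf mN).
(* The edges at [m], already counted from [m], are counted again from its neighbours: this gives the
   second copy of the weighted degree. *)
rewrite (eq_bigr (fun u => wsum G w N0 u + if G m u then w [set m; u] else 0)%R); last first.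
  move=> u /andP[/eqP uc N0u]; rewrite /wsum.
  case mu: (G m u); last first.
    rewrite addr0; apply: eq_bigl => y; case uy: (G u y) => //=.
    rewrite NE -?(lab_adj uy) // (_ : y == m = false) ?orbF //.
    by apply: contraFF mu => /eqP <-; rewrite adj_sym.
  rewrite (bigD1 m) /=; last by rewrite adj_sym mu NE // eqxx orbT.
  rewrite addrC [[set u; m]]setUC; congr (_ + _)%R; apply: eq_bigl => y.
  case uy: (G u y) => //=; rewrite NE -?(lab_adj uy) //.
  by case: (y =P m) => [->|]; rewrite ?(negPf mN) ?orbF ?andbT ?andbF.
rewrite big_split /=; congr (_ + _)%R.
rewrite -big_mkcondr; apply: eq_bigl => u; rewrite andbT.
by case mu: (G m u); rewrite ?andbF // hm // -(lab_adj mu) mc eqxx.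
Qed.

End Local.

(** The candidates are functions, without decidable equality; hence [List.In]. *)
Lemma In_allpairs S T A (f : S -> T -> A) s0 t0 (ss : seq S) (ts : seq T) i j :
  (i < size ss)%N -> (j < size ts)%N ->
  List.In (f (nth s0 ss i) (nth t0 ts j)) [seq f s t | s <- ss, t <- ts].
Proof.
have In_map g : (j < size ts)%N -> List.In (g (nth t0 ts j) : A) (map g ts).
  by elim: ts j => // t ts IH [|j] /=; [left | right; apply: IH].
elim: ss i => // s ss IH [|i] /= lti ltj; apply/List.in_app_iff; first by left; apply: In_map.
by right; apply: IH.
Qed.

(** * The candidates suffice in the component of one center *)

Section Component.
Variables (R : realType) (n : nat) (G : sgraph 'I_n) (w : {set 'I_n} -> R).
Implicit Types (u v x y : 'I_n) (p t W : pred 'I_n).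
Hypothesis noP5 : forall v, ~~ found G (tuples G) v.
Local Notation L := (lab G 3).
Variables (c : 'I_n).
Hypothesis hc : center G c.
Local Notation K u := (L u = L c).

Let sy := adj_sym G.
Let lab_adj := lab_adj noP5.

Lemma K_adj x y : G x y -> K x -> K y. Proof. by move=> /lab_adj ->. Qed.

Lemma K_L1 u : G u c -> K u. Proof. exact: lab_adj. Qed.

Lemma L1K u : K u -> L1 G u = G u c. Proof. exact: L1E. Qed.

Lemma L2K u : K u -> L2 G u = (u != c) && ~~ G u c. Proof. exact: L2E. Qed.

Lemma tri u : K u -> [\/ u = c, G u c | L2 G u].
Proof.
move=> uc; case: (u =P c) => [|ne]; first by constructor 1.
case ug: (G u c); first by constructor 2.
by constructor 3; rewrite L2K // ug andbT; apply/eqP.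
Qed.

Lemma L2_adj u : K u -> L2 G u -> exists y, [/\ G u y, G y c & K y].
Proof.
move=> uc /(L2_dom noP5 hc uc)[y cy uy]; exists y; split=> //; first by rewrite sy.
exact: K_adj uy uc.
Qed.

Lemma cpick_inj p a b : cpick G p a -> cpick G p b -> K a -> K b -> a = b.
Proof. by move=> pa pb ac bc; apply: cpick_uniq pa pb _; rewrite ac. Qed.

Lemma nbK p a u : cpick G p a -> K a -> K u -> nb G (cpick G p) u = G u a.
Proof. by move=> pa ac uc; apply: nb_cpick => //; rewrite ac. Qed.

Lemma cpickK p u : p u -> K u -> exists2 a, cpick G p a & K a.
Proof. by move=> pu uc; have [a pa e] := cpick_ex G pu; exists a; rewrite // e. Qed.

(** An arbitrary admissible set; its vertices are called white below. *)
Variable W : pred 'I_n.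
Hypothesis hW : forall u, ~~ bad G W u.

Lemma W_nbr u y : W u -> G u y -> ~~ W y.
Proof.
move=> Wu uy; apply: contra (hW u) => Wy; rewrite /bad Wu.
by apply/nbP; exists y; rewrite // Wy.
Qed.

Lemma W_cnt u y : W u -> G u y -> cnt G (predC W) y = 1%N.
Proof.
move=> Wu uy; apply/eqP; have := hW u; rewrite /bad Wu /=; apply: contraR => h.
by apply/nbP; exists y; rewrite // h orbT.
Qed.

Lemma W_uniq u y a b : W u -> G u y -> G y a -> ~~ W a -> G y b -> ~~ W b -> a = b.
Proof.
move=> Wu uy ya Wa yb Wb; have := W_cnt Wu uy; rewrite /cnt => e.
have /card_le1_eqP : (#|[pred x | G y x & predC W x]| <= 1)%N by rewrite e.
by apply; rewrite inE /= ?ya ?yb ?Wa ?Wb.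
Qed.

Lemma mate u y : W u -> G u y -> exists2 a, G y a & ~~ W a.
Proof.
move=> Wu uy; have : (0 < cnt G (predC W) y)%N by rewrite (W_cnt Wu uy).
by case/card_gt0P => a; rewrite inE => /andP[ya Wa]; exists a.
Qed.

Definition solved := exists W', [/\ List.In W' (whites G w), goodK G W' c &
  (KW G w W' c <= KW G w W c)%R].

Lemma goodW : goodK G W c.
Proof. by apply/existsP => -[u /andP[_]]; rewrite (negPf (hW u)). Qed.

Lemma solved_eq W' : List.In W' (whites G w) -> (forall u, K u -> W u = W' u) -> solved.
Proof.
move=> inW e; exists W'; split=> //; first by rewrite -(goodK_local noP5 e) goodW.
by rewrite (KW_local w noP5 e).
Qed.

Definition paint_at (b : pattern) (a u : 'I_n) : bool :=
  ~~ (cut b && (u == a)) &&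
  [|| (u == c) && wc b, G u c && w1 b | L2 G u && (if G u a then w2n b else w2f b)].

Lemma paintE b p a u : cpick G p a -> K a -> K u -> paint G b (cpick G p) u = paint_at b a u.
Proof.
move=> pa ac uc; rewrite /paint /paint_at (nbK pa ac uc) (L1K uc) (centerE hc uc).
congr (~~ (_ && _) && _); apply/idP/eqP => [h|-> //]; exact: cpick_inj h pa uc ac.
Qed.

Definition pat i := nth (Pattern false false false false false) patterns i.

Lemma paint_in i j : (i < 8)%N -> (j < 11)%N ->
  List.In (paint G (pat i) (nth xpred0 (pivots G w) j)) (whites G w).
Proof.
by move=> i8 j11; apply: (@In_allpairs _ _ _ (paint G) _ xpred0 patterns (pivots G w)).
Qed.

Lemma paint_atP b a :
  W c = ~~ (cut b && (c == a)) && wc b ->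
  (forall u, G u c -> W u = ~~ (cut b && (u == a)) && w1 b) ->
  (forall u, K u -> L2 G u -> W u = ~~ (cut b && (u == a)) && (if G u a then w2n b else w2f b)) ->
  forall u, K u -> W u = paint_at b a u.
Proof.
move=> h0 h1 h2 u uc; rewrite /paint_at L2K //.
have irr := adj_irr G.
case: (tri uc) => [->|ug|L2u]; first by rewrite h0 eqxx irr /= ?orbF.
  have -> : (u == c) = false by apply: contraTF ug => /eqP ->; rewrite irr.
  by rewrite h1 // ug andbF /= orbF.
rewrite h2 //; move: L2u; rewrite L2K // => /andP[/negPf -> /negPf ->] /=.
by [].
Qed.

Lemma solved_paint i j p a : (i < 8)%N -> (j < 11)%N ->
  nth xpred0 (pivots G w) j = cpick G p -> cpick G p a -> K a ->
  W c = ~~ (cut (pat i) && (c == a)) && wc (pat i) ->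
  (forall u, G u c -> W u = ~~ (cut (pat i) && (u == a)) && w1 (pat i)) ->
  (forall u, K u -> L2 G u -> W u = ~~ (cut (pat i) && (u == a)) &&
                              (if G u a then w2n (pat i) else w2f (pat i))) ->
  solved.
Proof.
move=> i8 j11 pE pa ac h0 h1 h2; apply: (solved_eq (paint_in i8 j11)) => u uc.
by rewrite pE (paintE _ pa ac uc); apply: paint_atP.
Qed.

(** Such a pattern treats all of L2 alike, so every pivot, even one that denotes no vertex, produces
    the same set; the index 0 is arbitrary. *)
Lemma solved_uncut i : (i < 8)%N -> cut (pat i) = false -> w2n (pat i) = w2f (pat i) ->
  W c = wc (pat i) -> (forall u, G u c -> W u = w1 (pat i)) ->
  (forall u, K u -> L2 G u -> W u = w2f (pat i)) -> solved.
Proof.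
move=> i8 ec e2 h0 h1 h2; apply: (solved_eq (paint_in (j := 0) i8 isT)) => u uc.
have irr := adj_irr G.
rewrite /paint ec e2 if_same (centerE hc uc) (L1K uc) L2K //=.
case: (tri uc) => [->|ug|L2u]; first by rewrite h0 eqxx irr /= ?orbF.
  have -> : (u == c) = false by apply: contraTF ug => /eqP ->; rewrite irr.
  by rewrite h1 // ug andbF /= orbF.
rewrite h2 //; move: L2u; rewrite L2K // => /andP[/negPf -> /negPf ->] /=.
by [].
Qed.

Lemma iso1E u : K u -> iso1 G u = G u c && ~~ nb G (L1 G) u.
Proof. by move=> uc; rewrite /iso1 (L1K uc). Qed.

Lemma q_ex u : K u -> L2 G u -> exists a, [/\ hub G a, K a, L2 G a &
  forall x, K x -> L2 G x -> nb G (L2 G) x -> nb G (L2 G) a].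
Proof.
move=> uc L2u; have [a' ha' e'] := kargmax_ex L (fun v => nb G (L2 G) v : nat) L2u.
have [a ha e] := cpick_ex G ha'; exists a.
have ac : K a by rewrite e e'.
split=> //; first exact: kargmax_sub (cpick_sub ha).
move=> x xc L2x hx; have := kargmax_max (cpick_sub ha) L2x; rewrite xc ac => /(_ erefl).
by rewrite hx lt0b.
Qed.

Lemma not_far v a : hub G a -> K a -> K v -> L2 G v -> v <> a -> ~~ G v a ->
  (forall y, G v y -> G y c -> ~~ G y a /\ forall z, G y z -> G z c -> ~~ G z a) -> False.
Proof.
move=> qa ac vc L2v va vNa h; have /negP := far_none noP5 v; apply.
have nbq u : K u -> nb G (hub G) u = G u a by move=> uc; apply: (nbK qa).
apply/and5P; split=> //.
- by apply/existsP; exists c; rewrite hc vc eqxx.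
- by apply/negP => qv; apply: va; apply: cpick_inj qv qa vc ac.
- by rewrite nbq.
apply/nbP => -[y vy /andP[]]; have yc := K_adj vy vc; rewrite (L1K yc) => gyc.
have [yNa zN] := h y vy gyc; rewrite nbq // (negPf yNa) /= => /nbP[z yz /andP[]].
have zc := K_adj yz yc; rewrite (L1K zc) nbq // => gzc.
by rewrite (negPf (zN z yz gzc)).
Qed.

(** The nonwhite vertices are [N0] and [m] for [W], [N0] and [a] for the candidate. As all
    neighbours of [m] and of [a] lie in [N0], the kept weights differ only by the weighted degrees
    of [m] and [a]. The last hypothesis is the admissibility of the candidate. *)
Lemma solved_twin i j p a (N0 : pred 'I_n) m : (i < 8)%N -> (j < 11)%N ->
  nth xpred0 (pivots G w) j = cpick G p -> cpick G p a -> K a -> K m ->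
  (forall u, K u -> ~~ W u = N0 u || (u == m)) ->
  (forall u, K u -> ~~ paint_at (pat i) a u = N0 u || (u == a)) ->
  ~~ N0 m -> ~~ N0 a -> (forall y, G m y -> N0 y) -> (forall y, G a y -> N0 y) ->
  (wdeg G w a <= wdeg G w m)%R ->
  (forall u y, K u -> paint_at (pat i) a u -> G u y ->
     ~~ paint_at (pat i) a y /\ cnt G (predC (paint_at (pat i) a)) y = 1%N) ->
  solved.
Proof.
move=> i8 j11 pE pa ac mc NW NW' mN aN hm ha le good.
have eW' u : K u -> paint G (pat i) (nth xpred0 (pivots G w) j) u = paint_at (pat i) a u.
  by move=> uc; rewrite pE (paintE _ pa ac uc).
exists (paint G (pat i) (nth xpred0 (pivots G w) j)); split; first exact: paint_in.
  rewrite (goodK_local noP5 eW'); apply/existsP => -[u /andP[/eqP uc /andP[Wu /nbP[y uy]]]].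
  by have [/negPf -> ->] := good u y uc Wu uy.
rewrite (KW_local w noP5 eW') (KW_add w noP5 mc NW mN hm) (KW_add w noP5 ac NW' aN ha).
by rewrite !lerD.
Qed.

(** * The center is in [W] *)

Section CenterWhite.
Hypothesis Wc : W c.

Let WL1 y : G y c -> ~~ W y.
Proof. by move=> yc; apply: (W_nbr Wc); rewrite sy. Qed.

Let uniqL1 y a b : G y c -> G y a -> ~~ W a -> G y b -> ~~ W b -> a = b.
Proof. by move=> yc; apply: (W_uniq Wc); rewrite sy. Qed.

Let L2N u : K u -> L2 G u -> u <> c /\ ~~ G u c.
Proof. by move=> uc; rewrite L2K // => /andP[/eqP]. Qed.

(** A neighbour of [y] in L1 would be nonwhite, like [m], whereas [y] has a single nonwhite
    neighbour because it is adjacent to the white center. *)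
Let inner y m : G y c -> K m -> L2 G m -> ~~ W m -> G y m -> iso1 G y.
Proof.
move=> yc mc L2m Wm ym; rewrite iso1E ?K_L1 // yc; apply/nbP => -[x yx].
rewrite (L1K (K_adj yx (K_L1 yc))) => xc.
have e : x = m := uniqL1 yc yx (WL1 xc) ym Wm.
by have [_ /negP] := L2N mc L2m; rewrite -e.
Qed.

Let iso_mate y : K y -> iso1 G y -> exists m, [/\ G y m, K m, L2 G m & ~~ W m].
Proof.
move=> Ky; rewrite iso1E // => /andP[yc /nbP noL1].
have [m ym Wm] := mate Wc (etrans (sy _ _) yc); have Km := K_adj ym Ky.
exists m; split=> //; case: (tri Km) => [e|mc|//]; first by rewrite e Wc in Wm.
by case: noL1; exists m; rewrite // L1K.
Qed.

(* The next three lemmas distinguish the number of vertices of L2 outside [W]. *)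
Lemma solved_white0 : (forall u, K u -> L2 G u -> W u) -> solved.
Proof.
move=> h; apply: (@solved_uncut 6) => // u uc.
by apply/negbTE/WL1.
Qed.

(** If L2 has an edge, the adjacent vertices [hub] and [hub'] are not both white, so one of them is
    [m]. Otherwise the neighbours of [m] are exactly the isolated vertices of L1, and the lightest
    vertex of L2 with this neighbourhood can replace [m]. *)
Lemma solved_white1 m : K m -> L2 G m -> ~~ W m ->
  (forall u, K u -> L2 G u -> ~~ W u -> u = m) -> solved.
Proof.
move=> Km L2m Wm only.
have cNa a : L2 G a -> K a -> (c == a) = false.
  by move=> L2a ac; apply/negbTE/eqP => e; case: (L2N ac L2a); rewrite e.
have WL2 u : K u -> L2 G u -> W u = (u != m).
  move=> Ku L2u; have [->|um] := eqVneq u m; first exact/negbTE.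
  by apply: contraNT um => nW; apply/eqP; apply: only.
have by_edge j p : (j < 11)%N -> nth xpred0 (pivots G w) j = cpick G p -> cpick G p m -> solved.
  move=> j11 pE pm; apply: (solved_paint (i := 2) (a := m) _ j11 pE pm) => //=.
  - by rewrite cNa // Wc.
  - by move=> u uc; rewrite andbF; apply/negbTE/WL1.
  - by move=> u Ku L2u; rewrite WL2 // if_same andbT.
case: (pickP (fun u => [&& L u == L c, L2 G u & nb G (L2 G) u])) => [u /and3P[/eqP Ku L2u nbu]|none].
  have [a [qa Ka L2a /(_ u Ku L2u nbu) /nbP[x ax L2x]]] := q_ex Ku L2u.
  have [b qb Kb] : exists2 b, hub' G b & K b.
    apply: (cpickK (u := x)); last exact: K_adj ax Ka.
    by rewrite L2x (nbK qa) 1?sy //; apply: K_adj ax Ka.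
  have /andP[L2b] := cpick_sub qb; rewrite (nbK qa) // => ba.
  case: (a =P m) => [e|am]; first by apply: (by_edge 0%N) => //; rewrite -e; exact: qa.
  case: (b =P m) => [e|bm]; first by apply: (by_edge 1%N) => //; rewrite -e; exact: qb.
  have Wa : W a by rewrite WL2 //; apply/eqP.
  have Wb : W b by rewrite WL2 //; apply/eqP.
  by move: (W_nbr Wb ba); rewrite Wa.
have L2indep u y : K u -> L2 G u -> G u y -> G y c.
  move=> Ku L2u uy; case: (tri (K_adj uy Ku)) => // [e|L2y].
    by case: (L2N Ku L2u); rewrite -e uy.
  by have := none u; rewrite Ku eqxx L2u /=; case/nbP; exists y.
have isoE y : K y -> L1 G y -> G m y = iso1 G y.
  move=> Ky; rewrite L1K // => yc; apply/idP/idP => [my|iso_y].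
    by apply: (inner yc Km L2m Wm); rewrite sy.
  by have [x [yx Kx L2x Wx]] := iso_mate Ky iso_y; rewrite sy -(only x).
have sub y : iso1 G y -> L1 G y by case/andP.
have hm : L2 G m && exactly G (L1 G) (iso1 G) m.
  by rewrite L2m; apply/(exactlyP noP5 sub Km).
have [a' ha' e'] := kargmin_ex (p := fun u => L2 G u && exactly G (L1 G) (iso1 G) u) L (wdeg G w) hm.
have [a ha e] := cpick_ex G ha'.
have Ka : K a by rewrite e e'.
have /andP[/andP[L2a /(exactlyP noP5 sub Ka) isoEa] /forallP/(_ m)] := cpick_sub ha.
rewrite hm Km Ka eqxx /= => le.
have nonwhite u : K u -> ~~ paint_at (pat 2) a u = G u c || (u == a).
  move=> Ku; rewrite /paint_at /= !andbT andbF if_same andbT L2K // negb_and negbK.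
  have [->|ua] := eqVneq u a; first by rewrite orbT.
  rewrite orbF /= !negb_or negb_and !negbK.
  have [->|uc] := eqVneq u c; first by rewrite adj_irr.
  by rewrite /=.
apply: (@solved_twin 2 9 _ a (fun u => G u c) m _ _ erefl ha Ka Km) => //.
- move=> u Ku; case: (tri Ku) => [->|uc|L2u].
  + by rewrite Wc adj_irr cNa.
  + by rewrite uc WL1.
  + by rewrite WL2 // negbK; case: (L2N Ku L2u) => _ /negPf ->.
- by case: (L2N Km L2m).
- by case: (L2N Ka L2a).
- by move=> y; apply: L2indep.
- by move=> y; apply: L2indep.
move=> u y Ku; rewrite -[paint_at _ _ u]negbK nonwhite // negb_or => /andP[ucN ua] uy.
have Ky := K_adj uy Ku.
have yc : G y c.
  case: (tri Ku) => [e1|uc|L2u]; [by rewrite sy -e1 | by rewrite uc in ucN | exact: L2indep uy].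
rewrite nonwhite // yc; split=> //.
rewrite -[RHS](W_cnt Wc (etrans (sy _ _) yc)).
(* An isolated vertex of L1 sees [a] in place of [m], the other vertices of L1 see neither: the
   numbers of nonwhite neighbours are those for [W]. *)
have [iso_y|niso_y] := boolP (iso1 G y).
  have one p x : G y x -> p x -> (forall z, G y z -> p z -> z = x) -> cnt G p y = 1%N.
    move=> yx px un; apply: (@eq_card1 _ x) => z; rewrite !inE; apply/andP/eqP => [[yz pz]|-> //].
    exact: un.
  have ya : G y a by rewrite sy isoEa // L1K.
  have ym : G y m by rewrite sy isoE // L1K.
  have noL1 z : G y z -> ~~ G z c.
    move=> yz; have /andP[_ /nbP h] := iso_y; apply/negP => zc; apply: h; exists z => //.
    by rewrite L1K // (K_adj yz).
  rewrite (one _ a) //.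
  - rewrite (one _ m) // => z yz Wz; have Kz := K_adj yz Ky.
    apply: only => //; case: (tri Kz) => // [e1|]; first by rewrite /= e1 Wc in Wz.
    by rewrite (negPf (noL1 z yz)).
  - by rewrite /= nonwhite // eqxx orbT.
  - by move=> z yz /=; rewrite nonwhite ?(K_adj yz) // (negPf (noL1 z yz)) => /eqP.
apply: eq_cnt_in => z yz; have Kz := K_adj yz Ky; rewrite /= nonwhite //.
case: (tri Kz) => [->|zc|L2z].
- by rewrite Wc adj_irr (cNa a).
- by rewrite zc WL1.
rewrite WL2 // negbK; case: (L2N Kz L2z) => _ /negPf -> /=.
have notadj x : (forall y, K y -> L1 G y -> G x y = iso1 G y) -> (z == x) = false.
  by move=> h; apply: contraNF niso_y => /eqP e1; rewrite -h ?L1K // sy -e1.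
by rewrite !notadj.
Qed.

(** All nonwhite vertices of L2 are [partial]. The widest vertex [a] is nonwhite, and by
    [apart_none] every other nonwhite vertex of L2 is adjacent to it. Having nonwhite neighbours
    both in L1 and in L2, it has no white one; so [a] determines [W]. *)
Lemma solved_white2 m m' : K m -> L2 G m -> ~~ W m -> K m' -> L2 G m' -> ~~ W m' -> m <> m' ->
  solved.
Proof.
move=> Km L2m Wm Km' L2m' Wm' mm'.
have L1_of x : K x -> L2 G x -> ~~ W x -> exists y, [/\ G x y, G y c, K y & iso1 G y].
  move=> Kx L2x Wx; have [y [xy yc Ky]] := L2_adj Kx L2x.
  by exists y; split=> //; apply: (inner yc Kx L2x Wx); rewrite sy.
have partM x : K x -> L2 G x -> ~~ W x -> partial G x.
  move=> Kx L2x Wx; apply/and3P; split=> //.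
    apply/nbP => -[y xy /andP[]]; rewrite L1K ?(K_adj xy) // => yc /negP; apply.
    by apply: (inner yc Kx L2x Wx); rewrite sy.
  have [x' [Kx' L2x' Wx' xx']] : exists x', [/\ K x', L2 G x', ~~ W x' & x <> x'].
    by case: (x =P m) => [->|xm]; [exists m' | exists m].
  have [y [x'y yc Ky iy]] := L1_of x' Kx' L2x' Wx'.
  apply/proper_card/properP; split.
    by apply/subsetP => z; rewrite !inE => /andP[/lab_adj -> ->]; rewrite eqxx.
  exists y; rewrite !inE ?Ky ?Kx ?eqxx // iy andbT; apply/negP => xy.
  by apply: xx'; apply: (uniqL1 yc _ Wx _ Wx'); rewrite sy.
have [a' ha' e'] := kargmax_ex L (cnt G (iso1 G)) (partM m Km L2m Wm).
have [a ha0 e] := cpick_ex G ha'; have ha : widest G a := ha0.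
have Ka : K a by rewrite e e'.
have pa : partial G a := kargmax_sub (cpick_sub ha).
have msE u : K u -> nb G (widest G) u = G u a := nbK ha0 Ka.
have iso1a y : G y a -> G y c -> iso1 G y.
  move=> ya yc; case/and3P: pa => _ /negP h _; apply/negPn/negP => niso; apply: h.
  by apply/nbP; exists y; rewrite 1?sy // L1K ?K_L1 // yc.
have L2a : L2 G a by case/and3P: pa.
have near x : K x -> L2 G x -> ~~ W x -> x <> a ->
    (exists2 y, G x y & iso1 G y && ~~ G y a) -> G x a.
  move=> Kx L2x Wx xa [y xy /andP[iy yNa]].
  apply/negPn/negP => xNa; have /negP := apart_none noP5 x; apply; apply/and4P; split.
  - exact: partM.
  - by apply/negP => msx; apply: xa; apply: cpick_inj msx ha0 Kx Ka.
  - by rewrite msE.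
  - by apply/nbP; exists y; rewrite // iy msE // (K_adj xy).
(* Were [a] white, take an isolated [b] of L1 missed by [a] and its nonwhite neighbour [x'] in L2.
   Then [x'] is adjacent to [a], so [b] is its only nonwhite neighbour. The nonwhite neighbour [x]
   in L2 of a vertex [d] seen by [a] is thus not adjacent to [x'], and [x] is [crossed]. *)
have [Wa|Wa] := boolP (W a).
  have [b1 /andP[/andP[/eqP Kb1 ib1] b1Na]] :
      exists b, ((L b == L a) && iso1 G b) && ~~ G b a.
    case/and3P: pa => _ _; case: (pickP (fun b => ((L b == L a) && iso1 G b) && ~~ G b a)).
      by move=> b hb; exists b.
    move=> none; rewrite ltnNge => /negP[]; apply: subset_leq_card; apply/subsetP => b.
    rewrite !inE => /andP[ba ib]; rewrite ib andbT.
    by move: (none b); rewrite ba ib /= sy => /negbFE.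
  rewrite Ka in Kb1.
  have [b hb Kb] : exists2 b, unseen G b & K b.
    by apply: (cpickK (u := b1)) => //; rewrite ib1 msE.
  have /andP[ib] := cpick_sub hb; rewrite msE // => bNa.
  have bc : G b c by move: ib; rewrite iso1E // => /andP[].
  have [x' [bx' Kx' L2x' Wx']] := iso_mate Kb ib.
  have x'a : G x' a.
    apply: near => //; first by move=> e1; rewrite e1 Wa in Wx'.
    by exists b; [rewrite sy | rewrite ib].
  have uniq_x' y : G x' y -> ~~ W y -> y = b.
    move=> x'y Wy; apply: (W_uniq (u := a) (y := x') Wa) => //; first by rewrite sy.
      by rewrite sy.
    exact: WL1.
  have [d1 [ad1 d1c Kd1]] := L2_adj Ka L2a.
  have [d hd Kd] : exists2 d, seen G d & K d.
    by apply: (cpickK (u := d1)) => //; rewrite msE // sy ad1 iso1a // sy.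
  have /andP[id] := cpick_sub hd; rewrite msE // => da.
  have dc : G d c by move: id; rewrite iso1E // => /andP[].
  have [x [dx Kx L2x Wx]] := iso_mate Kd id.
  have x'Nd : ~~ G x' d.
    by apply/negP => /uniq_x'/(_ (WL1 dc)) e1; rewrite -e1 da in bNa.
  have xNx' : ~~ G x x'.
    apply/negP => xx'; have e1 : x = b by apply: uniq_x' => //; rewrite sy.
    by have [_ /negP] := L2N Kx L2x; rewrite e1 bc.
  have x_x' : x <> x' by move=> e1; rewrite -e1 sy dx in x'Nd.
  have xNb : ~~ G x b.
    by apply/negP => xb; apply: x_x'; apply: (uniqL1 bc _ Wx bx' Wx'); rewrite sy.
  have a0E u : K u -> nb G (seen G) u = G u d := nbK hd Kd.
  have a1E u : K u -> nb G (unseen G) u = G u b := nbK hb Kb.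
  have X1x' : side1 G x' by rewrite /side1 partM // a1E // a0E // sy bx'.
  have /negP := apart'_none noP5 x; case; apply/andP; split.
    by rewrite /side0 partM // a1E // a0E // sy dx.
  apply/proper_card/properP; split.
    by apply/subsetP => z; rewrite !inE => /andP[/lab_adj -> ->]; rewrite eqxx.
  by exists x'; rewrite !inE ?Kx ?Kx' ?eqxx // (negPf xNx').
have [x2 [Kx2 L2x2 Wx2 x2a]] : exists x, [/\ K x, L2 G x, ~~ W x & x <> a].
  by case: (m =P a) => [e1|ma]; [exists m'; split=> // e2; apply: mm'; rewrite e1 e2 | exists m].
have adj x : K x -> L2 G x -> ~~ W x -> x <> a -> G x a.
  move=> Kx L2x Wx xa; apply: near => //.
  have [y [xy yc Ky iy]] := L1_of x Kx L2x Wx; exists y; rewrite // iy.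
  by apply/negP => ya; apply: xa; apply: (uniqL1 yc _ Wx ya Wa); rewrite sy.
have [y [ay yc Ky]] := L2_adj Ka L2a.
apply: (solved_paint (i := 3) (j := 10) (a := a) isT isT erefl ha0 Ka) => /=.
- by have [/eqP] := L2N Ka L2a; rewrite eq_sym => /negPf -> _; rewrite Wc.
- by move=> u uc; rewrite andbF; apply/negbTE/WL1.
move=> u Ku L2u; have [->|/eqP ua] := eqVneq u a; first exact/negbTE.
case ua1: (G u a) => /=; last by apply: contraFT ua1 => Wu; apply: adj.
apply/negP => Wu; have e1 : y = x2.
  by apply: (W_uniq Wu ua1 ay (WL1 yc) _ Wx2); rewrite sy; apply: adj.
by have [_ /negP] := L2N Kx2 L2x2; rewrite -e1.
Qed.

Lemma solved_white : solved.
Proof.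
case: (pickP (fun m => [&& L m == L c, L2 G m & ~~ W m])) => [m /and3P[/eqP Km L2m Wm]|none].
  case: (pickP (fun x => [&& L x == L c, L2 G x, ~~ W x & m != x])).
    by move=> x /and4P[/eqP Kx L2x Wx /eqP mx]; apply: (solved_white2 Km L2m Wm Kx).
  move=> none; apply: (solved_white1 Km L2m Wm) => u Ku L2u Wu.
  by apply/esym/eqP; move: (none u); rewrite Ku eqxx L2u Wu /= => /negbFE.
apply: solved_white0 => u Ku L2u; move: (none u).
by rewrite Ku eqxx L2u /= => /negbFE.
Qed.

End CenterWhite.

(** * The center is outside [W] *)

Section CenterNonwhite.
Hypothesis Wc : ~~ W c.

Let irr := adj_irr G.

Let L2N u : K u -> L2 G u -> u <> c /\ ~~ G u c.
Proof. by move=> uc; rewrite L2K // => /andP[/eqP]. Qed.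

(** * The center has a neighbour in [W] *)

Section WhiteNeighbour.
Variables y0 d : 'I_n.
Hypotheses (Wy0 : W y0) (y0c : G y0 c) (dc : G d c) (Wd : ~~ W d).

Let Kd : K d := K_L1 dc.

Let c_d : (c == d) = false.
Proof. by apply: contraTF dc => /eqP <-; rewrite irr. Qed.

(** The white neighbour [y0] leaves the center a single nonwhite neighbour, [d]. *)
Let WL1 u : G u c -> W u = (u != d).
Proof.
move=> uc; have [->|ud] := eqVneq u d; first exact/negbTE.
by apply: contraNT ud => Wu; apply/eqP; apply: (W_uniq Wy0 y0c); rewrite // sy.
Qed.

(** The neighbours of [u] in L1 differ from [d], hence are white. *)
Let far_nonwhite u : K u -> L2 G u -> ~~ G u d -> exists y, [/\ G u y, G y c, W y & ~~ W u].
Proof.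
move=> Ku L2u ud; have [y [uy yc Ky]] := L2_adj Ku L2u.
have Wy : W y by rewrite WL1 //; apply: contraNneq ud => <-.
by exists y; split=> //; apply: (W_nbr Wy); rewrite sy.
Qed.

(** Once [d] is a pivot, [W] is determined: if [d] has a white neighbour, [c] is its only nonwhite
    one and all its neighbours in L2 are white; otherwise no vertex of L2 is white. *)
Lemma solved_pivot j p : (j < 11)%N -> nth xpred0 (pivots G w) j = cpick G p -> cpick G p d ->
  solved.
Proof.
move=> j11 pE pd; have [/nbP[x dx Wx]|noW] := boolP (nb G W d).
  apply: (solved_paint (i := 0) (a := d) isT j11 pE pd Kd) => /=.
  - by rewrite c_d; apply/negbTE.
  - by move=> u uc; rewrite andbT WL1.
  move=> u Ku L2u; case ud: (G u d); last first.
    by rewrite andbF; have [|y [_ _ _ /negbTE]] := far_nonwhite Ku L2u; rewrite ?ud.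
  have -> : (u == d) = false by apply: contraTF ud => /eqP ->; rewrite irr.
  apply/negPn/negP => Wu; have [uc _] := L2N Ku L2u; apply: uc.
  by apply: (W_uniq Wx _ _ Wu dc Wc); rewrite sy // sy.
apply: (solved_paint (i := 1) (a := d) isT j11 pE pd Kd) => /=.
- by rewrite c_d; apply/negbTE.
- by move=> u uc; rewrite andbT WL1.
move=> u Ku L2u; rewrite if_same andbF; case ud: (G u d).
  by apply: contraNF noW => Wu; apply/nbP; exists u; rewrite // sy.
by have [|y [_ _ _ /negbTE]] := far_nonwhite Ku L2u; rewrite ?ud.
Qed.

(** The adjacent vertices [rung] and [rung'] of L1 are not both white, so one of them is [d]. *)
Lemma solved_L1_edge u y : G u c -> G y c -> G u y -> solved.
Proof.
move=> uc yc uy.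
have [a ha Ka] : exists2 a, rung G a & K a.
  by apply: (cpickK (u := u)); rewrite ?K_L1 // L1K ?K_L1 // uc; apply/nbP; exists y; rewrite ?L1K ?K_L1.
have /andP[] := cpick_sub ha; rewrite L1K // => ac /nbP[x ax].
rewrite L1K ?(K_adj ax) // => xc.
have enE z : K z -> nb G (rung G) z = G z a := nbK ha Ka.
have [b hb Kb] : exists2 b, rung' G b & K b.
  by apply: (cpickK (u := x)); rewrite ?K_L1 // L1K ?K_L1 // xc enE ?K_L1 // sy.
have /andP[] := cpick_sub hb; rewrite L1K // enE // => bc ba.
case: (a =P d) => [e|ad]; first by apply: (@solved_pivot 6) => //; rewrite -e; exact: ha.
case: (b =P d) => [e|bd]; first by apply: (@solved_pivot 7) => //; rewrite -e; exact: hb.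
have Wa : W a by rewrite WL1 //; apply/eqP.
by have := W_nbr Wa (etrans (sy _ _) ba); rewrite WL1 //; move/eqP: bd => ->.
Qed.

Hypothesis indep : forall u y, G u c -> G y c -> ~~ G u y.

Let private s := forall y, G s y -> G y c -> y = d.

Lemma solved_up j p s : (j < 11)%N -> nth xpred0 (pivots G w) j = upper G (cpick G p) ->
  cpick G p s -> K s -> G s d -> private s -> solved.
Proof.
move=> j11 pE ps Ks sd priv; apply: (solved_pivot j11 pE).
have tE u : K u -> nb G (cpick G p) u = G u s := nbK ps Ks.
have [x hx Kx] : exists2 x, upper G (cpick G p) x & K x.
  by apply: (cpickK (u := d)); rewrite ?L1K ?dc ?tE // sy.
have /andP[] := cpick_sub hx; rewrite L1K // tE // => xc xs.
have e : x = d by apply: priv; rewrite // sy.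
by rewrite -e; exact: hx.
Qed.

(** The only neighbour of [s] in L1 is [d], which sees neither the hub nor L1; without an edge to
    the hub, [s] would be [remote]. *)
Let not_far_private s a : hub G a -> K a -> ~~ G a d -> K s -> L2 G s -> G s d -> private s -> G s a.
Proof.
move=> qa Ka ad Ks L2s sd priv; apply/negPn/negP => sa.
apply: (not_far qa Ka Ks L2s _ sa) => [e|y sy' yc]; first by rewrite -e sd in ad.
have -> := priv y sy' yc; split; first by rewrite sy.
by move=> z dz zc; have := indep dc zc; rewrite dz.
Qed.

(** The neighbours of [d] in L2 are white, so [d] is their only neighbour in L1, and it suffices
    that one of them be [hub], [hub'] or [hub'']. If the hub misses [d], they are all adjacent to
    it. The hub then has a white neighbour in L1, hence at most one nonwhite neighbour, so [hub'] or
    [hub''] is white, and a white vertex of L2 is adjacent to [d]. *)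
Lemma solved_d_yellow x : G d x -> W x -> solved.
Proof.
move=> dx Wx.
have Kx : K x := K_adj dx Kd.
have L2x : L2 G x.
  case: (tri Kx) => // [e|xc]; first by rewrite e (negPf Wc) in Wx.
  by have := indep dc xc; rewrite dx.
have Wnbr s : K s -> L2 G s -> G s d -> W s.
  move=> Ks L2s sd; apply/negPn/negP => Ws; have [sc _] := L2N Ks L2s; apply: sc.
  by apply: (W_uniq Wx _ _ Ws dc Wc); rewrite sy // sy.
have priv s : K s -> L2 G s -> G s d -> private s.
  move=> Ks L2s sd y s_y yc; have := W_nbr (Wnbr s Ks L2s sd) s_y.
  by rewrite WL1 // negbK => /eqP.
have xd : G x d by rewrite sy.
have [a [qa Ka L2a _]] := q_ex Kx L2x.
case ad: (G a d); first exact: (solved_up (j := 3) isT erefl qa Ka ad (priv a Ka L2a ad)).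
have [y [ay yc Wy Wa]] := far_nonwhite Ka L2a (negbT ad).
have near s : K s -> L2 G s -> G s d -> G s a.
  by move=> Ks L2s sd; apply: (not_far_private qa) => //; [rewrite ad | apply: priv].
have qE u : K u -> nb G (hub G) u = G u a := nbK qa Ka.
have [b hb Kb] : exists2 b, hub' G b & K b.
  by apply: (cpickK (u := x)) => //; rewrite L2x qE // near.
have /andP[L2b] := cpick_sub hb; rewrite qE // => ba.
case bd: (G b d); first exact: (solved_up (j := 4) isT erefl hb Kb bd (priv b Kb L2b bd)).
have [_ [_ _ _ Wb]] := far_nonwhite Kb L2b (negbT bd).
have [t ht Kt] : exists2 t, hub'' G t & K t.
  apply: (cpickK (u := x)) => //; rewrite L2x qE // near //=.
  by apply/negP => hx; have e := cpick_inj hx hb Kx Kb; rewrite -e xd in bd.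
have /and3P[L2t] := cpick_sub ht; rewrite qE // => ta tNq'.
have Wt : W t.
  apply/negPn/negP => Wt; have e : t = b.
    by apply: (W_uniq (y := a) Wy _ _ Wt _ Wb); rewrite sy.
  by rewrite e hb in tNq'.
have td : G t d.
  apply/negPn/negP => tNd; have [_ [_ _ _]] := far_nonwhite Kt L2t tNd; by rewrite Wt.
exact: (solved_up (j := 5) isT erefl ht Kt td (priv t Kt L2t td)).
Qed.

(** Now L2 has no white vertex. Suppose a neighbour [s] of [d] in L2 has a neighbour in L2. Then
    [hub] or [hub'] is adjacent to [d]: otherwise the hub would have a white neighbour in L1 and the
    two nonwhite neighbours [s] and [hub']. The vertex found has [d] as its only neighbour in L1. If
    there is no such [s], the neighbours of [d] in L2 are exactly the isolated vertices of L2, and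
    the lightest twin replaces [d]. *)
Lemma solved_d_black : (forall x, G d x -> ~~ W x) -> solved.
Proof.
move=> noW.
have WL2 u : K u -> L2 G u -> ~~ W u.
  move=> Ku L2u; case ud: (G u d); first by apply: noW; rewrite sy.
  by have [|y [_ _ _]] := far_nonwhite Ku L2u; rewrite ?ud.
have iso_d u : K u -> iso2 G u -> G u d.
  move=> Ku /andP[L2u /nbP noL2]; apply/negPn/negP => ud.
  have [y [uy yc Wy Wu]] := far_nonwhite Ku L2u ud.
  have [x ux Wx] := mate Wy (etrans (sy _ _) uy).
  case: (tri (K_adj ux Ku)) => [e|xc|L2x].
  - by have [_ /negP] := L2N Ku L2u; rewrite -e ux.
  - by move: Wx; rewrite WL1 // negbK => /eqP e; rewrite -e ux in ud.
  - by apply: noL2; exists x.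
have priv s z : K s -> L2 G s -> G s d -> G s z -> K z -> L2 G z -> private s.
  move=> Ks L2s sd sz Kz L2z y s_y yc; apply/eqP/negPn/negP; rewrite -WL1 // => Wy.
  have e : d = z by apply: (W_uniq Wy _ sd Wd sz (WL2 z Kz L2z)); rewrite sy.
  by have [_ /negP] := L2N Kz L2z; rewrite -e dc.
have sub y : iso2 G y -> L2 G y by case/andP.
case: (pickP (fun s => [&& L s == L c, L2 G s, G s d & nb G (L2 G) s])).
  move=> s /and4P[/eqP Ks L2s sd /[dup] nbs /nbP[s2 ss2 L2s2]].
  have privs := priv s s2 Ks L2s sd ss2 (K_adj ss2 Ks) L2s2.
  have [a [qa Ka L2a /(_ s Ks L2s nbs) /nbP[b0 ab0 L2b0]]] := q_ex Ks L2s.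
  have qE u : K u -> nb G (hub G) u = G u a := nbK qa Ka.
  have Kb0 := K_adj ab0 Ka.
  have [b hb Kb] : exists2 b, hub' G b & K b.
    by apply: (cpickK (u := b0)) => //; rewrite L2b0 qE // sy.
  have /andP[L2b] := cpick_sub hb; rewrite qE // => ba.
  have ab : G a b by rewrite sy.
  case ad: (G a d).
    exact: (solved_up (j := 3) isT erefl qa Ka ad (priv a b Ka L2a ad ab Kb L2b)).
  case bd: (G b d).
    exact: (solved_up (j := 4) isT erefl hb Kb bd (priv b a Kb L2b bd ba Ka L2a)).
  have [y [ay yc Wy _]] := far_nonwhite Ka L2a (negbT ad).
  have sa : G s a by apply: (not_far_private qa) => //; rewrite ad.
  have e : s = b.
    by apply: (W_uniq Wy _ _ (WL2 s Ks L2s) ab (WL2 b Kb L2b)); rewrite sy // sy.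
  by rewrite -e sd in bd.
move=> none.
have isoE y : K y -> L2 G y -> G d y = iso2 G y.
  move=> Ky L2y; apply/idP/idP => [dy|/(iso_d y Ky)]; last by rewrite sy.
  by rewrite /iso2 L2y; apply/negP => h; move: (none y); rewrite Ky eqxx L2y sy dy h.
have hd : L1 G d && exactly G (L2 G) (iso2 G) d.
  by rewrite L1K // dc; apply/(exactlyP noP5 sub Kd).
have [a' ha' e'] := kargmin_ex (p := fun u => L1 G u && exactly G (L2 G) (iso2 G) u) L (wdeg G w) hd.
have [a ha e] := cpick_ex G ha'.
have Ka : K a by rewrite e e'.
have /andP[/andP[L1a /(exactlyP noP5 sub Ka) isoEa] /forallP/(_ d)] := cpick_sub ha.
rewrite hd Kd Ka eqxx /= => le.
have ac : G a c by rewrite -L1K.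
pose N0 u := (u == c) || L2 G u.
have N0L1 u : G u c -> ~~ N0 u.
  move=> uc; rewrite /N0 L2K ?K_L1 // uc andbF orbF.
  by apply: contraTneq uc => ->; rewrite irr.
have nonwhite u : K u -> ~~ paint_at (pat 1) a u = N0 u || (u == a).
  move=> Ku; rewrite /paint_at /= andbF if_same !andbF /= orbF.
  have [->|ua] := eqVneq u a; first by rewrite orbT.
  rewrite andbT orbF; case: (tri Ku) => [->|uc|L2u]; first by rewrite irr /N0 eqxx.
    by rewrite uc (negPf (N0L1 u uc)).
  by rewrite /N0 L2u orbT; case: (L2N Ku L2u).
have nonwhiteW u : K u -> ~~ W u = N0 u || (u == d).
  move=> Ku; case: (tri Ku) => [->|uc|L2u]; first by rewrite Wc /N0 eqxx.
    by rewrite WL1 // negbK (negPf (N0L1 u uc)).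
  by rewrite WL2 // /N0 L2u orbT.
have nbrN0 x y : G x c -> G x y -> N0 y.
  move=> xc xy; case: (tri (K_adj xy (K_L1 xc))) => [->|yc|L2y].
  - by rewrite /N0 eqxx.
  - by have := indep xc yc; rewrite xy.
  - by rewrite /N0 L2y orbT.
apply: (@solved_twin 1 8 _ a N0 d _ _ erefl ha Ka Kd) => //; try exact: N0L1.
- by move=> y; apply: nbrN0.
- by move=> y; apply: nbrN0.
move=> u y Ku; rewrite -[paint_at _ _ u]negbK nonwhite // negb_or => /andP[uN0 ua] uy.
have uc : G u c.
  by case: (tri Ku) uN0 => [->|//|L2u]; rewrite /N0 ?eqxx // L2u orbT.
have Ky := K_adj uy Ku; have N0y := nbrN0 u y uc uy.
rewrite nonwhite // N0y; split=> //.
have one p x : G y x -> p x -> (forall z, G y z -> p z -> z = x) -> cnt G p y = 1%N.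
  move=> yx px un; apply: (@eq_card1 _ x) => z; rewrite !inE; apply/andP/eqP => [[yz pz]|-> //].
  exact: un.
have anw : predC (paint_at (pat 1) a) a by rewrite /= nonwhite // eqxx orbT.
(* The center and the isolated vertices of L2 have [a] as their only nonwhite neighbour; the other
   vertices of L2 see neither [a] nor [d], so their counts are those for [W]. *)
case: (tri Ky) => [yc|yc|L2y]; last first.
- have [iy|niy] := boolP (iso2 G y).
    apply: (one _ a) => //; first by rewrite sy isoEa.
    move=> z yz; have Kz := K_adj yz Ky; rewrite /= nonwhite // => /orP[|/eqP //].
    case/orP => [/eqP zc|L2z]; first by have [_ /negP] := L2N Ky L2y; rewrite -zc.
    by have /andP[_ /nbP h] := iy; case: h; exists z.
  have ud : u <> d by move=> e1; rewrite e1 isoE // (negPf niy) in uy.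
  have Wu : W u by rewrite WL1 //; apply/eqP.
  rewrite -[RHS](W_cnt Wu uy); apply: eq_cnt_in => z yz; have Kz := K_adj yz Ky.
  rewrite /= nonwhite // nonwhiteW //.
  have -> : (z == a) = false by apply: contraNF niy => /eqP e1; rewrite -isoEa // -e1 sy.
  by have -> : (z == d) = false by apply: contraNF niy => /eqP e1; rewrite -isoE // -e1 sy.
- by have := indep uc yc; rewrite uy.
rewrite yc in one *; apply: (one _ a) => //; first by rewrite sy.
move=> z cz; have Kz : K z := esym (lab_adj cz); rewrite /= nonwhite // => /orP[|/eqP //].
by rewrite (negPf (N0L1 z _)) // sy.
Qed.

End WhiteNeighbour.

(** A neighbour in L1 of a white vertex has [c] as its only nonwhite neighbour, which makes
    [not_far] applicable. If the hub is white, the white vertices are those of L2 not adjacent to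
    it. If it is not, every white vertex is adjacent to it, and so its only nonwhite neighbour is in
    L1: the white vertices are its neighbours in L2. *)
Lemma solved_no_white_nbr : (forall y, G y c -> ~~ W y) -> solved.
Proof.
move=> WL1.
case: (pickP (fun x => (L x == L c) && W x)) => [x /andP[/eqP Kx Wx]|none]; last first.
  apply: (@solved_uncut 7) => // [|u uc|u Ku _]; first exact/negbTE.
    exact/negbTE/WL1.
  by move: (none u); rewrite Ku eqxx.
have white_L2 u : K u -> W u -> L2 G u.
  move=> Ku Wu; case: (tri Ku) => // [e|uc]; first by rewrite e (negPf Wc) in Wu.
  by have := WL1 u uc; rewrite Wu.
have only_c u y z : W u -> G u y -> G y c -> G y z -> ~~ W z -> z = c.
  by move=> Wu uy yc yz Wz; apply: (W_uniq Wu uy yz Wz yc Wc).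
have c_L2 u : K u -> L2 G u -> c <> u by move=> Ku L2u e; case: (L2N Ku L2u) => /(_ (esym e)).
have [a [qa Ka L2a _]] := q_ex Kx (white_L2 x Kx Wx).
have [Wa|Wa] := boolP (W a).
  apply: (solved_paint (i := 4) (j := 0) (a := a) isT isT erefl qa Ka) => /=.
  - exact/negbTE.
  - by move=> u uc; apply/negbTE/WL1.
  move=> u Ku L2u; case ua: (G u a) => /=; first by apply/negbTE/(W_nbr Wa); rewrite sy.
  apply/negPn/negP => Wu; apply: (not_far qa Ka Ku L2u) => [e||y uy yc].
  - by rewrite e Wa in Wu.
  - by rewrite ua.
  have ync z : G z a -> G z c -> G z y -> False.
    by move=> za zc zy; have := only_c a z y Wa (etrans (sy _ _) za) zc zy (WL1 y yc) => e;
       rewrite e irr in yc.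
  split.
    apply/negP => ya; apply: (c_L2 u Ku L2u); apply/esym.
    by apply: (only_c a y u Wa) => //; rewrite sy.
  by move=> z yz zc; apply/negP => za; apply: (ync z za zc); rewrite sy.
apply: (solved_paint (i := 5) (j := 0) (a := a) isT isT erefl qa Ka) => /=.
- exact/negbTE.
- by move=> u uc; apply/negbTE/WL1.
have near u : K u -> W u -> G u a.
  move=> Ku Wu; apply/negPn/negP => ua.
  apply: (not_far qa Ka Ku (white_L2 u Ku Wu) _ ua) => [e|y uy yc].
    by rewrite e (negPf Wa) in Wu.
  split.
    apply/negP => ya; apply: (c_L2 a Ka L2a); apply/esym.
    exact: (only_c u y a Wu).
  move=> z yz zc; apply/negP => za.
  by have e := only_c u y z Wu uy yc yz (WL1 z zc); rewrite e irr in zc.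
move=> u Ku L2u; case ua: (G u a) => /=; last by apply: contraFF ua => /(near u Ku).
apply/negPn/negP => Wu; have [y [ay yc Ky]] := L2_adj Ka L2a.
have e : u = y.
  by apply: (W_uniq Wx (near x Kx Wx) _ Wu ay (WL1 y yc)); rewrite sy.
by have [_ /negP] := L2N Ku L2u; rewrite e yc.
Qed.

Lemma solved_nonwhite : solved.
Proof.
case: (pickP (fun y => G y c && W y)) => [y0 /andP[y0c Wy0]|none]; last first.
  by apply: solved_no_white_nbr => y yc; move: (none y); rewrite yc => /negbT.
have [d cd Wd] := mate Wy0 y0c; have dc : G d c by rewrite sy.
case: (pickP (fun uy : 'I_n * 'I_n => [&& G uy.1 c, G uy.2 c & G uy.1 uy.2])).
  by move=> [u y] /= /and3P[uc yc uy]; apply: (solved_L1_edge Wy0 y0c dc Wd uc yc uy).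
move=> none; have indep u y : G u c -> G y c -> ~~ G u y.
  by move=> uc yc; move: (none (u, y)); rewrite /= uc yc => /negbT.
have [/nbP[x dx Wx]|noW] := boolP (nb G W d).
  exact: (solved_d_yellow Wy0 y0c dc Wd indep dx Wx).
apply: (solved_d_black Wy0 y0c dc Wd indep) => x dx.
by apply: contra noW => Wx; apply/nbP; exists x.
Qed.

End CenterNonwhite.

Lemma component_solved : solved.
Proof. by have [/solved_white|/solved_nonwhite] := boolP (W c). Qed.

End Component.

(** * Perfect edge dominating sets and their uncovered vertices *)

Section Domination.
Variables (n : nat) (G : sgraph 'I_n).
Implicit Types (u v x y : 'I_n) (W : pred 'I_n) (f g : {set 'I_n}) (P : {set {set 'I_n}}).

Definition kept W : {set {set 'I_n}} := [set f in edges G | [forall u in f, ~~ W u]].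
Definition uncovered P : pred 'I_n := fun v => [forall f in P, v \notin f].

Lemma edgesP f : f \in edges G -> exists x y, G x y /\ f = [set x; y].
Proof. by rewrite inE => /existsP[x /existsP[y /andP[xy /eqP ->]]]; exists x, y. Qed.

Lemma kept_pair W x y : ([set x; y] \in kept W) = [&& G x y, ~~ W x & ~~ W y].
Proof.
rewrite inE edges_sym; congr (_ && _); apply/forall_inP/andP => [h|[nx ny] u].
  by split; apply: h; rewrite ?set21 ?set22.
by rewrite !inE => /orP[]/eqP ->.
Qed.

Lemma uncoveredP P v : reflect (exists2 f, f \in P & v \in f) (~~ uncovered P v).
Proof.
apply: (iffP forallPn) => [[f]|[f fP vf]]; last by exists f; rewrite fP vf.
by rewrite negb_imply negbK => /andP[fP vf]; exists f.
Qed.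

Lemma dominates_pair g x y : dominates g [set x; y] = (x \in g) || (y \in g).
Proof.
apply/set0Pn/orP => [[z]|[]h]; last 2 first.
- by exists x; rewrite !inE h eqxx.
- by exists y; rewrite !inE h eqxx orbT.
by rewrite !inE => /andP[zg /orP[]/eqP <-]; [left | right].
Qed.

Section FromDomination.
Variable P : {set {set 'I_n}}.
Hypothesis ped : perfect_edge_dominating G P.

Let subP f : f \in P -> f \in edges G.
Proof. by have /andP[/subsetP] := ped => h _; apply: h. Qed.

Let dom1 x y g g' : G x y -> [set x; y] \notin P -> g \in P -> g' \in P ->
  dominates g [set x; y] -> dominates g' [set x; y] -> g = g'.
Proof.
move=> xy fP gP g'P dg dg'; have /andP[_ /forall_inP h] := ped.
have := h [set x; y]; rewrite inE fP edges_sym xy => /(_ isT)/cards1P[g0 e].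
have : g \in [set g0] by rewrite -e inE gP.
have : g' \in [set g0] by rewrite -e inE g'P.
by rewrite !inE => /eqP -> /eqP ->.
Qed.

(** Were this edge outside [P], the edges of [P] covering [x] and [y] would both dominate it, hence
    coincide, and then be this very edge. *)
Lemma covered_edge x y : G x y -> ~~ uncovered P x -> ~~ uncovered P y -> [set x; y] \in P.
Proof.
move=> xy /uncoveredP[g gP xg] /uncoveredP[g' g'P yg']; apply/negPn/negP => fP.
have e : g = g' by apply: (dom1 xy fP gP g'P); rewrite dominates_pair ?xg ?yg' ?orbT.
subst g'; have [a [b [ab gE]]] := edgesP (subP gP).
move: xg yg'; rewrite gE !inE => xg yg'.
have ne : x != y by apply: contraTneq xy => ->; rewrite adj_irr.
move: fP; rewrite (_ : [set x; y] = g) ?gP //; rewrite gE.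
case/orP: xg => /eqP ex; case/orP: yg' => /eqP ey; rewrite ex ey ?eqxx // in ne *.
by rewrite setUC.
Qed.

Lemma uncovered_kept : P = kept (uncovered P).
Proof.
apply/setP => f; apply/idP/idP => [fP|].
  rewrite inE subP //=; apply/forall_inP => u uf; apply/uncoveredP; by exists f.
move=> fk; have : f \in edges G by move: fk; rewrite inE => /andP[].
by move=> /edgesP[x [y [xy fE]]]; move: fk; rewrite fE kept_pair => /and3P[_]; apply: covered_edge.
Qed.

(** An edge [u y] is outside [P], so a single edge [y z] of [P] dominates it. Any covered neighbour
    [x] of [y] gives an edge [y x] of [P], which also dominates [u y]; hence [x] is [z]. *)
Lemma uncovered_good u : ~~ bad G (uncovered P) u.
Proof.
apply/negP => /andP[Wu /nbP[y uy]].
have notP g : g \in P -> u \notin g by move: Wu => /forall_inP; apply.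
have fP : [set u; y] \notin P by apply/negP => /notP; rewrite set21.
have /andP[_ /forall_inP h] := ped.
have := h [set u; y]; rewrite inE fP edges_sym uy => /(_ isT)/cards1P[g e].
have : g \in [set g] by rewrite inE.
rewrite -{1}e inE dominates_pair => /andP[gP]; rewrite (negPf (notP g gP)) /= => yg.
have -> /= : uncovered P y = false by apply/negbTE/uncoveredP; exists g.
have [a [b [ab gE]]] := edgesP (subP gP).
have [z [yz gE']] : exists z, G y z /\ g = [set y; z].
  move: yg; rewrite gE !inE => /orP[]/eqP ey; first by exists b; rewrite ey.
  by exists a; rewrite ey adj_sym ab setUC.
apply/negP; rewrite negbK; apply/eqP/(@eq_card1 _ z) => x; rewrite !inE.
apply/andP/eqP => [[yx Wx]|->].
  have xP : [set y; x] \in P by apply: covered_edge => //; apply/uncoveredP; exists g.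
  have e2 : [set y; x] = g by apply: (dom1 uy fP xP gP); rewrite dominates_pair ?set21 ?yg orbT.
  move: e2; rewrite gE' => /set2_inj[[] //|[-> ->] //].
by split=> //; apply/uncoveredP; exists g; rewrite // gE' set22.
Qed.

End FromDomination.

(** An edge left out has an end [x] in [W], which no kept edge contains; the kept edges at its other
    end [y] all lead to the only neighbour of [y] outside [W]. *)
Lemma kept_dominating W : (forall u, ~~ bad G W u) -> perfect_edge_dominating G (kept W).
Proof.
move=> good; apply/andP; split; first by apply/subsetP => f; rewrite inE => /andP[].
apply/forall_inP => f; rewrite inE => /andP[fk /edgesP[x [y [xy fE]]]].
wlog Wx : x y xy fE / W x.
  move=> base; move: fk; rewrite fE kept_pair xy /= negb_and !negbK => /orP[Wx|Wy].
    by rewrite -fE; apply: (base x y).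
  by rewrite -fE; apply: (base y x); rewrite ?fE 1?setUC // adj_sym.
have Wy := W_nbr good Wx xy.
have [z yz Wz] := mate good Wx xy.
apply/cards1P; exists [set y; z]; apply/setP => g; rewrite inE fE dominates_pair [RHS]inE.
apply/andP/eqP => [[gk]|->]; last by rewrite kept_pair yz Wy Wz set21 orbT.
move: (gk); rewrite inE => /andP[/edgesP[a [b [ab gE]]] /forall_inP nW].
have -> /= : x \in g = false by apply/negP => /nW; rewrite Wx.
have aW : ~~ W a by apply: nW; rewrite gE set21.
have bW : ~~ W b by apply: nW; rewrite gE set22.
rewrite gE !inE => /orP[]/eqP e; subst y.
  by rewrite (W_uniq good Wx xy ab bW yz Wz).
by rewrite setUC (W_uniq good Wx xy (etrans (adj_sym G _ _) ab) aW yz Wz).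
Qed.

End Domination.

(** * Optimality of the selected set *)

Section Best.
Variables (R : realType) (n : nat) (G : sgraph 'I_n) (w : {set 'I_n} -> R).
Implicit Types (u v : 'I_n) (W : pred 'I_n).
Hypothesis noP5 : forall v, ~~ found G (tuples G) v.
Local Notation L := (lab G 3).

Lemma goodK_comp W u v : L u = L v -> goodK G W u = goodK G W v.
Proof. by move=> uv; rewrite /goodK /kex uv. Qed.

Lemma KW_comp W u v : L u = L v -> KW G w W u = KW G w W v.
Proof. by move=> uv; rewrite /KW /kwsum uv. Qed.

Lemma better_local W W' v :
  (goodK G W v && (KW G w W v <= KW G w W' v)%R /\
   forall x, L x = L v -> better G w W W' x = W x) \/
  (~~ (goodK G W v && (KW G w W v <= KW G w W' v)%R) /\
   forall x, L x = L v -> better G w W W' x = W' x).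
Proof.
case b: (goodK G W v && _); [left | right]; split=> // x xv;
by rewrite /better (goodK_comp W xv) (KW_comp W xv) (KW_comp W' xv) b.
Qed.

Lemma best_comp (l : seq (pred 'I_n)) v :
  goodK G (foldr (better G w) xpred0 l) v /\
  forall W, List.In W l -> goodK G W v -> (KW G w (foldr (better G w) xpred0 l) v <= KW G w W v)%R.
Proof.
elim: l => [|W' l [IHg IHw]]; first by split=> //; apply/existsP => -[u /andP[]].
rewrite [foldr _ _ _]/=; set b := foldr _ _ _ in IHg IHw *.
have [[/andP[g le] e]|[nle e]] := better_local W' b v.
  rewrite (goodK_local noP5 e) (KW_local w noP5 e); split=> // W [<- //|inW gW].
  exact: le_trans le (IHw W inW gW).
rewrite (goodK_local noP5 e) (KW_local w noP5 e); split=> // W [<- gW|]; last exact: IHw.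
by move: nle; rewrite gW -ltNge => /ltW.
Qed.

Lemma best_good v : ~~ bad G (best G w) v.
Proof.
have [g _] := best_comp (whites G w) v.
by apply: contraL g => b; rewrite /goodK negbK; apply/existsP; exists v; rewrite eqxx.
Qed.

(** By [center_ex], a component without a center has no edge. *)
Lemma KW_isolated W v : ~~ kex L (center G) v -> KW G w W v = 0%R.
Proof.
move=> noc; apply: big1 => u /andP[/eqP uv _]; apply: big1 => y /andP[uy _].
have [c hc cu] := center_ex noP5 uy.
by case/existsP: noc; exists c; rewrite hc cu uv eqxx.
Qed.

Lemma best_min W v : (forall u, ~~ bad G W u) -> (KW G w (best G w) v <= KW G w W v)%R.
Proof.
move=> good; have [/existsP[c /andP[/eqP cv hc]]|noc] := boolP (kex L (center G) v).
  rewrite -!(KW_comp _ cv); have [W' [inW' gW' le]] := component_solved w noP5 hc good.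
  by apply: le_trans le; apply: (best_comp (whites G w) c).2.
by rewrite !KW_isolated.
Qed.

Lemma lab_lt v : (L v < n)%N.
Proof.
have [r [y1 [y2 [/eqP rr s1 s2 s3]]]] := reach noP5 v.
by rewrite -(reach_comp noP5 s3) -(reach_comp noP5 s2) -(reach_comp noP5 s1) rr.
Qed.

Lemma total_le W W' : (forall v, KW G w W v <= KW G w W' v)%R ->
  (\sum_(u | ~~ W u) wsum G w (predC W) u <= \sum_(u | ~~ W' u) wsum G w (predC W') u)%R.
Proof.
(* Labels are vertex numbers, so they index the splitting of the sum into components. *)
move=> le; pose rt u := Ordinal (lab_lt u).
rewrite (partition_big rt predT) // [leRHS](partition_big rt predT) //=.
apply: ler_sum => r _.
have rtE u : (rt u == r) = (L u == r) by [].
case: (pickP (fun v => L v == r)) => [v /eqP vr|none]; last first.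
  by rewrite !big_pred0 // => u; rewrite rtE none andbF.
have KWE W0 : (\sum_(u | ~~ W0 u && (rt u == r)) wsum G w (predC W0) u)%R = KW G w W0 v.
  by apply: eq_bigl => u; rewrite rtE vr andbC.
by rewrite !KWE.
Qed.

End Best.

(** * From sums over components to weights, and conclusion *)

Lemma weight_kept (R : realType) (I : inst R) (W : pred 'I_(isz I)) :
  (weight (@iwt R I) (kept (igr I) W) *+ 2 =
   \sum_(u | ~~ W u) wsum (igr I) (@iwt R I) (predC W) u)%R.
Proof.
pose F (x y : 'I_(isz I)) := if ~~ W x && ~~ W y then iwt [set x; y] else 0%R.
have -> : (\sum_(u | ~~ W u) wsum (igr I) (@iwt R I) (predC W) u =
           \sum_u \sum_(y | igr I u y) F u y)%R.
  rewrite big_mkcond; apply: eq_bigr => u _; rewrite /wsum /F.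
  by case: (W u) => /=; [rewrite big1 | rewrite big_mkcondr].
have -> : (\sum_u \sum_(y | igr I u y) F u y = \sum_(p <- arcs I) F p.1 p.2)%R.
  rewrite [RHS](partition_big (fun p => p.1) predT) //=; apply: eq_bigr => u _.
  by rewrite -(big_arcs +%R u F).
have half : (\sum_(p <- ies I) F p.1 p.2 = weight (@iwt R I) (kept (igr I) W))%R.
  rewrite /weight (eq_bigl (fun f => (f \in edges (igr I)) && [forall u in f, ~~ W u])); last first.
    by move=> f; rewrite in_set.
  rewrite big_mkcondr -[RHS]big_enum /= -(perm_big _ (iok I)) big_map; apply: eq_bigr => p _.
  rewrite /F /edge_of; congr (if _ then _ else _); apply/andP/forall_inP => [[n1 n2] u|h].
    by rewrite !inE => /orP[]/eqP ->.
  by split; apply: h; rewrite ?set21 ?set22.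
rewrite /arcs big_cat big_map /= mulr2n -half; congr (_ + _)%R.
by apply: eq_bigr => p _; rewrite /F andbC setUC.
Qed.

Theorem theorem24 (R : realType) :
  exists (prog : cmd) (C : nat),
    forall (n : nat) (G : sgraph 'I_n) (w : {set 'I_n} -> R)
           (es : seq ('I_n * 'I_n)),
      edge_list G es ->
      exists (s : state R) (t : nat),
        exec prog (input_state es w) s t /\
        (t <= C * (n + #|edges G|).+1)%N /\
        correct_output G es w s.
Proof.
have [c [C run]] := output_exec (cb_found_tuples R) (cb_best R)
  (fun i (_ : (i < 5)%N) => cb_select_tuples R i).
exists c, C => n G w es ok; pose I := Inst w ok.
have [s [t [ex le out]]] := run I.
exists s, t; split=> //; split.
  have -> : #|edges G| = size es by rewrite cardE -(perm_size ok) size_map.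
  exact: le.
move: out; rewrite /correct_output /output_kind.
case: eqP => [fl0 [-> out]|fl1 [-> out]] /=.
  (* The tests on tuples use the constant key only, so the flag read at vertex 0 is valid for all
     vertices. *)
  have noP5 v : ~~ found G (tuples G) v.
    have n0 : (0 < n)%N by apply: leq_ltn_trans (ltn_ord v).
    have := fl0; rewrite (vget_lt 0%N _ n0) => /eqP; rewrite eqb0; apply: contra.
    by rewrite (_ : found G (tuples G) v = found G (tuples G) (Ordinal n0)).
  have outE : output_edges es s = kept G (best G w).
    have es_adj p : p \in es -> G p.1 p.2.
      by move=> pes; have [_ <-] := arcs_uniq I; rewrite mem_cat pes.
    have bitE p : p \in es ->
        (narr s 2 (index p es) != 0%N) = ~~ best G w p.1 && ~~ best G w p.2.
      move=> pes; rewrite out ?index_mem // eqb0 negbK.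
      by rewrite /ends !(nth_map p) ?index_mem // nth_index // !vget_val.
    apply/setP => f; apply/imsetP/idP => [[p]|fk].
      rewrite inE => /andP[pes]; rewrite (bitE p pes) => nW ->.
      by rewrite /edge_of kept_pair es_adj.
    have : f \in edges G by move: fk; rewrite in_set => /andP[].
    rewrite -mem_enum -(perm_mem ok) => /mapP[p pes fE]; exists p => //.
    move: fk; rewrite fE /edge_of kept_pair => /and3P[_ n1 n2].
    rewrite inE; apply/andP; split; first exact: pes.
    by rewrite (bitE p pes); apply/andP; split; [exact: n1 | exact: n2].
  rewrite outE; split; first by apply: kept_dominating; apply: best_good.
  move=> Q ped; rewrite (uncovered_kept ped).
  (* The sums over vertices count each edge twice, so doubled weights are compared. *)
  rewrite -(ler_pMn2r (n := 2)) // (@weight_kept R I) (@weight_kept R I).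
  apply: total_le => // v; apply: best_min => // u; exact: uncovered_good.
have n0 : (0 < n)%N by rewrite lt0n; apply/eqP => n0; apply: fl1; apply: vget_ge; apply/eq_leq/n0.
have fl : found G (tuples G) (Ordinal n0).
  by move/eqP: fl1; rewrite (vget_lt 0%N _ n0) eqb0 negbK.
have [l P5 selE] := select_found fl.
have [f [emb fP]] := isP5_sound P5.
exists f; split=> // i; rewrite (out i (ltn_ord i)); apply/eqP; rewrite eqn_leq.
apply/andP; split.
  by apply/bigop.bigmax_leqP => u; rewrite selE => tu; rewrite (gpick_uniq tu (fP i)).
by apply: (bigop.bigmax_sup (f i)); rewrite // selE.
Qed.
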